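(* Let $\{\lambda_n\}_{n=0}^\infty$ be the eigenvalues of the non-local boundary value problem $$-\phi''=\lambda\phi \ \text{ on } (0,1),\qquad \phi(0)+\phi(1)=-\phi'(0)=\phi'(1),$$ and let $K_p(x,y)$ be the $p$-th iterated kernel of $K(x,y)=-|x-y|/2$ on $[0,1]\times[0,1]$. Then for every integer $p\ge 1$, $$\sum_{n=0}^\infty\frac{1}{\lambda_n^p}=\int_0^1K_p(x,x)\,dx=\frac{1}{4^p}\left(S_{2p}+\frac{(-1)^p}{\alpha^{2p}}\right)+\frac{4^p-1}{2\cdot(2p)!}\,|B_{2p}|,$$ where $$S_{2p}:=\sum_{m=1}^\infty\frac{1}{x_m^{2p}}=\sum_{m=1}^\infty\left(\frac{4}{\lambda_{2m}}\right)^p .$$ Moreover, $S_{2p}$ satisfies the following recursion formula: for every integer $n\ge 0$, $$\sum_{\ell=1}^{n+1}\frac{(-1)^{n-\ell+1}\bigl(2(n-\ell+1)-1\bigr)}{\bigl(2(n-\ell+1)\bigr)!}\left\{S_{2\ell}+\frac{(-1)^\ell}{\alpha^{2\ell}}\right\}=\frac{(-1)^n}{2\,(2n)!}.$$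
   Context: The eigenvalues $\{\lambda_n\}_{n\ge 0}$ are explicitly the following (each listed once): $\lambda_0<0$ is the only negative eigenvalue ($\lambda_0\approx-5.756915$) and is the solution of $\coth\frac{\sqrt{-\lambda_0}}{2}=\frac{\sqrt{-\lambda_0}}{2}$; $\lambda_{2m-1}=(2m-1)^2\pi^2$ for $m=1,2,\ldots$; and, for $m=1,2,\ldots$, $\lambda_{2m}>0$ is the $m$-th positive solution of $\cot\frac{\sqrt{\lambda_{2m}}}{2}=-\frac{\sqrt{\lambda_{2m}}}{2}$. The corresponding eigenfunctions are those of the integral operator on $L^2(0,1)$ with kernel $K(x,y)$, whose eigenvalues are $1/\lambda_n$. The number $x_m=\sqrt{\lambda_{2m}}/2>0$ is the $m$-th positive zero of $\cot x=-x$. The number $\alpha=\sqrt{-\lambda_0}/2\approx1.19967864$ is the positive solution of $\alpha=\coth\alpha$, so $\lambda_0=-4\alpha^2$. The iterated kernels are defined by $K_1=K$ and $K_{p+1}(x,y)=\int_0^1K_p(x,z)K(z,y)\,dz$ for $p\ge1$. The Bernoulli numbers $B_n$ are defined by $\frac{x}{e^x-1}=\sum_{n=0}^\infty\frac{B_n}{n!}x^n$. *)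

(* Defs.v *)
From Stdlib Require Import Reals Factorial.
From Coquelicot Require Import Coquelicot.
Open Scope R_scope.

Definition cot (t : R) : R := cos t / sin t.
Definition coth (t : R) : R := cosh t / sinh t.

(* Derivative at a point of [0,1] of a function regarded as a function on
   [0,1] only: one-sided at 0 and at 1, two-sided in between. *)
Definition is_derive_unit (f : R -> R) (t l : R) : Prop :=
  filterlim (fun s => (f s - f t) / (s - t))
    (within (fun s => 0 <= s <= 1) (locally' t)) (locally l).

Definition bvp_eigenvalue (mu : R) : Prop :=
  exists phi dphi d2phi : R -> R,
    (forall t, 0 <= t <= 1 -> is_derive_unit phi t (dphi t)) /\
    (forall t, 0 < t < 1 -> is_derive dphi t (d2phi t)) /\
    (forall t, 0 < t < 1 -> - d2phi t = mu * phi t) /\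
    phi 0 + phi 1 = - dphi 0 /\
    - dphi 0 = dphi 1 /\
    (exists t, 0 <= t <= 1 /\ phi t <> 0).

(* u k, u (k+1), ... lists the elements of P in increasing order, each once;
   the values of u below index k are unconstrained. *)
Definition increasing_enum (k : nat) (u : nat -> R) (P : R -> Prop) : Prop :=
  (forall n, (k <= n)%nat -> u n < u (S n)) /\
  (forall t, P t <-> exists n, (k <= n)%nat /\ u n = t).

(* The condition on the sine excludes the poles, where the total function
   cot takes a conventional value. *)
Definition positive_cot_root (t : R) : Prop :=
  0 < t /\ sin t <> 0 /\ cot t = - t.

(* The series is required to converge to x / (e^x - 1) on some punctured
   neighbourhood of 0, which determines B; x = 0 is left out because the
   quotient is not defined there. *)
Definition bernoulli_numbers (B : nat -> R) : Prop :=
  exists r, 0 < r /\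
    forall x, 0 < Rabs x < r ->
      is_series (fun n => B n / INR (fact n) * x ^ n) (x / (exp x - 1)).

Definition kernel (x y : R) : R := - Rabs (x - y) / 2.

(* Indexed from 1; the value at p = 0 is a dummy. *)
Fixpoint iterK (p : nat) (x y : R) : R :=
  match p with
  | O => 0
  | S O => kernel x y
  | S q => RInt (fun z => iterK q x z * kernel z y) 0 1
  end.

(* The sum over m >= 1 of 1 / (x m)^q. *)
Definition root_power_sum (x : nat -> R) (q : nat) : R :=
  Series (fun k => / x (S k) ^ q).

(* Main.v *)
Require Import Defs.
From Stdlib Require Import Reals Factorial Arith ZArith Lra Lia Psatz.
From Coquelicot Require Import Coquelicot.
Open Scope R_scope.

(** The integral operator with kernel [K] inverts the boundary value problem
    ([kernel_inverts], [eigenpair_kernel]). Let [psi n] be the eigenfunction for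
    [lambda n], scaled to 1 at the left end point. Its value at the right end
    point is [(-1)^n], and a virial identity shows that its squared norm is [1/2]
    for every [n] ([eigenpair_norm]). Everything rests on the expansion
    [K(x, y) = sum_n 2 psi_n(x) psi_n(y) / lambda_n] ([mercer]).

    The expansion is proved without spectral theory. The gap in Bessel's
    inequality for the section [K(x, .)] is a non-negative continuous function of
    [x], and its integral is [1/24 - sum_n 1 / lambda_n^2], because [1/24] is the
    squared Hilbert-Schmidt norm of [K]. So it suffices that
    [sum_n 1 / lambda_n^2 >= 1/24] ([bessel_gap_zero]). The square roots of the
    eigenvalues are twice the zeros of [cos x] and of [cos x + x sin x], the latter
    including [+- i alpha] ([eigenvalues_explicit]). With [t = x / N], these
    functions are limits of the polynomials [Re (1 + i t)^N] and
    [Re (1 - i N t) (1 + i t)^N], whose inverse roots have power sums given by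
    Vieta. The approximate roots are [N tan (y / N)] with [y] at least the true zero,
    and [N tan (y / N) >= y], so the finite sums bound the infinite ones from below
    ([odd_power_sum_lower_bound], [even_power_sum_lower_bound]).

    The expansion is preserved by iteration, each step dividing the [n]-th
    coefficient by [lambda_n] ([iterK_expansion]); integrating it on the diagonal
    gives the trace formula ([iterK_trace]).

    For the recursion, the functions [K(0, z) + K(1, z) = - 1/2] and
    [K(0, z) - K(1, z) = 1/2 - z] involve eigenfunctions of one parity only.
    Integrating them against the polynomials [(z - 1/2)^k / k!], both directly and
    through the expansion, and applying Green's formula repeatedly, gives a finite
    linear relation between the power sums of one parity ([parity_recursion]). The
    even case is the recursion to be proved. The odd case, with [i t] for [t], is
    the relation [cosh (t/2) * T(t) = (t/4) sinh (t/2)] between power series,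
    satisfied by [T(t) = (t/4) tanh (t/2)], whose coefficients are multiples of the
    Bernoulli numbers; this evaluates the sums over the odd eigenvalues
    ([odd_sum_bernoulli]). *)

(** * Increasing enumerations and the zeros of cos t + t sin t *)

Lemma increasing_enum_lt (k : nat) (u : nat -> R) (P : R -> Prop) :
  increasing_enum k u P ->
  forall i j, (k <= i)%nat -> (i < j)%nat -> u i < u j.
Proof.
  intros [Hinc _] i j Hi Hij. induction j as [|j IH]; [lia|].
  destruct (Nat.eq_dec i j) as [->|Hne].
  - apply Hinc; lia.
  - apply Rlt_trans with (u j); [apply IH; lia | apply Hinc; lia].
Qed.

(** At the first index where two enumerations of the same set differ, the value
    of the first one must occur later in the second one, so it is not smaller. *)
Lemma increasing_enum_first_difference (k : nat) (u v : nat -> R) (P : R -> Prop) (n : nat) :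
  increasing_enum k u P -> increasing_enum k v P -> (k <= n)%nat ->
  (forall i, (k <= i)%nat -> (i < n)%nat -> u i = v i) -> v n <= u n.
Proof.
  intros Hu Hv Hn IH.
  assert (HP : P (u n)) by (apply (proj2 Hu); exists n; auto).
  apply (proj2 Hv) in HP. destruct HP as [m [Hm Em]].
  destruct (lt_eq_lt_dec m n) as [[H|H]|H].
  - rewrite <- IH in Em by lia.
    pose proof (increasing_enum_lt _ _ _ Hu m n Hm H). lra.
  - subst m. lra.
  - pose proof (increasing_enum_lt _ _ _ Hv n m Hn H). lra.
Qed.

Lemma increasing_enum_unique (k : nat) (u v : nat -> R) (P : R -> Prop) :
  increasing_enum k u P -> increasing_enum k v P ->
  forall n, (k <= n)%nat -> u n = v n.
Proof.
  intros Hu Hv n. induction n as [n IH] using (well_founded_induction lt_wf). intros Hn.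
  apply Rle_antisym.
  - apply (increasing_enum_first_difference k v u P n); auto.
    intros; symmetry; auto.
  - apply (increasing_enum_first_difference k u v P n); auto.
Qed.

Lemma cos_add_INR_PI (n : nat) (s : R) : cos (INR n * PI + s) = (-1) ^ n * cos s.
Proof.
  induction n as [|n IH].
  - simpl. rewrite Rmult_0_l, Rplus_0_l. ring.
  - rewrite S_INR. replace ((INR n + 1) * PI + s) with (INR n * PI + s + PI) by ring.
    rewrite neg_cos, IH. simpl. ring.
Qed.

Lemma sin_add_INR_PI (n : nat) (s : R) : sin (INR n * PI + s) = (-1) ^ n * sin s.
Proof.
  induction n as [|n IH].
  - simpl. rewrite Rmult_0_l, Rplus_0_l. ring.
  - rewrite S_INR. replace ((INR n + 1) * PI + s) with (INR n * PI + s + PI) by ring.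
    rewrite neg_sin, IH. simpl. ring.
Qed.

Lemma pow_m1_sq (n : nat) : (-1) ^ n * (-1) ^ n = 1.
Proof. rewrite <- Rpow_mult_distr. replace (-1 * -1) with 1 by ring. apply pow1. Qed.

(** Multiplying [cot t = - t] by [sin t] removes the poles: the positive
    solutions are the positive zeros of this entire function. *)
Definition even_char (t : R) : R := cos t + t * sin t.

Lemma positive_cot_root_iff (t : R) :
  positive_cot_root t <-> 0 < t /\ even_char t = 0.
Proof.
  unfold positive_cot_root, cot, even_char. split.
  - intros [H [Hs Hc]]. split; auto.
    replace (cos t) with (cos t / sin t * sin t) by (field; auto). rewrite Hc; ring.
  - intros [H Hc].
    assert (Hs : sin t <> 0).
    { intros Hs. rewrite Hs in Hc. pose proof (sin2_cos2 t) as E. unfold Rsqr in E.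
      rewrite Hs in E. nra. }
    repeat split; auto. replace (cos t) with (- t * sin t) by lra. field; auto.
Qed.

(** [even_char] moves monotonically between alternating signs on each period,
    because its derivative is [t cos t]. *)
Lemma even_char_increasing (n : nat) (s1 s2 : R) :
  (1 <= n)%nat -> - (PI / 2) <= s1 -> s1 < s2 -> s2 <= PI / 2 ->
  (-1) ^ n * even_char (INR n * PI + s1) < (-1) ^ n * even_char (INR n * PI + s2).
Proof.
  intros Hn H1 H12 H2. pose proof PI_RGT_0 as Hpi.
  destruct (MVT_cor2 (fun s => (-1) ^ n * even_char (INR n * PI + s))
     (fun s => (INR n * PI + s) * cos s) s1 s2 H12) as [c [Hc1 Hc2]].
  { intros c Hc. apply is_derive_Reals. unfold even_char. auto_derive; auto.
    rewrite sin_add_INR_PI, cos_add_INR_PI.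
    transitivity ((-1) ^ n * (-1) ^ n * ((INR n * PI + c) * cos c)); [ring|].
    rewrite pow_m1_sq; ring. }
  cbv beta in Hc1.
  assert (Hc3 : 0 < cos c) by (apply cos_gt_0; lra).
  assert (Hc4 : 1 <= INR n) by (apply (le_INR 1); auto).
  assert (0 < (INR n * PI + c) * cos c * (s2 - s1)).
  { apply Rmult_lt_0_compat; [apply Rmult_lt_0_compat; auto; nra | lra]. }
  lra.
Qed.

Lemma even_char_shift_end (n : nat) (e : R) :
  (-1) ^ n * even_char (INR n * PI + e) = cos e + (INR n * PI + e) * sin e.
Proof.
  unfold even_char. rewrite sin_add_INR_PI, cos_add_INR_PI.
  transitivity ((-1) ^ n * (-1) ^ n * (cos e + (INR n * PI + e) * sin e)); [ring|].
  rewrite pow_m1_sq; ring.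
Qed.

Lemma even_char_continuous : continuity even_char.
Proof.
  intros t. apply derivable_continuous_pt, ex_derive_Reals_0.
  unfold even_char. auto_derive. auto.
Qed.

Lemma even_char_left (n : nat) : (1 <= n)%nat ->
  (-1) ^ n * even_char (INR n * PI + - (PI / 2)) < 0.
Proof.
  intros Hn. rewrite even_char_shift_end, cos_neg, sin_neg, cos_PI2, sin_PI2.
  pose proof PI_RGT_0. assert (1 <= INR n) by (apply (le_INR 1); auto). nra.
Qed.

Lemma even_char_right (n : nat) : (1 <= n)%nat ->
  0 < (-1) ^ n * even_char (INR n * PI + PI / 2).
Proof.
  intros Hn. rewrite even_char_shift_end, cos_PI2, sin_PI2.
  pose proof PI_RGT_0. assert (1 <= INR n) by (apply (le_INR 1); auto). nra.
Qed.

Lemma even_char_root_exists (n : nat) : (1 <= n)%nat ->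
  {t | INR n * PI - PI / 2 < t < INR n * PI + PI / 2 /\ even_char t = 0}.
Proof.
  intros Hn. pose proof PI_RGT_0 as Hpi.
  pose proof (even_char_left n Hn) as HL. pose proof (even_char_right n Hn) as HR.
  destruct (IVT_cor even_char (INR n * PI + - (PI / 2)) (INR n * PI + PI / 2))
    as [z [Hz Ez]].
  - apply even_char_continuous.
  - lra.
  - assert (E := pow_m1_sq n). nra.
  - exists z. split; auto. split.
    + destruct (Req_dec z (INR n * PI + - (PI / 2))) as [->|]; [rewrite Ez in HL|]; lra.
    + destruct (Req_dec z (INR n * PI + PI / 2)) as [->|]; [rewrite Ez in HR|]; lra.
Qed.

Lemma even_char_pos_small (t : R) : 0 < t -> t <= PI / 2 -> 0 < even_char t.
Proof.
  intros H1 H2. unfold even_char.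
  assert (0 <= cos t) by (apply cos_ge_0; lra).
  assert (0 < sin t) by (apply sin_gt_0; pose proof PI_RGT_0; lra). nra.
Qed.

Lemma nearest_multiple_PI (t : R) : 0 < t ->
  exists n, INR n * PI - PI / 2 < t <= INR n * PI + PI / 2.
Proof.
  intros Ht. pose proof PI_RGT_0 as Hpi.
  set (v := t / PI - / 2).
  assert (Hv : t = (v + / 2) * PI) by (unfold v; field; lra).
  assert (Hv0 : - / 2 < v) by (assert (0 < t / PI) by (apply Rdiv_lt_0_compat; lra); unfold v; lra).
  destruct (Rle_dec v 0) as [Hle|Hgt].
  - exists O. simpl. nra.
  - (* [1 - up (- v)] is the ceiling of [v]. *)
    destruct (archimed (- v)) as [A1 A2].
    assert (Hz : (0 <= 1 - up (- v))%Z) by (apply le_IZR; rewrite minus_IZR; lra).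
    exists (Z.to_nat (1 - up (- v))).
    rewrite INR_IZR_INZ, Z2Nat.id, minus_IZR by auto.
    rewrite Hv. split; nra.
Qed.

(** Existence on each period and strict monotonicity there: the [n]-th root is
    the one nearest to [n PI]. *)
Lemma root_location (x : nat -> R) :
  increasing_enum 1 x positive_cot_root ->
  forall n, (1 <= n)%nat ->
    INR n * PI - PI / 2 < x n < INR n * PI + PI / 2 /\ even_char (x n) = 0.
Proof.
  intros Hx. pose proof PI_RGT_0 as Hpi.
  set (y := fun n => match le_dec 1 n with
                     | left H => proj1_sig (even_char_root_exists n H)
                     | right _ => 0 end).
  assert (Hy : forall n, (1 <= n)%nat ->
    INR n * PI - PI / 2 < y n < INR n * PI + PI / 2 /\ even_char (y n) = 0).
  { intros n Hn. unfold y. destruct (le_dec 1 n) as [H|H]; [|lia].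
    destruct (even_char_root_exists n H) as [t Ht]. exact Ht. }
  assert (Hye : increasing_enum 1 y positive_cot_root).
  { split.
    - intros n Hn. pose proof (Hy n Hn). pose proof (Hy (S n) ltac:(lia)).
      rewrite S_INR in *. lra.
    - intros t. rewrite positive_cot_root_iff. split.
      + intros [Ht Et]. destruct (nearest_multiple_PI t Ht) as [n Hn].
        exists n.
        assert (H1 : (1 <= n)%nat).
        { destruct n; [|lia]. simpl in Hn.
          pose proof (even_char_pos_small t Ht ltac:(lra)). lra. }
        split; auto. pose proof (Hy n H1) as [Hb Hb0].
        destruct (Rtotal_order (y n) t) as [H|[H|H]]; auto; exfalso.
        * pose proof (even_char_increasing n (y n - INR n * PI) (t - INR n * PI) H1
            ltac:(lra) ltac:(lra) ltac:(lra)) as M.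
          replace (INR n * PI + (y n - INR n * PI)) with (y n) in M by ring.
          replace (INR n * PI + (t - INR n * PI)) with t in M by ring.
          rewrite Hb0, Et in M. lra.
        * pose proof (even_char_increasing n (t - INR n * PI) (y n - INR n * PI) H1
            ltac:(lra) ltac:(lra) ltac:(lra)) as M.
          replace (INR n * PI + (y n - INR n * PI)) with (y n) in M by ring.
          replace (INR n * PI + (t - INR n * PI)) with t in M by ring.
          rewrite Hb0, Et in M. lra.
      + intros [n [Hn <-]]. pose proof (Hy n Hn) as [Hb Hb0]. split; auto.
        assert (1 <= INR n) by (apply (le_INR 1); auto). nra. }
  intros n Hn. rewrite (increasing_enum_unique 1 x y _ Hx Hye n Hn). auto.
Qed.

(** * Lower bounds for power sums of zeros, by polynomial approximation *)

Definition peval (a : nat -> R) (d : nat) (z : R) : R :=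
  sum_f_R0 (fun k => a k * z ^ k) d.

Fixpoint psum (f : nat -> R) (m : nat) : R :=
  match m with O => 0 | S i => psum f i + f i end.

(** Synthetic division, from the constant term upwards: for a root [r] of the
    polynomial [a], these are the coefficients of the quotient of [a] by
    [1 - z / r]. This normalisation keeps the constant term. *)
Fixpoint deflate (a : nat -> R) (r : R) (k : nat) : R :=
  match k with O => a O | S i => a (S i) + deflate a r i / r end.

Lemma deflate_pow (a : nat -> R) (r : R) (k : nat) :
  r <> 0 -> deflate a r k * r ^ k = peval a k r.
Proof.
  intros Hr. unfold peval. induction k as [|k IH]; [reflexivity|].
  rewrite tech5, <- IH. simpl. field. auto.
Qed.

Lemma deflate_partial (a : nat -> R) (r z : R) (d : nat) : r <> 0 ->
  peval a (S d) z = (1 - z / r) * peval (deflate a r) d z + deflate a r (S d) * z ^ S d.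
Proof.
  intros Hr. unfold peval. induction d as [|d IH].
  - simpl. field. auto.
  - rewrite tech5, IH, (tech5 _ d). simpl. field. auto.
Qed.

Lemma deflate_vanish (a : nat -> R) (r : R) (d : nat) :
  r <> 0 -> peval a (S d) r = 0 -> (forall k, (S d < k)%nat -> a k = 0) ->
  forall k, (d < k)%nat -> deflate a r k = 0.
Proof.
  intros Hr H0 Ha k Hk. induction k as [|k IH]; [lia|].
  destruct (Nat.eq_dec k d) as [->|Hne].
  - pose proof (deflate_pow a r (S d) Hr) as E. rewrite H0 in E.
    apply Rmult_integral in E. destruct E as [E|E]; auto.
    exfalso. apply (pow_nonzero r (S d)); auto.
  - simpl. rewrite IH, Ha by lia. field. auto.
Qed.

(** Known roots are divided out one at a time. The cofactor [h] is kept because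
    the even problem has one root that is not located in advance; the last clause
    serves to bound that root. [a_1^2 - 2 a_2] is Newton's expression for the sum of
    the squares of the inverse roots. *)
Lemma vieta (m : nat) : forall (d : nat) (a r : nat -> R),
  (forall k, (m + d < k)%nat -> a k = 0) -> a O = 1 ->
  (forall i, (i < m)%nat -> 0 < r i /\ peval a (m + d) (r i) = 0) ->
  (forall i j, (i < j)%nat -> (j < m)%nat -> r i <> r j) ->
  exists h : nat -> R,
    (forall k, (d < k)%nat -> h k = 0) /\ h O = 1 /\
    a 1%nat = h 1%nat - psum (fun i => / r i) m /\
    a 1%nat ^ 2 - 2 * a 2%nat = h 1%nat ^ 2 - 2 * h 2%nat + psum (fun i => / r i ^ 2) m /\
    (forall z, z <= 0 -> 0 < peval a (m + d) z -> 0 < peval h d z).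
Proof.
  induction m as [|m IH]; intros d a r Ha Ha0 Hr Hd.
  - exists a. simpl in *. repeat split; auto; ring.
  - destruct (Hr m ltac:(lia)) as [Hrm Em].
    assert (Hm0 : r m <> 0) by lra.
    set (b := deflate a (r m)).
    assert (Hfac : forall z, peval a (S m + d) z = (1 - z / r m) * peval b (m + d) z).
    { intros z. change (S m + d)%nat with (S (m + d)).
      rewrite (deflate_partial a (r m) z (m + d) Hm0).
      rewrite (deflate_vanish a (r m) (m + d) Hm0 Em Ha (S (m + d))) by lia.
      fold b. ring. }
    destruct (IH d b r) as [h [Hh [Hh0 [H1 [H2 H3]]]]].
    + intros k Hk. apply (deflate_vanish a (r m) (m + d)); auto.
    + exact Ha0.
    + intros i Hi. destruct (Hr i ltac:(lia)) as [Hi0 Ei]. split; auto.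
      rewrite Hfac in Ei. apply Rmult_integral in Ei. destruct Ei as [Ei|Ei]; auto.
      exfalso. apply (Hd i m); try lia. apply Rminus_diag_uniq in Ei.
      replace (r i) with (r i / r m * r m) by (field; auto). rewrite <- Ei. ring.
    + intros i j Hij Hj. apply Hd; lia.
    + exists h.
      assert (E1 : a 1%nat = b 1%nat - / r m).
      { unfold b. simpl. rewrite Ha0. field. auto. }
      assert (E2 : a 2%nat = b 2%nat - b 1%nat / r m).
      { unfold b. simpl. field. auto. }
      split; [exact Hh|]. split; [exact Hh0|]. split; [|split].
      * simpl psum. rewrite E1, H1. ring.
      * assert (E : a 1%nat ^ 2 - 2 * a 2%nat = b 1%nat ^ 2 - 2 * b 2%nat + / r m ^ 2).
        { rewrite E1, E2. field. auto. }
        cbn [psum]. rewrite E, H2. ring.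
      * intros z Hz Hp. apply H3; auto. rewrite Hfac in Hp.
        assert (0 < 1 - z / r m).
        { assert (0 <= - z / r m) by (apply Rdiv_le_0_compat; lra).
          unfold Rdiv in *. lra. }
        apply (Rmult_lt_reg_l (1 - z / r m)); auto. lra.
Qed.

Definition shift (a : nat -> R) (j : nat) : R :=
  match j with O => 0 | S i => a i end.

(** [cisU k] and [cisW k] are the coefficients, as polynomials in [z = t^2], of
    the real part and of the imaginary part divided by [t] of [(1 + i t)^k]. *)
Fixpoint cisU (k : nat) : nat -> R :=
  match k with
  | O => fun j => match j with O => 1 | _ => 0 end
  | S i => fun j => cisU i j - shift (cisW i) j
  end
with cisW (k : nat) : nat -> R :=
  match k with
  | O => fun _ => 0
  | S i => fun j => cisW i j + cisU i j
  end.

Lemma cis_support (k : nat) :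
  (forall j, (k < 2 * j)%nat -> cisU k j = 0) /\
  (forall j, (k < 2 * j + 1)%nat -> cisW k j = 0).
Proof.
  induction k as [|k [IU IW]]; split; intros j Hj.
  - destruct j; [lia|reflexivity].
  - reflexivity.
  - simpl. destruct j as [|j]; [lia|]. simpl. rewrite IU, IW by lia. ring.
  - simpl. rewrite IU, IW by lia. ring.
Qed.

Lemma cis_low_coefficients (k : nat) :
  cisU k 0 = 1 /\ cisW k 0 = INR k /\
  cisU k 1 = - (INR k * (INR k - 1)) / 2 /\
  cisW k 1 = - (INR k * (INR k - 1) * (INR k - 2)) / 6 /\
  cisU k 2 = INR k * (INR k - 1) * (INR k - 2) * (INR k - 3) / 24.
Proof.
  induction k as [|k (I0 & J0 & I1 & J1 & I2)].
  - simpl. repeat split; lra.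
  - rewrite S_INR. cbn [cisU cisW shift]. rewrite I0, J0, I1, J1, I2. repeat split; field.
Qed.

Lemma peval_shift (a : nat -> R) (d : nat) (z : R) :
  a d = 0 -> peval (shift a) d z = z * peval a d z.
Proof.
  intros Hd. unfold peval.
  assert (E : forall n, sum_f_R0 (fun k => shift a k * z ^ k) n + a n * z ^ S n
                        = z * sum_f_R0 (fun k => a k * z ^ k) n).
  { induction n as [|n IH]; [simpl; ring|].
    rewrite !tech5, Rmult_plus_distr_l, <- IH. simpl. ring. }
  rewrite <- E, Hd. ring.
Qed.

Lemma peval_lin (a b : nat -> R) (c : R) (d : nat) (z : R) :
  peval (fun k => a k + c * b k) d z = peval a d z + c * peval b d z.
Proof.
  unfold peval. induction d as [|d IH]; [simpl; ring|].
  rewrite !tech5, IH. ring.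
Qed.

Lemma peval_ext (a b : nat -> R) (d : nat) (z : R) :
  (forall k, a k = b k) -> peval a d z = peval b d z.
Proof. intros H. unfold peval. apply sum_eq. intros. rewrite H. reflexivity. Qed.

Lemma cis_step (d k : nat) (z : R) : (k < 2 * d + 1)%nat ->
  peval (cisU (S k)) d z = peval (cisU k) d z - z * peval (cisW k) d z /\
  peval (cisW (S k)) d z = peval (cisW k) d z + peval (cisU k) d z.
Proof.
  intros Hk. split.
  - rewrite <- peval_shift by (apply cis_support; lia).
    rewrite (peval_ext _ (fun j => cisU k j + -1 * shift (cisW k) j)).
    + rewrite peval_lin. ring.
    + intros j. simpl. ring.
  - rewrite (peval_ext _ (fun j => cisW k j + 1 * cisU k j)).
    + rewrite peval_lin. ring.
    + intros j. simpl. ring.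
Qed.

Lemma cis_zero (d : nat) (z : R) : peval (cisU 0) d z = 1 /\ peval (cisW 0) d z = 0.
Proof.
  unfold peval. split; induction d as [|d IH]; try (simpl; ring);
    rewrite tech5, IH; simpl; ring.
Qed.

Lemma cis_trig (d : nat) (th : R) : cos th <> 0 ->
  forall k, (k <= 2 * d)%nat ->
    cos th ^ k * peval (cisU k) d (tan th ^ 2) = cos (INR k * th) /\
    cos th ^ k * (tan th * peval (cisW k) d (tan th ^ 2)) = sin (INR k * th).
Proof.
  intros Hc k. induction k as [|k IH]; intros Hk.
  - destruct (cis_zero d (tan th ^ 2)) as [-> ->]. simpl INR.
    rewrite Rmult_0_l, cos_0, sin_0. simpl. split; ring.
  - destruct (IH ltac:(lia)) as [IU IW].
    destruct (cis_step d k (tan th ^ 2) ltac:(lia)) as [-> ->].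
    rewrite S_INR. replace ((INR k + 1) * th) with (INR k * th + th) by ring.
    rewrite cos_plus, sin_plus, <- IU, <- IW. unfold tan. simpl.
    split; field; auto.
Qed.

Lemma cis_hyperbolic (d : nat) (b : R) :
  forall k, (k <= 2 * d)%nat ->
    peval (cisU k) d (- b ^ 2) = ((1 + b) ^ k + (1 - b) ^ k) / 2 /\
    b * peval (cisW k) d (- b ^ 2) = ((1 + b) ^ k - (1 - b) ^ k) / 2.
Proof.
  intros k. induction k as [|k IH]; intros Hk.
  - destruct (cis_zero d (- b ^ 2)) as [-> ->]. simpl. split; field.
  - destruct (IH ltac:(lia)) as [IU IW].
    destruct (cis_step d k (- b ^ 2) ltac:(lia)) as [-> ->]. split.
    + transitivity (peval (cisU k) d (- b ^ 2) + b * (b * peval (cisW k) d (- b ^ 2))); [ring|].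
      rewrite IU, IW. simpl. field.
    + transitivity (b * peval (cisW k) d (- b ^ 2) + b * peval (cisU k) d (- b ^ 2)); [ring|].
      rewrite IU, IW. simpl. field.
Qed.

Lemma tan_ge_id (u : R) : 0 < u < PI / 2 -> u <= tan u.
Proof.
  intros Hu.
  destruct (MVT_cor2 (fun t => sin t - t * cos t) (fun t => t * sin t) 0 u ltac:(lra))
    as [c [Hc1 Hc2]].
  { intros c Hc. apply is_derive_Reals. auto_derive; auto. ring. }
  cbv beta in Hc1. rewrite sin_0, cos_0 in Hc1.
  assert (Hs : 0 < sin c) by (apply sin_gt_0; pose proof PI_RGT_0; lra).
  assert (Hcu : 0 < cos u) by (apply cos_gt_0; lra).
  assert (0 <= c * sin c * (u - 0)).
  { apply Rmult_le_pos; [apply Rmult_le_pos|]; lra. }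
  unfold tan. apply Rmult_le_reg_r with (cos u); auto.
  replace (sin u / cos u * cos u) with (sin u) by (field; lra). lra.
Qed.

Lemma psum_le (f g : nat -> R) (m : nat) :
  (forall i, (i < m)%nat -> f i <= g i) -> psum f m <= psum g m.
Proof.
  induction m as [|m IH]; intros H; simpl; [lra|].
  apply Rplus_le_compat; [apply IH; intros; apply H; lia | apply H; lia].
Qed.

Lemma psum_scal (c : R) (f : nat -> R) (m : nat) :
  psum (fun i => c * f i) m = c * psum f m.
Proof. induction m as [|m IH]; simpl; [|rewrite IH]; ring. Qed.

Lemma psum_le_Series (f : nat -> R) (m : nat) :
  (forall i, 0 <= f i) -> ex_series f -> psum f m <= Series f.
Proof.
  intros Hf He.
  assert (Hs : forall n, psum f (S n) = sum_n f n).
  { induction n as [|n IH]; [rewrite sum_O; simpl; ring|].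
    rewrite sum_Sn, <- IH. reflexivity. }
  assert (Hl : psum f (S m) <= Series f).
  { rewrite Hs. apply (is_lim_seq_incr_compare (sum_n f) (Series f)).
    - apply Series_correct. exact He.
    - intros n. rewrite sum_Sn. specialize (Hf (S n)). unfold plus; simpl. lra. }
  simpl in Hl. specialize (Hf m). lra.
Qed.

(** Comparison of a root [tan^2 (y / N)] of an approximating polynomial with
    the limiting value: [N tan (y / N) >= y]. *)
Lemma inv_tan_pow4_le (N y v : R) :
  0 < N -> 0 < v -> v <= y -> y < N * (PI / 2) ->
  0 < tan (y / N) /\ / (tan (y / N) ^ 2) ^ 2 <= N ^ 4 * / v ^ 4.
Proof.
  intros HN Hv Hvy Hy.
  assert (Hr : 0 < y / N < PI / 2).
  { split; [apply Rdiv_lt_0_compat; lra|]. apply Rmult_lt_reg_r with N; auto.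
    unfold Rdiv at 1. rewrite Rmult_assoc, Rinv_l by lra. lra. }
  pose proof (tan_ge_id _ Hr) as Ht. split; [lra|].
  replace (N ^ 4 * / v ^ 4) with (/ ((v / N) ^ 2) ^ 2) by (field; split; lra).
  assert (H1 : 0 < v / N) by (apply Rdiv_lt_0_compat; lra).
  assert (H2 : v / N <= tan (y / N)).
  { apply Rle_trans with (y / N); auto. unfold Rdiv. apply Rmult_le_compat_r; auto.
    left. apply Rinv_0_lt_compat; auto. }
  apply Rinv_le_contravar.
  - repeat apply pow_lt; auto.
  - apply pow_incr. split; [apply pow2_ge_0|]. apply pow_incr. lra.
Qed.

Lemma tan_sq_injective (N y1 y2 : R) :
  0 < N -> 0 < y1 -> y1 < y2 -> y2 < N * (PI / 2) ->
  tan (y1 / N) ^ 2 <> tan (y2 / N) ^ 2.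
Proof.
  intros HN H1 H12 H2.
  assert (HI : 0 < / N) by (apply Rinv_0_lt_compat; auto).
  assert (A1 : 0 < y1 / N) by (apply Rmult_lt_0_compat; auto).
  assert (A2 : y1 / N < y2 / N) by (apply Rmult_lt_compat_r; auto).
  assert (A3 : y2 / N < PI / 2).
  { apply Rmult_lt_reg_r with N; auto.
    unfold Rdiv at 1. rewrite Rmult_assoc, Rinv_l by lra. lra. }
  pose proof (tan_gt_0 (y1 / N) A1 ltac:(lra)) as T1.
  pose proof (tan_increasing (y1 / N) (y2 / N) ltac:(lra) A2 A3) as T2.
  intros E. nra.
Qed.

(** For [N = 2 M] the polynomial [cisU N] has degree [M] and vanishes at
    [tan^2 (y / N)] for the first [M] positive zeros [y] of [cos], so these are all
    its roots. Vieta gives [N^4 / 6 - O(N^2)] for the sum of their inverse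
    squares. *)
Lemma odd_power_sum_lower_bound :
  ex_series (fun m => / (INR (S m) * PI - PI / 2) ^ 4) ->
  / 6 <= Series (fun m => / (INR (S m) * PI - PI / 2) ^ 4).
Proof.
  intros Hex. pose proof PI_RGT_0 as Hpi.
  set (v := fun m => INR (S m) * PI - PI / 2) in *.
  change (/ 6 <= Series (fun m => / v m ^ 4)).
  assert (Hv : forall m, 0 < v m).
  { intros m. unfold v. rewrite S_INR. pose proof (pos_INR m). nra. }
  assert (HM : forall M, (1 <= M)%nat ->
    / 6 - 2 / 3 / INR (2 * M) ^ 2 <= Series (fun m => / v m ^ 4)).
  { intros M HM. set (N := INR (2 * M)).
    assert (HN : 0 < N) by (apply lt_0_INR; lia).
    assert (HvN : forall m, (m < M)%nat -> v m < N * (PI / 2)).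
    { intros m Hm. unfold v, N. rewrite mult_INR. apply le_INR in Hm. simpl (INR 2). nra. }
    destruct (vieta M 0 (cisU (2 * M)) (fun m => tan (v m / N) ^ 2))
      as [h [Hh [_ [_ [H2 _]]]]].
    - intros k Hk. apply cis_support. lia.
    - apply cis_low_coefficients.
    - intros i Hi.
      destruct (inv_tan_pow4_le N (v i) (v i) HN (Hv i) ltac:(lra) (HvN i Hi)) as [Ht _].
      split; [apply pow_lt; auto|].
      assert (Hc : 0 < cos (v i / N)).
      { apply cos_gt_0.
        - assert (0 < v i / N) by (apply Rdiv_lt_0_compat; auto). lra.
        - apply Rmult_lt_reg_r with N; auto.
          unfold Rdiv at 1. rewrite Rmult_assoc, Rinv_l by lra. specialize (HvN i Hi). lra. }
      rewrite Nat.add_0_r.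
      destruct (cis_trig M (v i / N) ltac:(lra) (2 * M) ltac:(lia)) as [E _].
      fold N in E. replace (N * (v i / N)) with (v i) in E by (field; lra).
      assert (E0 : cos (v i) = 0).
      { unfold v. replace (INR (S i) * PI - PI / 2) with (INR (S i) * PI + - (PI / 2)) by ring.
        rewrite cos_add_INR_PI, cos_neg, cos_PI2. ring. }
      rewrite E0 in E. apply Rmult_integral in E. destruct E as [E|E]; auto.
      exfalso. apply (pow_nonzero (cos (v i / N)) (2 * M)); auto; lra.
    - intros i j Hij Hj. apply tan_sq_injective; auto.
      unfold v. apply lt_INR in Hij. rewrite !S_INR. nra.
    - rewrite !Hh in H2 by lia.
      destruct (cis_low_coefficients (2 * M)) as (_ & _ & E1 & _ & E2).
      rewrite E1, E2 in H2. fold N in H2.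
      assert (P1 : psum (fun i => / (tan (v i / N) ^ 2) ^ 2) M
                   <= N ^ 4 * psum (fun m => / v m ^ 4) M).
      { rewrite <- psum_scal. apply psum_le. intros i Hi.
        apply (inv_tan_pow4_le N (v i) (v i)); auto; lra. }
      assert (P2 : psum (fun m => / v m ^ 4) M <= Series (fun m => / v m ^ 4)).
      { apply psum_le_Series; auto. intros i. left. apply Rinv_0_lt_compat, pow_lt, Hv. }
      assert (HN4 : 0 < N ^ 4) by (apply pow_lt; auto).
      apply Rmult_le_reg_l with (N ^ 4); auto.
      replace (N ^ 4 * (/ 6 - 2 / 3 / N ^ 2)) with (N ^ 4 / 6 - 2 / 3 * N ^ 2) by (field; lra).
      assert (N ^ 4 * psum (fun m => / v m ^ 4) M <= N ^ 4 * Series (fun m => / v m ^ 4))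
        by (apply Rmult_le_compat_l; lra).
      nra. }
  apply le_epsilon. intros eps Heps.
  destruct (archimed_cor1 eps Heps) as [M [HM1 HM2]].
  specialize (HM M HM2).
  assert (H1 : 1 <= INR M) by (apply (le_INR 1); lia).
  assert (2 / 3 / INR (2 * M) ^ 2 <= / INR M).
  { rewrite mult_INR. simpl (INR 2). apply Rmult_le_reg_r with (6 * INR M ^ 2).
    - apply Rmult_lt_0_compat; [lra | apply pow_lt; lra].
    - replace (2 / 3 / ((1 + 1) * INR M) ^ 2 * (6 * INR M ^ 2)) with 1 by (field; lra).
      replace (/ INR M * (6 * INR M ^ 2)) with (6 * INR M) by (field; lra). lra. }
  lra.
Qed.

(** The zeros [y] of [cos y + N tan (y / N) sin y], multiplied by [cos (y / N)] to
    stay continuous. *)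
Lemma even_approximant_root (M n : nat) : (1 <= n)%nat -> (n < M)%nat ->
  let N := INR (2 * M) in
  {y | INR n * PI - PI / 2 < y < INR n * PI /\
       cos y * cos (y / N) + N * sin (y / N) * sin y = 0}.
Proof.
  intros Hn HnM N. pose proof PI_RGT_0 as Hpi.
  assert (H1 : 1 <= INR n) by (apply (le_INR 1); auto).
  assert (H2 : INR n + 1 <= INR M) by (rewrite <- S_INR; apply le_INR; lia).
  assert (EN : N = 2 * INR M) by (unfold N; rewrite mult_INR; simpl; ring).
  assert (HN : 0 < N) by lra.
  set (H := fun y => cos y * cos (y / N) + N * sin (y / N) * sin y).
  assert (Hb : forall y, 0 < y -> y <= INR n * PI -> 0 < y / N < PI / 2).
  { intros y Hy0 Hy. split; [apply Rdiv_lt_0_compat; auto|].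
    apply Rmult_lt_reg_r with N; auto.
    unfold Rdiv at 1. rewrite Rmult_assoc, Rinv_l by lra. nra. }
  assert (HL : (-1) ^ n * H (INR n * PI - PI / 2) < 0).
  { unfold H. replace (INR n * PI - PI / 2) with (INR n * PI + - (PI / 2)) by ring.
    rewrite cos_add_INR_PI, sin_add_INR_PI, cos_neg, sin_neg, cos_PI2, sin_PI2.
    set (u := (INR n * PI + - (PI / 2)) / N).
    assert (Hs : 0 < sin u).
    { apply sin_gt_0; unfold u; destruct (Hb (INR n * PI + - (PI / 2)));
        try nra. }
    replace ((-1) ^ n * ((-1) ^ n * 0 * cos u + N * sin u * ((-1) ^ n * - (1))))
      with (- ((-1) ^ n * (-1) ^ n * (N * sin u))) by ring.
    rewrite pow_m1_sq. nra. }
  assert (HR : 0 < (-1) ^ n * H (INR n * PI)).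
  { unfold H. set (u := INR n * PI / N).
    replace (INR n * PI) with (INR n * PI + 0) by ring.
    rewrite cos_add_INR_PI, sin_add_INR_PI, cos_0, sin_0.
    assert (Hs : 0 < cos u).
    { apply cos_gt_0; unfold u; destruct (Hb (INR n * PI)); try nra. }
    replace ((-1) ^ n * ((-1) ^ n * 1 * cos u + N * sin u * ((-1) ^ n * 0)))
      with ((-1) ^ n * (-1) ^ n * cos u) by ring.
    rewrite pow_m1_sq. lra. }
  destruct (IVT_cor H (INR n * PI - PI / 2) (INR n * PI)) as [z [Hz Ez]].
  - intros t. apply derivable_continuous_pt, ex_derive_Reals_0.
    unfold H. auto_derive. auto.
  - lra.
  - pose proof (pow_m1_sq n). nra.
  - exists z. split; [|exact Ez]. split.
    + destruct (Req_dec z (INR n * PI - PI / 2)) as [E|]; [rewrite <- E, Ez in HL|]; lra.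
    + destruct (Req_dec z (INR n * PI)) as [E|]; [rewrite <- E, Ez in HR|]; lra.
Qed.

(** Replacing the factor [t] of [cos t + t sin t] by the larger
    [N tan (t / N)] moves each zero to the right. *)
Lemma even_approximant_root_ge (n : nat) (N y t : R) :
  (1 <= n)%nat -> 0 < N -> INR n * PI - PI / 2 < y < INR n * PI -> y < N * (PI / 2) ->
  cos y * cos (y / N) + N * sin (y / N) * sin y = 0 ->
  INR n * PI - PI / 2 < t < INR n * PI + PI / 2 -> even_char t = 0 -> t <= y.
Proof.
  intros Hn HN Hy HyN Ey Ht Et. pose proof PI_RGT_0 as Hpi.
  assert (H1 : 1 <= INR n) by (apply (le_INR 1); auto).
  assert (Hy0 : 0 < y) by nra.
  apply Rnot_lt_le. intros Hlt.
  pose proof (even_char_increasing n (y - INR n * PI) (t - INR n * PI) Hn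
     ltac:(lra) ltac:(lra) ltac:(lra)) as Hinc.
  replace (INR n * PI + (y - INR n * PI)) with y in Hinc by ring.
  replace (INR n * PI + (t - INR n * PI)) with t in Hinc by ring.
  rewrite Et, Rmult_0_r in Hinc.
  assert (Hr : 0 < y / N < PI / 2).
  { split; [apply Rdiv_lt_0_compat; lra|]. apply Rmult_lt_reg_r with N; auto.
    unfold Rdiv at 1. rewrite Rmult_assoc, Rinv_l by lra. lra. }
  pose proof (tan_ge_id _ Hr) as Htan.
  assert (Hc : 0 < cos (y / N)) by (apply cos_gt_0; lra).
  assert (E : even_char y = (y - N * tan (y / N)) * sin y).
  { unfold even_char. apply Rmult_eq_reg_r with (cos (y / N)); [|lra].
    unfold tan. transitivity (cos y * cos (y / N) + y * sin y * cos (y / N)); [ring|].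
    transitivity (y * sin y * cos (y / N) - N * sin (y / N) * sin y); [lra|].
    field. lra. }
  assert (Hs : (-1) ^ n * sin y < 0).
  { replace y with (INR n * PI + (y - INR n * PI)) by ring.
    rewrite sin_add_INR_PI.
    rewrite <- Rmult_assoc, pow_m1_sq, Rmult_1_l.
    replace (y - INR n * PI) with (- (INR n * PI - y)) by ring. rewrite sin_neg.
    assert (0 < sin (INR n * PI - y)) by (apply sin_gt_0; lra). lra. }
  assert (HNt : y <= N * tan (y / N)).
  { apply Rmult_le_compat_l with (r := N) in Htan; [|lra].
    replace (N * (y / N)) with y in Htan by (field; lra). lra. }
  rewrite E in Hinc. nra.
Qed.

(** For [b = beta / N] the [N]-th power of this inequality reads
    [exp (- beta / (1 - b)) <= (1 - b)^N], whose left side tends to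
    [exp (- beta)]. *)
Lemma one_minus_ge_exp (b : R) : b < 1 -> exp (- (b / (1 - b))) <= 1 - b.
Proof.
  intros Hb.
  assert (H : 1 + b / (1 - b) <= exp (b / (1 - b))) by apply exp_ineq1_le.
  replace (1 + b / (1 - b)) with (/ (1 - b)) in H by (field; lra).
  rewrite exp_Ropp. apply Rinv_le_contravar in H; [|apply Rinv_0_lt_compat; lra].
  rewrite Rinv_inv in H. exact H.
Qed.

Lemma exp_pow (t : R) (n : nat) : exp t ^ n = exp (INR n * t).
Proof.
  induction n as [|n IH]; [simpl; rewrite Rmult_0_l, exp_0; reflexivity|].
  rewrite S_INR. simpl. rewrite IH, <- exp_plus. f_equal. ring.
Qed.

(** Up to a factor 2 this is the [N]-th approximating polynomial, [N = 2 M], at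
    [- b^2]. Below [alpha] its limit [cosh beta - beta sinh beta] is positive,
    so the negative root of the polynomial is eventually further from 0. *)
Lemma even_approximant_positive (beta : R) :
  1 < beta -> (beta - 1) * exp beta < (beta + 1) * exp (- beta) ->
  exists M0, forall M, (M0 <= M)%nat ->
    let b := beta / INR (2 * M) in
    0 < (1 + beta) * (1 - b) ^ (2 * M) + (1 - beta) * (1 + b) ^ (2 * M).
Proof.
  intros Hb1 Hb.
  set (F := fun b => (beta + 1) * exp (- (beta / (1 - b)))).
  assert (HF : continuity_pt F 0).
  { apply derivable_continuous_pt, ex_derive_Reals_0. unfold F. auto_derive. lra. }
  assert (HF0 : F 0 = (beta + 1) * exp (- beta)).
  { unfold F. do 2 f_equal. field. }
  destruct (HF ((beta + 1) * exp (- beta) - (beta - 1) * exp beta) ltac:(lra))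
    as [del [Hdel HFd]].
  destruct (archimed_cor1 (Rmin del 1 / beta)) as [M0 [HM1 HM2]].
  { apply Rdiv_lt_0_compat; [apply Rmin_pos|]; lra. }
  exists M0. intros M HM b.
  assert (HM0 : 0 < INR M0) by (apply lt_0_INR; auto).
  assert (HN : INR M0 <= INR (2 * M)) by (apply le_INR; lia).
  assert (Hbb : 0 < b < Rmin del 1).
  { unfold b. split; [apply Rdiv_lt_0_compat; lra|].
    apply Rle_lt_trans with (beta * / INR M0).
    - apply Rmult_le_compat_l; [lra|]. apply Rinv_le_contravar; auto.
    - apply Rmult_lt_compat_l with (r := beta) in HM1; [|lra].
      replace (beta * (Rmin del 1 / beta)) with (Rmin del 1) in HM1 by (field; lra). lra. }
  pose proof (Rmin_l del 1). pose proof (Rmin_r del 1).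
  assert (Eb : INR (2 * M) * b = beta) by (unfold b; field; lra).
  assert (HU : (1 + b) ^ (2 * M) <= exp beta).
  { rewrite <- Eb, <- exp_pow. apply pow_incr. split; [lra | apply exp_ineq1_le]. }
  assert (HL : exp (- (beta / (1 - b))) <= (1 - b) ^ (2 * M)).
  { replace (- (beta / (1 - b))) with (INR (2 * M) * (- (b / (1 - b)))).
    - rewrite <- exp_pow. apply pow_incr. split; [left; apply exp_pos|].
      apply one_minus_ge_exp. lra.
    - rewrite <- Eb. field. lra. }
  assert (Hd : R_dist (F b) (F 0) < (beta + 1) * exp (- beta) - (beta - 1) * exp beta).
  { apply HFd. split; [split; [exact I | lra]|]. unfold dist; simpl. unfold R_dist.
    rewrite Rminus_0_r, Rabs_pos_eq; lra. }
  unfold R_dist in Hd. apply Rabs_def2 in Hd. rewrite HF0 in Hd. unfold F in Hd.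
  assert ((beta + 1) * exp (- (beta / (1 - b))) <= (beta + 1) * (1 - b) ^ (2 * M))
    by (apply Rmult_le_compat_l; lra).
  assert ((beta - 1) * (1 + b) ^ (2 * M) <= (beta - 1) * exp beta)
    by (apply Rmult_le_compat_l; lra).
  lra.
Qed.

(** The real part of [(1 - i N t) (1 + i t)^N] tends to [cos x + x sin x] for
    [t = x / N]. It has degree [M] in [z = t^2], [N = 2 M], and [M - 1] positive
    roots, each beyond the matching zero of the limit. The remaining factor
    [1 + h_1 z] has a negative root, bounded by [even_approximant_positive].
    Vieta gives [N^4 / 2 + N / 2] for the sum of the inverse squares. *)
Lemma even_power_sum_lower_bound (x : nat -> R) (beta : R) :
  (forall n, (1 <= n)%nat ->
    INR n * PI - PI / 2 < x n < INR n * PI + PI / 2 /\ even_char (x n) = 0) ->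
  ex_series (fun m => / x (S m) ^ 4) ->
  1 < beta -> (beta - 1) * exp beta < (beta + 1) * exp (- beta) ->
  / 2 <= Series (fun m => / x (S m) ^ 4) + / beta ^ 4.
Proof.
  intros Hx Hex Hb1 Hb. pose proof PI_RGT_0 as Hpi.
  destruct (even_approximant_positive beta Hb1 Hb) as [M0 HM0].
  destruct (ex_intro (fun M => M = S M0) (S M0) eq_refl) as [M EM].
  specialize (HM0 M ltac:(lia)). cbv zeta in HM0.
  set (N := INR (2 * M)) in *.
  assert (HN : 0 < N) by (apply lt_0_INR; lia).
  assert (EN : N = 2 * INR M) by (unfold N; rewrite mult_INR; simpl; ring).
  set (y := fun i => match lt_dec (S i) M with
     | left H => proj1_sig (even_approximant_root M (S i) (le_n_S 0 i (Nat.le_0_l i)) H)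
     | right _ => 0 end).
  assert (Hy : forall i, (i < M0)%nat ->
     INR (S i) * PI - PI / 2 < y i < INR (S i) * PI /\
     cos (y i) * cos (y i / N) + N * sin (y i / N) * sin (y i) = 0).
  { intros i Hi. unfold y. destruct (lt_dec (S i) M) as [H|H]; [|lia].
    destruct (even_approximant_root M (S i) (le_n_S 0 i (Nat.le_0_l i)) H) as [t Ht].
    exact Ht. }
  assert (HyN : forall i, (i < M0)%nat -> 0 < y i /\ y i < N * (PI / 2)).
  { intros i Hi. destruct (Hy i Hi) as [Hyi _].
    assert (1 <= INR (S i)) by (apply (le_INR 1); lia).
    assert (INR (S i) <= INR M) by (apply le_INR; lia). nra. }
  assert (Hxpos : forall i, 0 < x (S i)).
  { intros i. destruct (Hx (S i) ltac:(lia)) as [Hxi _].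
    assert (1 <= INR (S i)) by (apply (le_INR 1); lia). nra. }
  assert (Hxy : forall i, (i < M0)%nat -> x (S i) <= y i).
  { intros i Hi. destruct (Hx (S i) ltac:(lia)) as [Hxi Exi].
    destruct (Hy i Hi) as [Hyi Eyi].
    apply (even_approximant_root_ge (S i) N); auto; try lia; apply HyN; auto. }
  (* real part of [(1 - i N t) (1 + i t)^N] *)
  set (a := fun j => cisU (2 * M) j + N * shift (cisW (2 * M)) j).
  assert (Hpa : forall z, peval a M z
     = peval (cisU (2 * M)) M z + N * (z * peval (cisW (2 * M)) M z)).
  { intros z. unfold a. rewrite peval_lin, peval_shift; auto. apply cis_support. lia. }
  destruct (vieta M0 1 a (fun i => tan (y i / N) ^ 2)) as [h [Hh [Hh0 [H1 [H2 H3]]]]].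
  - intros k Hk. unfold a. destruct (cis_support (2 * M)) as [SU SW].
    destruct k as [|k]; [lia|]. cbn [shift].
    rewrite SU, SW by (lia). ring.
  - unfold a. cbn [shift]. rewrite (proj1 (cis_low_coefficients _)). ring.
  - intros i Hi.
    destruct (HyN i Hi) as [Hy0 Hy1].
    destruct (inv_tan_pow4_le N (y i) (y i) HN Hy0 ltac:(lra) Hy1) as [Ht _].
    split; [apply pow_lt; auto|].
    assert (Hc : 0 < cos (y i / N)).
    { apply cos_gt_0.
      - assert (0 < y i / N) by (apply Rdiv_lt_0_compat; auto). lra.
      - apply Rmult_lt_reg_r with N; auto.
        unfold Rdiv at 1. rewrite Rmult_assoc, Rinv_l by lra. lra. }
    replace (M0 + 1)%nat with M by (lia). rewrite Hpa.
    destruct (cis_trig M (y i / N) ltac:(lra) (2 * M) ltac:(lia)) as [EU EW].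
    fold N in EU, EW. replace (N * (y i / N)) with (y i) in EU, EW by (field; lra).
    destruct (Hy i Hi) as [_ Eyi].
    apply Rmult_eq_reg_l with (cos (y i / N) ^ (2 * M) * cos (y i / N));
      [|apply Rmult_integral_contrapositive_currified; [apply pow_nonzero|]; lra].
    rewrite Rmult_0_r, <- Eyi, <- EU, <- EW. unfold tan. field. lra.
  - intros i j Hij Hj. apply tan_sq_injective; try apply HyN; auto; try lia.
    destruct (Hy i ltac:(lia)) as [Hyi _]. destruct (Hy j Hj) as [Hyj _].
    assert (INR (S i) + 1 <= INR (S j)) by (rewrite <- (S_INR (S i)); apply le_INR; lia). nra.
  - destruct (cis_low_coefficients (2 * M)) as (_ & W0 & U1 & W1 & U2).
    fold N in W0, U1, W1, U2.
    assert (E1 : a 1%nat = N * (N + 1) / 2).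
    { unfold a. cbn [shift]. rewrite U1, W0. field. }
    assert (E2 : a 1%nat ^ 2 - 2 * a 2%nat = N ^ 4 / 2 + N / 2).
    { rewrite E1. unfold a. cbn [shift]. rewrite U2, W1. field. }
    rewrite (Hh 2%nat) in H2 by lia. rewrite E2 in H2. rewrite E1 in H1.
    assert (P1 : psum (fun i => / (tan (y i / N) ^ 2) ^ 2) M0
                 <= N ^ 4 * psum (fun m => / x (S m) ^ 4) M0).
    { rewrite <- psum_scal. apply psum_le. intros i Hi.
      apply (inv_tan_pow4_le N (y i) (x (S i))); auto; apply HyN; auto. }
    assert (P2 : psum (fun m => / x (S m) ^ 4) M0 <= Series (fun m => / x (S m) ^ 4)).
    { apply psum_le_Series; auto. intros i. left. apply Rinv_0_lt_compat, pow_lt, Hxpos. }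
    assert (P3 : 0 <= psum (fun i => / tan (y i / N) ^ 2) M0).
    { apply Rle_trans with (psum (fun _ => 0) M0).
      - clear. induction M0 as [|n IH]; simpl; lra.
      - apply psum_le. intros i Hi. destruct (HyN i Hi) as [Hy0 Hy1].
        destruct (inv_tan_pow4_le N (y i) (y i) HN Hy0 ltac:(lra) Hy1) as [Ht _].
        left. apply Rinv_0_lt_compat, pow_lt. auto. }
    assert (Hh1 : 0 < h 1%nat) by nra.
    set (b := beta / N) in *.
    assert (Hb0 : 0 < b) by (apply Rdiv_lt_0_compat; lra).
    assert (P4 : 0 < peval h 1 (- b ^ 2)).
    { apply H3; [pose proof (pow2_ge_0 b); lra|].
      replace (M0 + 1)%nat with M by (lia). rewrite Hpa.
      destruct (cis_hyperbolic M b (2 * M) ltac:(lia)) as [EU EW].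
      replace (N * (- b ^ 2 * peval (cisW (2 * M)) M (- b ^ 2)))
        with (- beta * (b * peval (cisW (2 * M)) M (- b ^ 2))) by (unfold b; field; lra).
      rewrite EU, EW. lra. }
    unfold peval in P4. simpl in P4. rewrite Hh0 in P4.
    assert (P5 : h 1%nat * b ^ 2 < 1) by (simpl; lra).
    assert (P6 : h 1%nat < N ^ 2 * / beta ^ 2).
    { apply Rmult_lt_reg_r with (b ^ 2); [apply pow_lt; auto|].
      replace (N ^ 2 * / beta ^ 2 * b ^ 2) with 1 by (unfold b; field; lra). auto. }
    assert (P7 : h 1%nat ^ 2 <= N ^ 4 * / beta ^ 4).
    { replace (N ^ 4 * / beta ^ 4) with ((N ^ 2 * / beta ^ 2) ^ 2) by (field; lra).
      apply pow_incr. lra. }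
    assert (HN4 : 0 < N ^ 4) by (apply pow_lt; auto).
    apply Rmult_le_reg_l with (N ^ 4); auto.
    assert (N ^ 4 * psum (fun m => / x (S m) ^ 4) M0 <= N ^ 4 * Series (fun m => / x (S m) ^ 4))
      by (apply Rmult_le_compat_l; lra).
    rewrite Rmult_plus_distr_l. lra.
Qed.

(** * Series of functions, eigenpairs and the kernel on the unit interval *)

(** Integrals and series take values in an abstract module; [field] and [ring]
    need the equation stated in [R]. *)
Ltac real_eq := match goal with |- @eq _ ?u ?v => change (@eq R u v) end.

Lemma series_tail_le (a M : nat -> R) (N : nat) :
  (forall n, Rabs (a n) <= M n) -> ex_series M ->
  Rabs (Series a - sum_n a N) <= Series M - sum_n M N.
Proof.
  intros Ha HM.
  assert (Hea : ex_series (fun n => Rabs (a n))).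
  { apply (@ex_series_le R_AbsRing R_CompleteNormedModule (fun n => Rabs (a n)) M); auto.
    intros n. unfold norm; simpl. unfold abs; simpl. rewrite Rabs_Rabsolu. auto. }
  rewrite (Series_incr_n a (S N)), (Series_incr_n M (S N));
    try lia; auto using ex_series_Rabs.
  simpl pred. rewrite <- !sum_n_Reals.
  match goal with |- Rabs (?u + ?v - ?u') <= _ => replace (u + v - u') with v by ring end.
  match goal with |- _ <= ?u + ?v - ?u' => replace (u + v - u') with v by ring end.
  apply Rle_trans with (Series (fun k => Rabs (a (S N + k)%nat))).
  - apply Series_Rabs. apply (ex_series_incr_n (fun n => Rabs (a n)) (S N)); auto.
  - apply Series_le; [intros n; split; auto using Rabs_pos|].
    apply (ex_series_incr_n M (S N)); auto.
Qed.

Lemma series_tail_small (M : nat -> R) (eps : R) : ex_series M -> 0 < eps ->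
  exists N, forall n, (N <= n)%nat -> Series M - sum_n M n < eps.
Proof.
  intros HM Heps. pose proof (Series_correct M HM) as H.
  destruct (proj1 (filterlim_locally _ _) H (mkposreal eps Heps)) as [N HN].
  exists N. intros n Hn. specialize (HN n Hn).
  change (Rabs (sum_n M n - Series M) < eps) in HN.
  apply Rabs_def2 in HN. lra.
Qed.

(** Retraction of the line onto [0,1]; it turns bounds on [0,1] into bounds on
    the whole line, the setting of uniform convergence for integrals. *)
Definition clamp (t : R) : R := Rmax 0 (Rmin 1 t).

Lemma clamp_unit (t : R) : 0 <= clamp t <= 1.
Proof.
  unfold clamp. split; [apply Rmax_l|]. apply Rmax_lub; [lra | apply Rmin_l].
Qed.

Lemma clamp_id (t : R) : 0 <= t <= 1 -> clamp t = t.
Proof. intros H. unfold clamp. rewrite Rmin_right, Rmax_right; lra. Qed.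

Lemma clamp_lipschitz (s t : R) : Rabs (clamp s - clamp t) <= Rabs (s - t).
Proof.
  unfold clamp, Rmax, Rmin, Rabs.
  repeat destruct Rle_dec; repeat destruct Rcase_abs; lra.
Qed.

Lemma clamp_continuous (t : R) : continuous clamp t.
Proof.
  apply filterlim_locally. intros eps. exists eps. intros s Hs.
  apply Rle_lt_trans with (2 := Hs). apply clamp_lipschitz.
Qed.

(** Weierstrass test: the partial sums converge uniformly, so the integral may be
    taken term by term. *)
Lemma series_RInt (f : nat -> R -> R) (M : nat -> R) :
  (forall n t, 0 <= t <= 1 -> Rabs (f n t) <= M n) -> ex_series M ->
  (forall n, ex_RInt (f n) 0 1) ->
  ex_RInt (fun t => Series (fun n => f n t)) 0 1 /\
  is_series (fun n => RInt (f n) 0 1) (RInt (fun t => Series (fun n => f n t)) 0 1).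
Proof.
  intros Hb HM Hi.
  set (g := fun N t => sum_n (fun n => f n (clamp t)) N).
  set (G := fun t => Series (fun n => f n (clamp t))).
  destruct (filterlim_RInt g 0 1 eventually _ G (fun N => sum_n (fun n => RInt (f n) 0 1) N))
    as [I [HI1 HI2]].
  - intros N. unfold g. induction N as [|N IH].
    + apply is_RInt_ext with (f O).
      * intros t. rewrite Rmin_left, Rmax_right by lra. intros Ht.
        rewrite sum_O, clamp_id by lra. reflexivity.
      * rewrite sum_O. apply (@RInt_correct R_CompleteNormedModule). auto.
    + rewrite sum_Sn.
      apply is_RInt_ext with (fun t => plus (sum_n (fun n => f n (clamp t)) N) (f (S N) t)).
      * intros t. rewrite Rmin_left, Rmax_right by lra. intros Ht.
        rewrite sum_Sn, (clamp_id t) by lra. reflexivity.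
      * apply (@is_RInt_plus R_NormedModule); auto.
        apply (@RInt_correct R_CompleteNormedModule). auto.
  - apply filterlim_locally. intros eps.
    destruct (series_tail_small M eps HM (cond_pos eps)) as [N HN].
    exists N. intros n Hn t.
    change (Rabs (g n t - G t) < eps). rewrite Rabs_minus_sym.
    apply Rle_lt_trans with (2 := HN n Hn).
    apply (series_tail_le (fun k => f k (clamp t)) M n); auto.
    intros k. apply Hb, clamp_unit.
  - assert (HI3 : is_RInt (fun t => Series (fun n => f n t)) 0 1 I).
    { apply is_RInt_ext with (2 := HI2).
      intros t. rewrite Rmin_left, Rmax_right by lra. intros Ht.
      unfold G. rewrite clamp_id by lra. reflexivity. }
    rewrite (is_RInt_unique _ _ _ _ HI3). split; [exists I; auto | exact HI1].
Qed.

Lemma series_continuous (f : nat -> R -> R) (M : nat -> R) :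
  (forall n t, 0 <= t <= 1 -> Rabs (f n t) <= M n) -> ex_series M ->
  (forall n t, continuous (f n) t) ->
  forall t, continuous (fun t => Series (fun n => f n (clamp t))) t.
Proof.
  intros Hb HM Hc t. apply filterlim_locally. intros eps.
  assert (He : 0 < eps / 3) by (pose proof (cond_pos eps); lra).
  destruct (series_tail_small M (eps / 3) HM He) as [N HN]. specialize (HN N ltac:(lia)).
  assert (HcN : continuous (fun s => sum_n (fun n => f n (clamp s)) N) t).
  { clear HN. induction N as [|N IH].
    - apply continuous_ext with (fun s => f O (clamp s)).
      + intros s. rewrite sum_O. reflexivity.
      + apply continuous_comp; [apply clamp_continuous | apply Hc].
    - apply continuous_ext with
        (fun s => plus (sum_n (fun n => f n (clamp s)) N) (f (S N) (clamp s))).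
      + intros s. rewrite sum_Sn. reflexivity.
      + apply (@continuous_plus _ R_AbsRing R_NormedModule); auto.
        apply continuous_comp; [apply clamp_continuous | apply Hc]. }
  destruct (proj1 (filterlim_locally _ _) HcN (mkposreal _ He)) as [d Hd].
  exists d. intros s Hs. specialize (Hd s Hs).
  change (Rabs (sum_n (fun n => f n (clamp s)) N - sum_n (fun n => f n (clamp t)) N) < eps / 3) in Hd.
  change (Rabs (Series (fun n => f n (clamp s)) - Series (fun n => f n (clamp t))) < eps).
  assert (T : forall u, Rabs (Series (fun n => f n (clamp u)) - sum_n (fun n => f n (clamp u)) N) < eps / 3).
  { intros u. apply Rle_lt_trans with (2 := HN).
    apply (series_tail_le (fun k => f k (clamp u)) M N); auto.
    intros k. apply Hb, clamp_unit. }
  pose proof (T s) as Ts. pose proof (T t) as Tt.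
  apply Rabs_def2 in Hd. apply Rabs_def2 in Ts. apply Rabs_def2 in Tt.
  apply Rabs_def1; lra.
Qed.

Lemma continuous_nonneg_RInt_zero (f : R -> R) :
  (forall t, continuous f t) -> (forall t, 0 <= t <= 1 -> 0 <= f t) -> RInt f 0 1 <= 0 ->
  forall t, 0 <= t <= 1 -> f t = 0.
Proof.
  intros Hc Hp HI t Ht.
  destruct (Rle_lt_or_eq_dec 0 (f t) (Hp t Ht)) as [Hlt|]; auto. exfalso.
  destruct (proj1 (filterlim_locally _ _) (Hc t) (mkposreal _ Hlt)) as [d Hd].
  set (a := Rmax 0 (t - d / 2)). set (b := Rmin 1 (t + d / 2)).
  pose proof (cond_pos d) as Hd0.
  assert (Hab : 0 <= a /\ a < b /\ b <= 1 /\ t - d < a /\ b < t + d).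
  { unfold a, b, Rmax, Rmin. repeat destruct Rle_dec; lra. }
  assert (Hex : forall u v, ex_RInt f u v).
  { intros u v. apply (@ex_RInt_continuous R_CompleteNormedModule). auto. }
  assert (I1 : 0 <= RInt f 0 a) by (apply RInt_ge_0; auto; [lra | intros; apply Hp; lra]).
  assert (I2 : 0 <= RInt f b 1) by (apply RInt_ge_0; auto; [lra | intros; apply Hp; lra]).
  assert (I3 : 0 < RInt f a b).
  { apply RInt_gt_0; [lra | | auto].
    intros s Hs. assert (Hsd : Rabs (s - t) < d) by (apply Rabs_def1; lra).
    specialize (Hd s Hsd). change (Rabs (f s - f t) < f t) in Hd.
    apply Rabs_def2 in Hd. lra. }
  pose proof (RInt_Chasles f 0 a b (Hex _ _) (Hex _ _)) as C1.
  pose proof (RInt_Chasles f 0 b 1 (Hex _ _) (Hex _ _)) as C2.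
  unfold plus in C1, C2; simpl in C1, C2. lra.
Qed.

Lemma is_RInt_antiderivative (F f : R -> R) (a b v : R) :
  (forall t, is_derive F t (f t)) -> (forall t, continuous f t) -> v = F b - F a ->
  is_RInt f a b v.
Proof.
  intros HF Hf ->. apply (is_RInt_derive F f a b); auto.
Qed.

Lemma derivative_continuous (f df : R -> R) :
  (forall t, is_derive f t (df t)) -> forall t, continuous f t.
Proof.
  intros H t. apply (@ex_derive_continuous R_AbsRing R_NormedModule). exists (df t). apply H.
Qed.

Record eigenpair (l : R) (f df : R -> R) : Prop := {
  ep_fst : forall t, is_derive f t (df t);
  ep_snd : forall t, is_derive df t (- l * f t);
  ep_sum : f 0 + f 1 = - df 0;
  ep_end : - df 0 = df 1 }.

Ltac cont_mult := apply (@continuous_mult _ R_AbsRing).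

(** Lagrange's identity: the boundary terms cancel by the boundary conditions. *)
Lemma eigenpair_orthogonal (l m : R) (f df g dg : R -> R) :
  eigenpair l f df -> eigenpair m g dg -> l <> m ->
  is_RInt (fun t => f t * g t) 0 1 0.
Proof.
  intros [F1 F2 F3 F4] [G1 G2 G3 G4] Hlm.
  apply is_RInt_antiderivative with
    (fun t => / (m - l) * (df t * g t - f t * dg t)).
  - intros t. auto_derive.
    + repeat split; eexists; eauto.
    + rewrite (is_derive_unique (fun u : R => f u) _ _ (F1 t)),
        (is_derive_unique (fun u : R => df u) _ _ (F2 t)),
        (is_derive_unique (fun u : R => g u) _ _ (G1 t)),
        (is_derive_unique (fun u : R => dg u) _ _ (G2 t)). field. lra.
  - intros t. cont_mult; [apply (derivative_continuous f df) | apply (derivative_continuous g dg)]; auto.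
  - replace (df 1) with (f 0 + f 1) by lra. replace (dg 1) with (g 0 + g 1) by lra.
    replace (df 0) with (- (f 0 + f 1)) by lra. replace (dg 0) with (- (g 0 + g 1)) by lra.
    ring.
Qed.

(** Virial identity: [f'^2 + l f^2] is constant, so [2 l f^2] is the derivative of
    [(t - 1/2) (f'^2 + l f^2) - f f']; the norm of an eigenfunction is determined
    by its values at the two end points. *)
Lemma eigenpair_norm (l : R) (f df : R -> R) :
  eigenpair l f df -> l <> 0 ->
  is_RInt (fun t => f t * f t) 0 1 ((f 0 ^ 2 + f 1 ^ 2) / 4).
Proof.
  intros [F1 F2 F3 F4] Hl.
  apply is_RInt_antiderivative with
    (fun t => / (2 * l) * ((t - / 2) * (df t ^ 2 + l * f t ^ 2) - f t * df t)).
  - intros t. auto_derive.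
    + repeat split; eexists; eauto.
    + rewrite (is_derive_unique (fun u : R => f u) _ _ (F1 t)),
        (is_derive_unique (fun u : R => df u) _ _ (F2 t)). field. lra.
  - intros t. cont_mult; apply (derivative_continuous f df); auto.
  - replace (df 1) with (f 0 + f 1) by lra. replace (df 0) with (- (f 0 + f 1)) by lra.
    field. lra.
Qed.

Lemma kernel_le (x y : R) : x <= y -> kernel x y = (x - y) / 2.
Proof. intros H. unfold kernel. rewrite Rabs_left1 by lra. lra. Qed.

Lemma kernel_sym (x y : R) : kernel x y = kernel y x.
Proof. unfold kernel. rewrite Rabs_minus_sym. reflexivity. Qed.

Lemma kernel_ge (x y : R) : y <= x -> kernel x y = (y - x) / 2.
Proof. intros H. rewrite kernel_sym. apply kernel_le; auto. Qed.

Lemma kernel_continuous (x t : R) : continuous (kernel x) t.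
Proof.
  apply filterlim_locally. intros eps. exists eps. intros s Hs.
  change (Rabs (s - t) < eps) in Hs. change (Rabs (kernel x s - kernel x t) < eps).
  apply Rle_lt_trans with (2 := Hs). unfold kernel, Rabs.
  repeat destruct Rcase_abs; lra.
Qed.

Lemma kernel_bound (x y : R) : 0 <= x <= 1 -> 0 <= y <= 1 -> Rabs (kernel x y) <= 1.
Proof. intros Hx Hy. unfold kernel, Rabs. repeat destruct Rcase_abs; lra. Qed.

(** Two integrations by parts on each side of the kink of the kernel. The affine
    correction vanishes exactly when [G] satisfies the boundary conditions, which
    is why the integral operator inverts the boundary value problem. *)
Lemma kernel_inverts (G dG ddG : R -> R) (y : R) :
  (forall t, is_derive G t (dG t)) -> (forall t, is_derive dG t (ddG t)) ->
  (forall t, continuous ddG t) -> 0 <= y <= 1 ->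
  is_RInt (fun z => ddG z * kernel z y) 0 1
    (- (G y + ((1 - y) * dG 1 - y * dG 0 - G 0 - G 1) / 2)).
Proof.
  intros H1 H2 Hc Hy.
  replace (- (G y + ((1 - y) * dG 1 - y * dG 0 - G 0 - G 1) / 2))
    with (plus (- / 2 * (G y - (y * dG 0 + G 0))) (- / 2 * ((1 - y) * dG 1 - G 1 + G y)))
    by (unfold plus; simpl; field).
  apply (@is_RInt_Chasles R_NormedModule _ 0 y 1).
  - apply is_RInt_ext with (fun z => ddG z * ((z - y) / 2)).
    + intros z. rewrite Rmin_left, Rmax_right by lra. intros Hz.
      rewrite kernel_le by lra. reflexivity.
    + apply is_RInt_antiderivative with (fun z => - / 2 * ((y - z) * dG z + G z)).
      * intros t. auto_derive; [repeat split; eexists; eauto|].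
        rewrite (is_derive_unique (fun u : R => G u) _ _ (H1 t)),
          (is_derive_unique (fun u : R => dG u) _ _ (H2 t)). field.
      * intros t. cont_mult; auto.
        apply (@ex_derive_continuous R_AbsRing R_NormedModule). auto_derive. auto.
      * field.
  - apply is_RInt_ext with (fun z => ddG z * ((y - z) / 2)).
    + intros z. rewrite Rmin_left, Rmax_right by lra. intros Hz.
      rewrite kernel_ge by lra. reflexivity.
    + apply is_RInt_antiderivative with (fun z => - / 2 * ((z - y) * dG z - G z)).
      * intros t. auto_derive; [repeat split; eexists; eauto|].
        rewrite (is_derive_unique (fun u : R => G u) _ _ (H1 t)),
          (is_derive_unique (fun u : R => dG u) _ _ (H2 t)). field.
      * intros t. cont_mult; auto.
        apply (@ex_derive_continuous R_AbsRing R_NormedModule). auto_derive. auto.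
      * field.
Qed.

Lemma eigenpair_kernel (l : R) (f df : R -> R) (y : R) :
  eigenpair l f df -> l <> 0 -> 0 <= y <= 1 ->
  is_RInt (fun z => f z * kernel z y) 0 1 (f y / l).
Proof.
  intros [F1 F2 F3 F4] Hl Hy.
  pose proof (kernel_inverts f df (fun t => - l * f t) y F1 F2) as H.
  apply is_RInt_ext with (fun z => scal (- / l) (- l * f z * kernel z y)).
  - intros z _. unfold scal; simpl. unfold mult; simpl. field. auto.
  - replace (f y / l)
      with (scal (- / l) (- (f y + ((1 - y) * df 1 - y * df 0 - f 0 - f 1) / 2))).
    + apply (@is_RInt_scal R_NormedModule). apply H; auto.
      intros t. cont_mult; [apply continuous_const | apply (derivative_continuous f df); auto].
    + unfold scal; simpl; unfold mult; simpl.
      replace (df 1) with (f 0 + f 1) by lra. replace (df 0) with (- (f 0 + f 1)) by lra.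
      field. auto.
Qed.

Lemma kernel_norm (x : R) :
  is_RInt (fun z => kernel x z * kernel x z) 0 1 ((x ^ 3 + (1 - x) ^ 3) / 12).
Proof.
  apply is_RInt_ext with (fun z => (x - z) ^ 2 / 4).
  - intros z _. unfold kernel.
    replace (- Rabs (x - z) / 2 * (- Rabs (x - z) / 2)) with (Rabs (x - z) ^ 2 / 4) by field.
    rewrite <- (Rabs_right ((x - z) ^ 2)) by (apply Rle_ge, pow2_ge_0).
    rewrite <- RPow_abs. reflexivity.
  - apply is_RInt_antiderivative with (fun z => - (x - z) ^ 3 / 12).
    + intros t. auto_derive; auto. field.
    + intros t. apply (@ex_derive_continuous R_AbsRing R_NormedModule). auto_derive. auto.
    + field.
Qed.

(** * Mercer expansion of the kernel and of its iterates *)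

(** The values at the end points fix the normalisation; with them every
    eigenfunction has squared norm [1/2]. The last field is the inequality opposite
    to the integrated Bessel inequality. *)
Record eigenbasis (lam : nat -> R) (psi dpsi : nat -> R -> R) : Prop := {
  eb_pair : forall n, eigenpair (lam n) (psi n) (dpsi n);
  eb_large : forall n, 1 <= Rabs (lam n);
  eb_distinct : forall n m, n <> m -> lam n <> lam m;
  eb_left : forall n, psi n 0 = 1;
  eb_right : forall n, psi n 1 = (-1) ^ n;
  eb_bound : forall n t, 0 <= t <= 1 -> Rabs (psi n t) <= 2;
  eb_summable : ex_series (fun n => / Rabs (lam n));
  eb_trace2 : / 24 <= Series (fun n => / lam n ^ 2) }.

Section Mercer.

Variables (lam : nat -> R) (psi dpsi : nat -> R -> R).
Hypothesis EB : eigenbasis lam psi dpsi.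

Lemma eb_nonzero n : lam n <> 0.
Proof.
  intros H. pose proof (eb_large _ _ _ EB n) as L. rewrite H, Rabs_R0 in L. lra.
Qed.

Lemma eb_continuous n t : continuous (psi n) t.
Proof. apply (derivative_continuous _ (dpsi n)), (ep_fst _ _ _ (eb_pair _ _ _ EB n)). Qed.

Lemma eb_norm n : is_RInt (fun t => psi n t * psi n t) 0 1 (/ 2).
Proof.
  pose proof (eigenpair_norm _ _ _ (eb_pair _ _ _ EB n) (eb_nonzero n)) as H.
  rewrite (eb_left _ _ _ EB), (eb_right _ _ _ EB) in H.
  replace (/ 2) with ((1 ^ 2 + ((-1) ^ n) ^ 2) / 4); auto.
  simpl. rewrite !Rmult_1_r, pow_m1_sq. field.
Qed.

Lemma eb_orthogonal n m : n <> m -> is_RInt (fun t => psi n t * psi m t) 0 1 0.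
Proof.
  intros H. apply (eigenpair_orthogonal (lam n) (lam m) _ (dpsi n) _ (dpsi m));
    apply EB; auto.
Qed.

Lemma inv_lam_pow_bound n p : Rabs (/ lam n ^ S p) <= / Rabs (lam n).
Proof.
  pose proof (eb_large _ _ _ EB n) as L.
  rewrite Rabs_inv, <- RPow_abs. apply Rinv_le_contravar; [lra|].
  simpl. rewrite <- (Rmult_1_r (Rabs (lam n))) at 1.
  apply Rmult_le_compat_l; [lra|]. apply pow_R1_Rle. auto.
Qed.

(** The eigenfunctions are uniformly bounded, so absolute convergence of the
    coefficients is enough to integrate term by term. *)
Lemma expansion_RInt (a M : nat -> R) (h : R -> R) (C : R) :
  (forall n, Rabs (a n) <= M n) -> ex_series M ->
  (forall t, 0 <= t <= 1 -> Rabs (h t) <= C) ->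
  (forall n, ex_RInt (fun t => psi n t * h t) 0 1) ->
  ex_RInt (fun t => Series (fun n => a n * psi n t) * h t) 0 1 /\
  is_series (fun n => a n * RInt (fun t => psi n t * h t) 0 1)
    (RInt (fun t => Series (fun n => a n * psi n t) * h t) 0 1).
Proof.
  intros Ha HM Hh Hi.
  assert (E : forall t, Series (fun n => a n * psi n t) * h t
                        = Series (fun n => a n * (psi n t * h t))).
  { intros t. rewrite <- Series_scal_r. apply Series_ext. intros n. ring. }
  destruct (series_RInt (fun n t => a n * (psi n t * h t)) (fun n => M n * (2 * C)))
    as [H1 H2].
  - intros n t Ht. rewrite !Rabs_mult.
    apply Rmult_le_compat; auto using Rabs_pos.
    + apply Rmult_le_pos; apply Rabs_pos.
    + apply Rmult_le_compat; auto using Rabs_pos. apply EB; auto.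
  - apply (ex_series_scal_r (2 * C)). exact HM.
  - intros n. apply (@ex_RInt_scal R_NormedModule). auto.
  - split.
    + apply ex_RInt_ext with (2 := H1). intros t _. symmetry. apply E.
    + rewrite (RInt_ext _ (fun t => Series (fun n => a n * (psi n t * h t)))) by auto.
      apply is_series_ext with (2 := H2). intros n.
      apply (@RInt_scal R_CompleteNormedModule). auto.
Qed.

Definition mercer_coef (x : R) (n : nat) : R := 2 * psi n x / lam n.

Lemma mercer_coef_bound x : 0 <= x <= 1 ->
  forall n, Rabs (mercer_coef x n) <= 4 * / Rabs (lam n).
Proof.
  intros Hx n. unfold mercer_coef, Rdiv. rewrite !Rabs_mult, Rabs_inv.
  pose proof (eb_bound _ _ _ EB n x Hx). pose proof (eb_large _ _ _ EB n).
  rewrite (Rabs_right 2) by lra.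
  apply Rmult_le_compat_r; [left; apply Rinv_0_lt_compat; lra | lra].
Qed.

Lemma mercer_bound_summable : ex_series (fun n => 4 * / Rabs (lam n)).
Proof. apply (ex_series_scal_l 4 (fun n => / Rabs (lam n))), EB. Qed.

Definition mercer_sum (x z : R) : R := Series (fun n => mercer_coef x n * psi n z).

(** The gap in Bessel's inequality for the section [K(x, .)]. *)
Definition bessel_gap (x : R) : R :=
  (x ^ 3 + (1 - x) ^ 3) / 12 - Series (fun n => 2 * (psi n x * psi n x) / lam n ^ 2).

Lemma mercer_sum_bound x z : 0 <= x <= 1 -> 0 <= z <= 1 ->
  Rabs (mercer_sum x z) <= Series (fun n => 4 * / Rabs (lam n) * 2).
Proof.
  intros Hx Hz. unfold mercer_sum.
  assert (B : forall n, Rabs (mercer_coef x n * psi n z) <= 4 * / Rabs (lam n) * 2).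
  { intros n. rewrite Rabs_mult. apply Rmult_le_compat; auto using Rabs_pos, mercer_coef_bound.
    apply EB; auto. }
  assert (HS : ex_series (fun n => 4 * / Rabs (lam n) * 2)).
  { apply (ex_series_scal_r 2), mercer_bound_summable. }
  apply Rle_trans with (Series (fun n => Rabs (mercer_coef x n * psi n z))).
  - apply Series_Rabs.
    apply (@ex_series_le R_AbsRing R_CompleteNormedModule _ (fun n => 4 * / Rabs (lam n) * 2)); auto.
    intros n. unfold norm; simpl. unfold abs; simpl. rewrite Rabs_Rabsolu. auto.
  - apply Series_le; auto. intros n. split; auto using Rabs_pos.
Qed.

(** The three terms of the expanded square are [A], [- 2 s] and [s], where [A] is the
    squared norm of the section and [s] the sum of Bessel's inequality. *)
Lemma bessel_gap_integral x : 0 <= x <= 1 ->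
  is_RInt (fun z => (kernel x z - mercer_sum x z) * (kernel x z - mercer_sum x z)) 0 1
    (bessel_gap x).
Proof.
  intros Hx.
  set (s := Series (fun n => 2 * (psi n x * psi n x) / lam n ^ 2)).
  pose proof (expansion_RInt (mercer_coef x) (fun n => 4 * / Rabs (lam n))) as EX.
  pose proof (mercer_coef_bound x Hx) as B. pose proof mercer_bound_summable as S0.
  (* against an eigenfunction, by orthogonality *)
  assert (P1 : forall m, is_RInt (fun z => mercer_sum x z * psi m z) 0 1 (psi m x / lam m)).
  { intros m. destruct (EX (psi m) 2 B S0) as [I1 I2].
    - intros; apply EB; auto.
    - intros n. destruct (Nat.eq_dec n m) as [->|Hne].
      + exists (/ 2). apply eb_norm.
      + exists 0. apply eb_orthogonal; auto.
    - replace (psi m x / lam m) with (RInt (fun z => mercer_sum x z * psi m z) 0 1).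
      + apply (@RInt_correct R_CompleteNormedModule). auto.
      + transitivity (Series (fun n => mercer_coef x n * RInt (fun t => psi n t * psi m t) 0 1)).
        * symmetry. apply is_series_unique. exact I2.
        * rewrite (Series_incr_n _ (S m)); [|lia|eexists; exact I2].
          rewrite (Series_ext (fun k => mercer_coef x (S m + k) * RInt _ 0 1) (fun k => 0 * 0)).
          2: { intros k. rewrite (is_RInt_unique _ _ _ _ (eb_orthogonal (S m + k) m ltac:(lia))). ring. }
          rewrite Series_scal_l. simpl pred.
          assert (Z : forall j, (j < m)%nat ->
             sum_f_R0 (fun n => mercer_coef x n * RInt (fun t => psi n t * psi m t) 0 1) j = 0).
          { induction j as [|j IH]; intros Hj.
            - simpl. rewrite (is_RInt_unique _ _ _ _ (eb_orthogonal 0 m ltac:(lia))). ring.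
            - rewrite tech5, IH, (is_RInt_unique _ _ _ _ (eb_orthogonal (S j) m ltac:(lia))) by lia.
              ring. }
          pose proof (is_RInt_unique _ _ _ _ (eb_norm m)) as Em.
          destruct m as [|m].
          -- simpl. rewrite Em. unfold mercer_coef. field. apply eb_nonzero.
          -- rewrite tech5, Z, Em by lia. real_eq. unfold mercer_coef. field. apply eb_nonzero. }
  (* against the section of the kernel, by the eigenvalue equation *)
  assert (P2 : is_RInt (fun z => mercer_sum x z * kernel x z) 0 1 s).
  { assert (HK : forall n, is_RInt (fun z => psi n z * kernel x z) 0 1 (psi n x / lam n)).
    { intros n. apply is_RInt_ext with (fun z => psi n z * kernel z x).
      - intros; rewrite kernel_sym; reflexivity.
      - apply (eigenpair_kernel _ _ (dpsi n)); auto using eb_nonzero. apply EB. }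
    destruct (EX (kernel x) 1 B S0) as [I1 I2].
    - intros; apply kernel_bound; auto.
    - intros n. eexists; apply HK.
    - replace s with (RInt (fun z => mercer_sum x z * kernel x z) 0 1).
      + apply (@RInt_correct R_CompleteNormedModule). auto.
      + unfold mercer_sum at 1. rewrite <- (is_series_unique _ _ I2).
        apply Series_ext. intros n. rewrite (is_RInt_unique _ _ _ _ (HK n)).
        real_eq. unfold mercer_coef. field. apply eb_nonzero. }
  assert (P3 : is_RInt (fun z => mercer_sum x z * mercer_sum x z) 0 1 s).
  { assert (HK : forall n, is_RInt (fun z => psi n z * mercer_sum x z) 0 1 (psi n x / lam n)).
    { intros n. apply is_RInt_ext with (2 := P1 n). intros; real_eq; ring. }
    destruct (EX (mercer_sum x) (Series (fun n => 4 * / Rabs (lam n) * 2)) B S0) as [I1 I2].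
    - intros; apply mercer_sum_bound; auto.
    - intros n. eexists; apply HK.
    - replace s with (RInt (fun z => mercer_sum x z * mercer_sum x z) 0 1).
      + apply (@RInt_correct R_CompleteNormedModule). auto.
      + unfold mercer_sum at 1. rewrite <- (is_series_unique _ _ I2).
        apply Series_ext. intros n. rewrite (is_RInt_unique _ _ _ _ (HK n)).
        real_eq. unfold mercer_coef. field. apply eb_nonzero. }
  pose proof (kernel_norm x) as P0.
  apply is_RInt_ext with (fun z => plus (minus (kernel x z * kernel x z)
     (scal 2 (mercer_sum x z * kernel x z))) (mercer_sum x z * mercer_sum x z)).
  - intros z _. unfold plus, minus, scal; simpl. unfold plus, opp, mult; simpl. ring.
  - replace (bessel_gap x) with (plus (minus ((x ^ 3 + (1 - x) ^ 3) / 12) (scal 2 s)) s).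
    + apply (@is_RInt_plus R_NormedModule); auto.
      apply (@is_RInt_minus R_NormedModule); auto.
      apply (@is_RInt_scal R_NormedModule); auto.
    + unfold plus, minus, scal; simpl. unfold plus, opp, mult; simpl.
      unfold bessel_gap. fold s. real_eq. field.
Qed.

Lemma bessel_gap_nonneg x : 0 <= x <= 1 -> 0 <= bessel_gap x.
Proof.
  intros Hx. apply (is_RInt_ge_0 _ 0 1 _ ltac:(lra) (bessel_gap_integral x Hx)).
  intros z _. apply Rle_0_sqr.
Qed.

Lemma bessel_term_bound n t : 0 <= t <= 1 ->
  Rabs (2 * (psi n t * psi n t) / lam n ^ 2) <= 8 * / Rabs (lam n).
Proof.
  intros Ht. unfold Rdiv. rewrite !Rabs_mult, (Rabs_right 2) by lra.
  pose proof (eb_bound _ _ _ EB n t Ht). pose proof (Rabs_pos (psi n t)).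
  apply Rmult_le_compat; auto using Rabs_pos.
  - repeat apply Rmult_le_pos; auto. lra.
  - nra.
  - apply inv_lam_pow_bound.
Qed.

(** The squared Hilbert-Schmidt norm of the kernel is [1/24], so by [eb_trace2] the
    integral of the non-negative gap is at most zero. *)
Lemma bessel_gap_zero x : 0 <= x <= 1 -> bessel_gap x = 0.
Proof.
  assert (S8 : ex_series (fun n => 8 * / Rabs (lam n))).
  { apply (ex_series_scal_l 8 (fun n => / Rabs (lam n))), EB. }
  set (f := fun n t => 2 * (psi n t * psi n t) / lam n ^ 2).
  assert (Hf : forall n, is_RInt (f n) 0 1 (/ lam n ^ 2)).
  { intros n. replace (/ lam n ^ 2) with (scal (2 / lam n ^ 2) (/ 2)).
    - apply is_RInt_ext with (fun t => scal (2 / lam n ^ 2) (psi n t * psi n t)).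
      + intros t _. unfold f, scal; simpl; unfold mult; simpl. field. apply eb_nonzero.
      + apply (@is_RInt_scal R_NormedModule), eb_norm.
    - unfold scal; simpl; unfold mult; simpl. field. apply eb_nonzero. }
  assert (Hfc : forall n t, continuous (f n) t).
  { intros n t. unfold f, Rdiv.
    cont_mult; [|apply continuous_const]. cont_mult; [apply continuous_const|].
    cont_mult; apply eb_continuous. }
  set (g := fun t => (clamp t ^ 3 + (1 - clamp t) ^ 3) / 12 - Series (fun n => f n (clamp t))).
  assert (Eg : forall t, 0 <= t <= 1 -> g t = bessel_gap t).
  { intros t Ht. unfold g. rewrite clamp_id; auto. }
  intros Hx. rewrite <- Eg by auto.
  apply continuous_nonneg_RInt_zero; auto.
  - intros t. apply (@continuous_minus _ R_AbsRing R_NormedModule).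
    + apply (continuous_comp clamp (fun u => (u ^ 3 + (1 - u) ^ 3) / 12)).
      * apply clamp_continuous.
      * apply (@ex_derive_continuous R_AbsRing R_NormedModule). auto_derive. auto.
    + apply (series_continuous f (fun n => 8 * / Rabs (lam n))); auto.
      intros; apply bessel_term_bound; auto.
  - intros t Ht. rewrite Eg by auto. apply bessel_gap_nonneg; auto.
  - destruct (series_RInt f (fun n => 8 * / Rabs (lam n))) as [I1 I2].
    + intros; apply bessel_term_bound; auto.
    + auto.
    + intros n. eexists; apply Hf.
    + assert (I3 : RInt (fun t => Series (fun n => f n t)) 0 1 = Series (fun n => / lam n ^ 2)).
      { rewrite <- (is_series_unique _ _ I2). apply Series_ext. intros n.
        apply is_RInt_unique. apply Hf. }
      rewrite (RInt_ext g (fun t => minus ((t ^ 3 + (1 - t) ^ 3) / 12) (Series (fun n => f n t)))).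
      2: { intros t. rewrite Rmin_left, Rmax_right by lra. intros Ht.
           unfold g. rewrite clamp_id by lra. reflexivity. }
      assert (I0 : is_RInt (fun t => (t ^ 3 + (1 - t) ^ 3) / 12) 0 1 (/ 24)).
      { apply is_RInt_antiderivative with (fun t => (t ^ 4 - (1 - t) ^ 4) / 48).
        - intros t. auto_derive; auto. field.
        - intros t. apply (@ex_derive_continuous R_AbsRing R_NormedModule). auto_derive. auto.
        - field. }
      rewrite (@RInt_minus R_CompleteNormedModule); [|eexists; exact I0 | exact I1].
      rewrite (is_RInt_unique _ _ _ _ I0), I3.
      change (/ 24 - Series (fun n => / lam n ^ 2) <= 0).
      pose proof (eb_trace2 _ _ _ EB). lra.
Qed.

(** The squared distance between the section [K(x, .)] and its expansion is the
    Bessel gap, and both functions are continuous. *)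
Lemma mercer x z : 0 <= x <= 1 -> 0 <= z <= 1 -> kernel x z = mercer_sum x z.
Proof.
  intros Hx Hz.
  set (F := fun t => Series (fun n => mercer_coef x n * psi n (clamp t))).
  assert (HF : forall t, continuous F t).
  { apply (series_continuous (fun n t => mercer_coef x n * psi n t)
             (fun n => 4 * / Rabs (lam n) * 2)).
    - intros n t Ht. rewrite Rabs_mult.
      apply Rmult_le_compat; auto using Rabs_pos, mercer_coef_bound. apply EB; auto.
    - apply (ex_series_scal_r 2), mercer_bound_summable.
    - intros n t. cont_mult; [apply continuous_const | apply eb_continuous]. }
  assert (EF : forall t, 0 <= t <= 1 -> F t = mercer_sum x t).
  { intros t Ht. unfold F. rewrite clamp_id; auto. }
  assert (Hd : forall t, continuous (fun t => kernel x t - F t) t).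
  { intros t. apply (@continuous_minus _ R_AbsRing R_NormedModule); auto.
    apply kernel_continuous. }
  assert (H0 : (kernel x z - F z) * (kernel x z - F z) = 0).
  { apply (continuous_nonneg_RInt_zero (fun t => (kernel x t - F t) * (kernel x t - F t))); auto.
    - intros t. cont_mult; auto.
    - intros t _. apply Rle_0_sqr.
    - rewrite (RInt_ext _ (fun t => (kernel x t - mercer_sum x t) * (kernel x t - mercer_sum x t))).
      + rewrite (is_RInt_unique _ _ _ _ (bessel_gap_integral x Hx)), bessel_gap_zero by auto. lra.
      + intros t. rewrite Rmin_left, Rmax_right by lra. intros Ht. rewrite EF by lra. reflexivity. }
  rewrite EF in H0 by auto. apply Rmult_integral in H0. destruct H0; lra.
Qed.

Lemma eb_kernel_RInt n y : 0 <= y <= 1 ->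
  is_RInt (fun z => psi n z * kernel z y) 0 1 (psi n y / lam n).
Proof.
  intros Hy. apply (eigenpair_kernel _ _ (dpsi n)); auto using eb_nonzero. apply EB.
Qed.

Lemma iterK_term_bound p x n : 0 <= x <= 1 ->
  Rabs (2 * psi n x / lam n ^ S p) <= 4 * / Rabs (lam n).
Proof.
  intros Hx. unfold Rdiv. rewrite !Rabs_mult, (Rabs_right 2) by lra.
  pose proof (eb_bound _ _ _ EB n x Hx). pose proof (Rabs_pos (psi n x)).
  apply Rmult_le_compat; auto using Rabs_pos, inv_lam_pow_bound; lra.
Qed.

(** The kernel multiplies [psi n] by [1 / lam n], hence each further iteration
    divides the [n]-th coefficient by [lam n]. *)
Lemma iterK_expansion p : forall x y, 0 <= x <= 1 -> 0 <= y <= 1 ->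
  iterK (S p) x y = Series (fun n => 2 * psi n x / lam n ^ S p * psi n y).
Proof.
  induction p as [|p IH]; intros x y Hx Hy.
  - simpl iterK. rewrite mercer by auto. apply Series_ext. intros n.
    unfold mercer_coef. rewrite pow_1. reflexivity.
  - change (iterK (S (S p)) x y) with (RInt (fun z => iterK (S p) x z * kernel z y) 0 1).
    rewrite (RInt_ext _ (fun z => Series (fun n => 2 * psi n x / lam n ^ S p * psi n z) * kernel z y)).
    2: { intros z. rewrite Rmin_left, Rmax_right by lra. intros Hz.
         rewrite IH by lra. reflexivity. }
    destruct (expansion_RInt (fun n => 2 * psi n x / lam n ^ S p) (fun n => 4 * / Rabs (lam n))
       (fun z => kernel z y) 1) as [_ I2].
    + intros n. apply iterK_term_bound; auto.
    + apply mercer_bound_summable.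
    + intros t Ht. apply kernel_bound; auto.
    + intros n. eexists; apply eb_kernel_RInt; auto.
    + rewrite <- (is_series_unique _ _ I2). apply Series_ext. intros n.
      rewrite (is_RInt_unique _ _ _ _ (eb_kernel_RInt n y Hy)).
      real_eq. pose proof (eb_nonzero n). simpl. field. split; auto. apply pow_nonzero; auto.
Qed.

Lemma iterK_trace p :
  is_RInt (fun t => iterK (S p) t t) 0 1 (Series (fun n => / lam n ^ S p)).
Proof.
  set (f := fun n t => 2 / lam n ^ S p * (psi n t * psi n t)).
  assert (Hf : forall n, is_RInt (f n) 0 1 (/ lam n ^ S p)).
  { intros n. assert (lam n ^ S p <> 0) by (apply pow_nonzero, eb_nonzero).
    replace (/ lam n ^ S p) with (scal (2 / lam n ^ S p) (/ 2)).
    - apply (@is_RInt_scal R_NormedModule), eb_norm.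
    - change (2 / lam n ^ S p * / 2 = / lam n ^ S p). field. auto. }
  destruct (series_RInt f (fun n => 4 * / Rabs (lam n) * 2)) as [I1 I2].
  - intros n t Ht. unfold f.
    replace (2 / lam n ^ S p * (psi n t * psi n t))
      with (2 * psi n t / lam n ^ S p * psi n t) by (unfold Rdiv; ring).
    rewrite Rabs_mult. apply Rmult_le_compat; auto using Rabs_pos, iterK_term_bound.
    apply EB; auto.
  - apply (ex_series_scal_r 2), mercer_bound_summable.
  - intros n. eexists; apply Hf.
  - assert (I3 : RInt (fun t => Series (fun n => f n t)) 0 1 = Series (fun n => / lam n ^ S p)).
    { rewrite <- (is_series_unique _ _ I2). apply Series_ext. intros n.
      apply is_RInt_unique. apply Hf. }
    rewrite <- I3. apply is_RInt_ext with (fun t => Series (fun n => f n t)).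
    + intros t. rewrite Rmin_left, Rmax_right by lra. intros Ht.
      rewrite iterK_expansion by lra. apply Series_ext. intros n. unfold f, Rdiv. ring.
    + apply (@RInt_correct R_CompleteNormedModule). auto.
Qed.

End Mercer.

(** * Solution of the boundary value problem *)

Lemma is_derive_unit_spec (f : R -> R) (t l : R) :
  is_derive_unit f t l <->
  forall eps, 0 < eps -> exists d, 0 < d /\
    forall s, 0 <= s <= 1 -> s <> t -> Rabs (s - t) < d ->
      Rabs ((f s - f t) / (s - t) - l) < eps.
Proof.
  unfold is_derive_unit. split.
  - intros H eps Heps.
    destruct (proj1 (filterlim_locally _ _) H (mkposreal eps Heps)) as [d Hd].
    exists d. split; [apply cond_pos|]. intros s Hs Hne Hd'. apply (Hd s); auto.
  - intros H. apply filterlim_locally. intros eps.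
    destruct (H eps (cond_pos eps)) as [d [Hd H']].
    exists (mkposreal d Hd). intros s Hs Hne Hu. apply (H' s); auto.
Qed.

Lemma is_derive_unit_of_derive (f : R -> R) (t l : R) :
  is_derive f t l -> is_derive_unit f t l.
Proof.
  intros H. apply is_derive_Reals in H. apply is_derive_unit_spec. intros eps Heps.
  destruct (H eps Heps) as [d Hd]. exists d. split; [apply cond_pos|].
  intros s _ Hne Hs. specialize (Hd (s - t) ltac:(lra) Hs).
  replace (t + (s - t)) with s in Hd by ring. exact Hd.
Qed.

Lemma derive_of_is_derive_unit (f : R -> R) (t l : R) :
  0 < t < 1 -> is_derive_unit f t l -> is_derive f t l.
Proof.
  intros Ht H. apply is_derive_Reals. intros eps Heps.
  destruct (proj1 (is_derive_unit_spec _ _ _) H eps Heps) as [d [Hd H']].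
  assert (Hm : 0 < Rmin d (Rmin t (1 - t))) by (repeat apply Rmin_pos; lra).
  exists (mkposreal _ Hm). intros h Hh Hhd. simpl in Hhd.
  pose proof (Rmin_l d (Rmin t (1 - t))). pose proof (Rmin_r d (Rmin t (1 - t))).
  pose proof (Rmin_l t (1 - t)). pose proof (Rmin_r t (1 - t)).
  assert (Hhd' := Hhd). apply Rabs_def2 in Hhd'.
  specialize (H' (t + h) ltac:(lra) ltac:(lra)).
  replace (t + h - t) with h in H' by ring. apply H'. lra.
Qed.

Lemma unit_interior_point (t d : R) : 0 <= t <= 1 -> 0 < d ->
  exists s, 0 < s < 1 /\ s <> t /\ Rabs (s - t) < d.
Proof.
  intros Ht Hd. pose proof (Rmin_l (d / 2) (/ 4)). pose proof (Rmin_r (d / 2) (/ 4)).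
  assert (0 < Rmin (d / 2) (/ 4)) by (apply Rmin_pos; lra).
  destruct (Rle_dec t (/ 2)).
  - exists (t + Rmin (d / 2) (/ 4)). repeat split; try lra. apply Rabs_def1; lra.
  - exists (t - Rmin (d / 2) (/ 4)). repeat split; try lra. apply Rabs_def1; lra.
Qed.

Lemma is_derive_unit_unique (f : R -> R) (t l1 l2 : R) : 0 <= t <= 1 ->
  is_derive_unit f t l1 -> is_derive_unit f t l2 -> l1 = l2.
Proof.
  intros Ht H1 H2. apply Rminus_diag_uniq, cond_eq. intros eps Heps.
  destruct (proj1 (is_derive_unit_spec _ _ _) H1 (eps / 2) ltac:(lra)) as [d1 [Hd1 E1]].
  destruct (proj1 (is_derive_unit_spec _ _ _) H2 (eps / 2) ltac:(lra)) as [d2 [Hd2 E2]].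
  destruct (unit_interior_point t (Rmin d1 d2) Ht ltac:(apply Rmin_pos; lra)) as [s [Hs [Hne Hd]]].
  pose proof (Rmin_l d1 d2). pose proof (Rmin_r d1 d2).
  specialize (E1 s ltac:(lra) Hne ltac:(lra)). specialize (E2 s ltac:(lra) Hne ltac:(lra)).
  apply Rabs_def2 in E1. apply Rabs_def2 in E2. apply Rabs_def1; lra.
Qed.

Lemma is_derive_unit_ext (f g : R -> R) (t l : R) : 0 <= t <= 1 ->
  (forall s, 0 <= s <= 1 -> f s = g s) -> is_derive_unit f t l -> is_derive_unit g t l.
Proof.
  intros Ht E H. apply is_derive_unit_spec. intros eps Heps.
  destruct (proj1 (is_derive_unit_spec _ _ _) H eps Heps) as [d [Hd H']].
  exists d. split; auto. intros s Hs Hne Hds. rewrite <- !E by auto. auto.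
Qed.

(** One-sided differentiability forces continuity at the end points. *)
Lemma is_derive_unit_limit (f g : R -> R) (t l : R) : 0 <= t <= 1 ->
  is_derive_unit f t l -> continuity_pt g t -> (forall s, 0 < s < 1 -> f s = g s) ->
  f t = g t.
Proof.
  intros Ht H Hg E. apply Rminus_diag_uniq, cond_eq. intros eps Heps.
  destruct (proj1 (is_derive_unit_spec _ _ _) H 1 ltac:(lra)) as [d1 [Hd1 E1]].
  destruct (Hg (eps / 2) ltac:(lra)) as [d2 [Hd2 E2]].
  set (d3 := eps / 2 / (Rabs l + 1)).
  pose proof (Rabs_pos l) as Hl.
  assert (Hd3 : 0 < d3) by (apply Rdiv_lt_0_compat; lra).
  destruct (unit_interior_point t (Rmin d1 (Rmin d2 d3)) Ht
     ltac:(repeat apply Rmin_pos; lra)) as [s [Hs [Hne Hd]]].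
  pose proof (Rmin_l d1 (Rmin d2 d3)). pose proof (Rmin_r d1 (Rmin d2 d3)).
  pose proof (Rmin_l d2 d3). pose proof (Rmin_r d2 d3).
  specialize (E1 s ltac:(lra) Hne ltac:(lra)).
  assert (E2' : Rabs (g s - g t) < eps / 2).
  { apply (E2 s). split; [split; [exact I | auto]|]. simpl. unfold R_dist. lra. }
  assert (E3 : Rabs (f s - f t) < eps / 2).
  { replace (f s - f t) with ((f s - f t) / (s - t) * (s - t)) by (field; lra).
    rewrite Rabs_mult.
    assert (Hq : Rabs ((f s - f t) / (s - t)) <= Rabs l + 1).
    { replace ((f s - f t) / (s - t)) with (l + ((f s - f t) / (s - t) - l)) by ring.
      apply Rle_trans with (1 := Rabs_triang _ _). lra. }
    apply Rle_lt_trans with ((Rabs l + 1) * Rabs (s - t)).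
    - apply Rmult_le_compat_r; [apply Rabs_pos | auto].
    - apply Rlt_le_trans with ((Rabs l + 1) * d3).
      + apply Rmult_lt_compat_l; lra.
      + unfold d3. right. field. lra. }
  rewrite E in E3 by auto. apply Rabs_def2 in E2'. apply Rabs_def2 in E3.
  apply Rabs_def1; lra.
Qed.

(** Every solution of [f'' = - mu f] is a combination of an even one and an odd
    one about the midpoint; with Wronskian 1 its coefficients are the Wronskians
    of the solution with them. *)
Record fundamental (mu : R) (c dc s ds : R -> R) : Prop := {
  fu_c : forall t, is_derive c t (dc t);
  fu_dc : forall t, is_derive dc t (- mu * c t);
  fu_s : forall t, is_derive s t (ds t);
  fu_ds : forall t, is_derive ds t (- mu * s t);
  fu_wronskian : forall t, c t * ds t - dc t * s t = 1;
  fu_mid : s (/ 2) = 0;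
  fu_parity : c 0 = c 1 /\ dc 0 = - dc 1 /\ s 0 = - s 1 /\ ds 0 = ds 1 }.

(** The Wronskians of a solution with [c] and [s] are constant, so the solution
    is a combination of the two; the boundary conditions split by parity. *)
Lemma bvp_eigenvalue_iff (mu : R) (c dc s ds : R -> R) :
  fundamental mu c dc s ds ->
  (bvp_eigenvalue mu <-> 2 * c 1 = dc 1 \/ ds 1 = 0).
Proof.
  intros [Fc Fdc Fs Fds W Hmid (P1 & P2 & P3 & P4)]. split.
  - intros (phi & dphi & d2phi & H1 & H2 & H3 & H4 & H5 & t0 & Ht0 & Hn0).
    assert (H1' : forall t, 0 < t < 1 -> is_derive phi t (dphi t)).
    { intros t Ht. apply derive_of_is_derive_unit; auto. apply H1. lra. }
    set (W1 := fun t => phi t * ds t - dphi t * s t).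
    set (W2 := fun t => dphi t * c t - phi t * dc t).
    assert (HW1 : forall t, 0 < t < 1 -> is_derive W1 t 0).
    { intros t Ht. unfold W1. auto_derive.
      - repeat split; eexists; eauto.
      - rewrite (is_derive_unique (fun u : R => phi u) _ _ (H1' t Ht)),
          (is_derive_unique (fun u : R => dphi u) _ _ (H2 t Ht)),
          (is_derive_unique (fun u : R => s u) _ _ (Fs t)),
          (is_derive_unique (fun u : R => ds u) _ _ (Fds t)).
        replace (d2phi t) with (- (mu * phi t)) by (rewrite <- H3; auto; ring). ring. }
    assert (HW2 : forall t, 0 < t < 1 -> is_derive W2 t 0).
    { intros t Ht. unfold W2. auto_derive.
      - repeat split; eexists; eauto.
      - rewrite (is_derive_unique (fun u : R => phi u) _ _ (H1' t Ht)),
          (is_derive_unique (fun u : R => dphi u) _ _ (H2 t Ht)),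
          (is_derive_unique (fun u : R => c u) _ _ (Fc t)),
          (is_derive_unique (fun u : R => dc u) _ _ (Fdc t)).
        replace (d2phi t) with (- (mu * phi t)) by (rewrite <- H3; auto; ring). ring. }
    assert (Hconst : forall w, (forall t, 0 < t < 1 -> is_derive w t 0) ->
      forall t, 0 < t < 1 -> w t = w (/ 2)).
    { intros w Hw t Ht. destruct (Rtotal_order t (/ 2)) as [L|[->|L]]; auto.
      - apply (@eq_is_derive R_NormedModule w t (/ 2)); auto.
        intros u Hu. apply Hw. lra.
      - symmetry. apply (@eq_is_derive R_NormedModule w (/ 2) t); auto.
        intros u Hu. apply Hw. lra. }
    set (A := W1 (/ 2)). set (B := W2 (/ 2)).
    set (g := fun t => A * c t + B * s t).
    set (dg := fun t => A * dc t + B * ds t).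
    assert (Hg : forall t, is_derive g t (dg t)).
    { intros t. unfold g, dg. auto_derive; [repeat split; eexists; eauto|].
      rewrite (is_derive_unique (fun u : R => c u) _ _ (Fc t)),
        (is_derive_unique (fun u : R => s u) _ _ (Fs t)). ring. }
    assert (Ein : forall t, 0 < t < 1 -> phi t = g t).
    { intros t Ht. unfold g, A, B.
      rewrite <- (Hconst W1 HW1 t Ht), <- (Hconst W2 HW2 t Ht). unfold W1, W2.
      transitivity (phi t * (c t * ds t - dc t * s t)); [rewrite W; ring | ring]. }
    assert (E : forall t, 0 <= t <= 1 -> phi t = g t).
    { intros t Ht. apply (is_derive_unit_limit phi g t (dphi t)); auto.
      apply derivable_continuous_pt, ex_derive_Reals_0. eexists; apply Hg. }
    assert (Ed : forall t, 0 <= t <= 1 -> dphi t = dg t).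
    { intros t Ht. apply (is_derive_unit_unique g t); auto.
      - apply (is_derive_unit_ext phi); auto.
      - apply is_derive_unit_of_derive. auto. }
    rewrite !E, Ed in H4 by lra. rewrite !Ed in H5 by lra.
    unfold g, dg in H4, H5. rewrite P1, P2, P3, P4 in H4. rewrite P2, P4 in H5.
    destruct (Req_dec (ds 1) 0) as [|Hds]; auto. left.
    assert (HB : B = 0).
    { assert (HB : B * ds 1 = 0) by lra. apply Rmult_integral in HB. tauto. }
    rewrite HB in *.
    assert (HA : A <> 0).
    { intros HA. apply Hn0. rewrite E by auto. unfold g. rewrite HA, HB. ring. }
    apply Rmult_eq_reg_l with A; auto. lra.
  - intros [Hc|Hs].
    + exists c, dc, (fun t => - mu * c t).
      refine (conj _ (conj _ (conj _ (conj _ (conj _ _))))); intros.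
      * apply is_derive_unit_of_derive; auto.
      * auto.
      * ring.
      * lra.
      * lra.
      * exists (/ 2). split; [lra|]. intros H. specialize (W (/ 2)).
        rewrite H, Hmid in W. lra.
    + exists s, ds, (fun t => - mu * s t).
      refine (conj _ (conj _ (conj _ (conj _ (conj _ _))))); intros.
      * apply is_derive_unit_of_derive; auto.
      * auto.
      * ring.
      * lra.
      * lra.
      * exists 1. split; [lra|]. intros H. specialize (W 1).
        rewrite H, Hs in W. lra.
Qed.

Lemma cosh_sinh_sq (t : R) : cosh t * cosh t - sinh t * sinh t = 1.
Proof.
  unfold cosh, sinh.
  transitivity (exp t * exp (- t)); [field|]. rewrite <- exp_plus.
  replace (t + - t) with 0 by ring. apply exp_0.
Qed.

Lemma cosh_opp (t : R) : cosh (- t) = cosh t.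
Proof. unfold cosh. rewrite Ropp_involutive. lra. Qed.

Lemma sinh_opp (t : R) : sinh (- t) = - sinh t.
Proof. unfold sinh. rewrite Ropp_involutive. lra. Qed.

Lemma cosh_pos (t : R) : 0 < cosh t.
Proof. unfold cosh. pose proof (exp_pos t). pose proof (exp_pos (- t)). lra. Qed.

Lemma sinh_pos (t : R) : 0 < t -> 0 < sinh t.
Proof. intros H. unfold sinh. pose proof (exp_increasing (- t) t ltac:(lra)). lra. Qed.

Lemma half_0 (k : R) : k * (0 - / 2) = - (k / 2).
Proof. field. Qed.

Lemma half_1 (k : R) : k * (1 - / 2) = k / 2.
Proof. field. Qed.

Lemma fundamental_trig (k : R) : 0 < k ->
  fundamental (k ^ 2) (fun t => cos (k * (t - / 2))) (fun t => - k * sin (k * (t - / 2)))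
    (fun t => sin (k * (t - / 2)) / k) (fun t => cos (k * (t - / 2))).
Proof.
  intros Hk. constructor; intros.
  - auto_derive; auto. unfold Rminus. ring.
  - auto_derive; auto. unfold Rminus. ring.
  - auto_derive; auto. unfold Rminus. field. lra.
  - auto_derive; auto. unfold Rminus. field. lra.
  - set (u := k * (t - / 2)). pose proof (sin2_cos2 u) as E. unfold Rsqr in E.
    rewrite <- E. field. lra.
  - replace (k * (/ 2 - / 2)) with 0 by ring. rewrite sin_0. field. lra.
  - rewrite half_0, half_1, cos_neg, sin_neg. repeat split; field; lra.
Qed.

Lemma fundamental_hyperbolic (k : R) : 0 < k ->
  fundamental (- k ^ 2) (fun t => cosh (k * (t - / 2))) (fun t => k * sinh (k * (t - / 2)))
    (fun t => sinh (k * (t - / 2)) / k) (fun t => cosh (k * (t - / 2))).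
Proof.
  intros Hk. constructor; intros.
  - unfold cosh, sinh. auto_derive; auto. unfold Rminus. field.
  - unfold cosh, sinh. auto_derive; auto. unfold Rminus. field.
  - unfold cosh, sinh. auto_derive; auto. unfold Rminus. field. lra.
  - unfold cosh, sinh. auto_derive; auto. unfold Rminus. field. lra.
  - rewrite <- (cosh_sinh_sq (k * (t - / 2))). field. lra.
  - replace (k * (/ 2 - / 2)) with 0 by ring. rewrite sinh_0. field. lra.
  - rewrite half_0, half_1, cosh_opp, sinh_opp. repeat split; field; lra.
Qed.

(** Case [mu = 0], needed to exclude 0 from the spectrum. *)
Lemma fundamental_linear :
  fundamental 0 (fun _ => 1) (fun _ => 0) (fun t => t - / 2) (fun _ => 1).
Proof.
  constructor; intros; try (auto_derive; auto; unfold Rminus; ring); try lra.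
Qed.

Lemma bvp_eigenvalue_pos (k : R) : 0 < k ->
  (bvp_eigenvalue (k ^ 2) <-> even_char (k / 2) = 0 \/ cos (k / 2) = 0).
Proof.
  intros Hk. rewrite (bvp_eigenvalue_iff _ _ _ _ _ (fundamental_trig k Hk)), half_1.
  unfold even_char. split; (intros [H|H]; [left; lra | right; lra]).
Qed.

Lemma bvp_eigenvalue_neg (k : R) : 0 < k ->
  (bvp_eigenvalue (- k ^ 2) <-> cosh (k / 2) = k / 2 * sinh (k / 2)).
Proof.
  intros Hk. rewrite (bvp_eigenvalue_iff _ _ _ _ _ (fundamental_hyperbolic k Hk)), half_1.
  pose proof (cosh_pos (k / 2)). split; [intros [E|E]; lra | intros E; left; lra].
Qed.

Lemma bvp_eigenvalue_zero : ~ bvp_eigenvalue 0.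
Proof. rewrite (bvp_eigenvalue_iff _ _ _ _ _ fundamental_linear). intros [H|H]; lra. Qed.

Lemma hyperbolic_char_increasing (a b : R) : 0 <= a -> a < b ->
  a * sinh a - cosh a < b * sinh b - cosh b.
Proof.
  intros Ha Hab.
  destruct (MVT_cor2 (fun t => t * sinh t - cosh t) (fun t => t * cosh t) a b Hab)
    as [c [Hc1 Hc2]].
  { intros c Hc. apply is_derive_Reals. unfold sinh, cosh. auto_derive; auto. field. }
  cbv beta in Hc1. pose proof (cosh_pos c).
  assert (0 < c * cosh c * (b - a)).
  { apply Rmult_lt_0_compat; [apply Rmult_lt_0_compat|]; lra. }
  lra.
Qed.

Lemma coth_fixed_point (a : R) : 0 < a /\ a = coth a -> 1 < a /\ cosh a = a * sinh a.
Proof.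
  intros [Ha E]. pose proof (sinh_pos a Ha) as Hs.
  assert (E' : cosh a = a * sinh a).
  { rewrite E at 2. unfold coth. field. lra. }
  split; auto. unfold cosh, sinh in *.
  pose proof (exp_pos (- a)). nra.
Qed.

Lemma coth_fixed_point_unique (a b : R) : 0 < a -> 0 < b ->
  cosh a = a * sinh a -> cosh b = b * sinh b -> a = b.
Proof.
  intros Ha Hb Ea Eb. destruct (Rtotal_order a b) as [L|[L|L]]; auto.
  - pose proof (hyperbolic_char_increasing a b ltac:(lra) L). lra.
  - pose proof (hyperbolic_char_increasing b a ltac:(lra) L). lra.
Qed.

Lemma cos_zero_odd_multiple (u : R) : 0 < u -> cos u = 0 ->
  exists n, u = INR n * PI + PI / 2.
Proof.
  intros Hu E. destruct (nearest_multiple_PI u Hu) as [n Hn]. exists n.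
  destruct (Req_dec u (INR n * PI + PI / 2)) as [|Hne]; auto. exfalso.
  replace u with (INR n * PI + (u - INR n * PI)) in E by ring.
  rewrite cos_add_INR_PI in E. apply Rmult_integral in E. destruct E as [E|E].
  - apply (pow_nonzero (-1) n); lra.
  - assert (0 < cos (u - INR n * PI)) by (apply cos_gt_0; lra). lra.
Qed.

(** The square roots of the positive eigenvalues are the odd multiples of [PI] and
    the numbers [2 x m], and these interlace: [2 x m] lies within [PI] of [2 m PI]. So
    the explicit list is increasing, and an increasing list is determined by
    its set of values. *)
Lemma eigenvalues_explicit (lambda x : nat -> R) (alpha : R) :
  increasing_enum 0 lambda bvp_eigenvalue ->
  increasing_enum 1 x positive_cot_root ->
  0 < alpha /\ alpha = coth alpha ->
  lambda O = - (2 * alpha) ^ 2 /\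
  (forall m, lambda (2 * m + 1)%nat = (INR (2 * m + 1) * PI) ^ 2) /\
  (forall m, lambda (2 * S m)%nat = (2 * x (S m)) ^ 2).
Proof.
  intros Hl Hx Ha. destruct (coth_fixed_point alpha Ha) as [Ha1 Ea].
  pose proof PI_RGT_0 as Hpi. pose proof (root_location x Hx) as Hloc.
  set (k := fun n => if Nat.even n then 2 * x (Nat.div2 n) else INR n * PI).
  set (mu := fun n => match n with O => - (2 * alpha) ^ 2 | S _ => k n ^ 2 end).
  assert (Kodd : forall m, k (2 * m + 1)%nat = INR (2 * m + 1) * PI).
  { intros m. unfold k. rewrite Nat.even_odd. reflexivity. }
  assert (Keven : forall m, k (2 * m)%nat = 2 * x m).
  { intros m. unfold k. rewrite Nat.even_even, Nat.div2_double. reflexivity. }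
  assert (Hk0 : forall n, (1 <= n)%nat -> 0 < k n /\ k n < k (S n)).
  { intros n Hn. destruct (Nat.Even_or_Odd n) as [[m ->]|[m ->]].
    - replace (S (2 * m)) with (2 * m + 1)%nat by lia. rewrite Keven, Kodd.
      destruct (Hloc m ltac:(lia)) as [Hb _].
      assert (1 <= INR m) by (apply (le_INR 1); lia).
      rewrite plus_INR, mult_INR. simpl (INR 2). simpl (INR 1). split; nra.
    - replace (S (2 * m + 1)) with (2 * S m)%nat by lia. rewrite Keven, Kodd.
      destruct (Hloc (S m) ltac:(lia)) as [Hb _]. pose proof (pos_INR m).
      rewrite S_INR in Hb. rewrite plus_INR, mult_INR. simpl (INR 2). simpl (INR 1).
      split; nra. }
  assert (Emu : forall n, (1 <= n)%nat -> mu n = k n ^ 2).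
  { intros [|n] Hn; [lia | reflexivity]. }
  assert (Hmu : increasing_enum 0 mu bvp_eigenvalue).
  { split.
    - intros [|n] _; unfold mu.
      + destruct (Hk0 1%nat ltac:(lia)) as [K _]. simpl. nra.
      + destruct (Hk0 (S n) ltac:(lia)) as [K1 K2]. simpl. nra.
    - intros t. destruct (Rtotal_order t 0) as [Ht|[->|Ht]].
      + set (q := sqrt (- t)). assert (Hq : 0 < q) by (apply sqrt_lt_R0; lra).
        assert (Eq : t = - q ^ 2) by (unfold q; rewrite pow2_sqrt by lra; ring).
        rewrite Eq, bvp_eigenvalue_neg by auto. split.
        * intros E. exists O. split; [lia|]. unfold mu.
          assert (Hqa : alpha = q / 2) by (apply coth_fixed_point_unique; auto; lra).
          rewrite Hqa. field.
        * intros [[|n] [_ E]].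
          -- assert (H : q / 2 = alpha).
             { unfold mu in E. apply Rmult_eq_reg_r with (2 * (q / 2 + alpha)); [nra|].
               nra. }
             rewrite H. exact Ea.
          -- unfold mu in E. pose proof (pow2_ge_0 (k (S n))). lra.
      + split; [intros H; exfalso; revert H; apply bvp_eigenvalue_zero|].
        intros [[|n] [_ E]]; unfold mu in E.
        * nra.
        * destruct (Hk0 (S n) ltac:(lia)) as [K _]. nra.
      + set (q := sqrt t). assert (Hq : 0 < q) by (apply sqrt_lt_R0; lra).
        assert (Eq : t = q ^ 2) by (unfold q; rewrite pow2_sqrt by lra; ring).
        rewrite Eq, bvp_eigenvalue_pos by auto. split.
        * intros [E|E].
          -- assert (P : positive_cot_root (q / 2)) by (apply positive_cot_root_iff; split; [lra | auto]).
             apply (proj2 Hx) in P. destruct P as [n [Hn En]].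
             exists (2 * n)%nat. split; [lia|].
             rewrite Emu, Keven, En by lia. field.
          -- destruct (cos_zero_odd_multiple (q / 2) ltac:(lra) E) as [n En].
             exists (2 * n + 1)%nat. split; [lia|].
             rewrite Emu, Kodd by lia.
             rewrite plus_INR, mult_INR. simpl (INR 2). simpl (INR 1).
             replace (((1 + 1) * INR n + 1) * PI) with q by lra. reflexivity.
        * intros [[|n] [_ E]]; unfold mu in E; [nra|].
          destruct (Hk0 (S n) ltac:(lia)) as [K _].
          assert (Eqk : q = k (S n)).
          { apply Rmult_eq_reg_r with (q + k (S n)); [nra|]. lra. }
          rewrite Eqk. destruct (Nat.Even_or_Odd (S n)) as [[m Em]|[m Em]]; rewrite Em.
          -- left. rewrite Keven. replace (2 * x m / 2) with (x m) by field.
             apply Hloc. lia.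
          -- right. rewrite Kodd, plus_INR, mult_INR. simpl (INR 2). simpl (INR 1).
             replace (((1 + 1) * INR m + 1) * PI / 2) with (INR m * PI + PI / 2) by field.
             rewrite cos_add_INR_PI, cos_PI2. ring. }
  pose proof (increasing_enum_unique 0 lambda mu _ Hl Hmu) as U.
  split; [|split].
  - rewrite U by lia. reflexivity.
  - intros m. rewrite U, Emu, Kodd by lia. reflexivity.
  - intros m. rewrite U, Emu, Keven by lia. reflexivity.
Qed.

(** * Normalised eigenfunctions and sums over the spectrum *)

Lemma fundamental_even_eigenpair (mu : R) (c dc s ds : R -> R) :
  fundamental mu c dc s ds -> 2 * c 1 = dc 1 -> c 1 <> 0 ->
  eigenpair mu (fun t => c t / c 1) (fun t => dc t / c 1).
Proof.
  intros [Fc Fdc Fs Fds W Hmid (P1 & P2 & P3 & P4)] E Hn. constructor.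
  - intros t. auto_derive; [repeat split; eexists; eauto|].
    rewrite (is_derive_unique (fun u : R => c u) _ _ (Fc t)). field. auto.
  - intros t. auto_derive; [repeat split; eexists; eauto|].
    rewrite (is_derive_unique (fun u : R => dc u) _ _ (Fdc t)). field. auto.
  - rewrite P1, P2, <- E. field. auto.
  - rewrite P2. field. auto.
Qed.

Lemma fundamental_odd_eigenpair (mu : R) (c dc s ds : R -> R) :
  fundamental mu c dc s ds -> ds 1 = 0 -> s 0 <> 0 ->
  eigenpair mu (fun t => s t / s 0) (fun t => ds t / s 0).
Proof.
  intros [Fc Fdc Fs Fds W Hmid (P1 & P2 & P3 & P4)] E Hn. constructor.
  - intros t. auto_derive; [repeat split; eexists; eauto|].
    rewrite (is_derive_unique (fun u : R => s u) _ _ (Fs t)). field. auto.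
  - intros t. auto_derive; [repeat split; eexists; eauto|].
    rewrite (is_derive_unique (fun u : R => ds u) _ _ (Fds t)). field. auto.
  - rewrite P4, E. replace (s 1) with (- s 0) by lra. field. auto.
  - rewrite P4, E. field. auto.
Qed.

Lemma inv_square_summable : ex_series (fun n => / INR (S n) ^ 2).
Proof.
  set (f := fun n => / INR (S n) ^ 2).
  assert (Hstep : forall n, sum_n f (S n) = sum_n f n + f (S n)).
  { intros n. rewrite sum_Sn. reflexivity. }
  assert (Hf : forall n, 0 < f n).
  { intros n. apply Rinv_0_lt_compat, pow_lt, lt_0_INR. lia. }
  (* telescoping against [1/n - 1/(n+1)] *)
  assert (H : forall n, sum_n f n <= 2 - / INR (S n)).
  { induction n as [|n IH].
    - rewrite sum_O. unfold f. simpl. lra.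
    - rewrite Hstep. unfold f at 2.
      assert (H0 : 0 < INR (S n)) by (apply lt_0_INR; lia).
      rewrite (S_INR (S n)). set (v := INR (S n)) in *.
      assert (/ (v + 1) ^ 2 <= / v - / (v + 1)).
      { replace (/ v - / (v + 1)) with (/ (v * (v + 1))) by (field; lra).
        apply Rinv_le_contravar; nra. }
      lra. }
  destruct (ex_finite_lim_seq_incr (sum_n f) 2) as [l Hl].
  - intros n. rewrite Hstep. specialize (Hf (S n)). lra.
  - intros n. specialize (H n).
    assert (0 < / INR (S n)) by (apply Rinv_0_lt_compat, lt_0_INR; lia). lra.
  - exists l. exact Hl.
Qed.

Lemma is_series_interleave (a : nat -> R) (l1 l2 : R) :
  is_series (fun n => a (2 * n)%nat) l1 -> is_series (fun n => a (2 * n + 1)%nat) l2 ->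
  is_series a (l1 + l2).
Proof.
  intros H1 H2.
  assert (E : forall (b : nat -> R) y l, y = 1 -> is_series b l <-> is_pseries b y l).
  { intros b y l ->. unfold is_pseries.
    split; intros H; apply is_series_ext with (2 := H); intros n;
      rewrite pow_n_pow, pow1; unfold scal; simpl; unfold mult; simpl; ring. }
  apply (E a 1); auto. replace (l1 + l2) with (l1 + 1 * l2) by ring.
  apply is_pseries_odd_even; apply E; auto; ring.
Qed.

Section Spectrum.

Variables (lam x : nat -> R) (alpha : R).
Hypothesis L0 : lam O = - (2 * alpha) ^ 2.
Hypothesis Lodd : forall m, lam (2 * m + 1)%nat = (INR (2 * m + 1) * PI) ^ 2.
Hypothesis Leven : forall m, lam (2 * S m)%nat = (2 * x (S m)) ^ 2.
Hypothesis Ha : 1 < alpha.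
Hypothesis Ea : cosh alpha = alpha * sinh alpha.
Hypothesis Hloc : forall n, (1 <= n)%nat ->
    INR n * PI - PI / 2 < x n < INR n * PI + PI / 2 /\ even_char (x n) = 0.

Lemma root_ge n : INR (S n) <= x (S n).
Proof.
  destruct (Hloc (S n) ltac:(lia)) as [H _]. pose proof PI2_3_2.
  assert (1 <= INR (S n)) by (apply (le_INR 1); lia). nra.
Qed.

Lemma nat_trichotomy (n : nat) :
  ((n = O) + {m | n = (2 * m + 1)%nat} + {m | n = (2 * S m)%nat})%type.
Proof.
  destruct n as [|n]; [left; left; reflexivity|].
  pose proof (Nat.div2_odd n) as E. destruct (Nat.odd n) eqn:O; simpl Nat.b2n in E.
  - right. exists (Nat.div2 n). lia.
  - left. right. exists (Nat.div2 n). lia.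
Qed.

Lemma eigenfunction (n : nat) :
  {p : (R -> R) * (R -> R) |
    eigenpair (lam n) (fst p) (snd p) /\ fst p 0 = 1 /\ fst p 1 = (-1) ^ n /\
    forall t, 0 <= t <= 1 -> Rabs (fst p t) <= 2}.
Proof.
  destruct (nat_trichotomy n) as [[->|[m ->]]|[m ->]].
  - (* the negative eigenvalue: [cosh], with [cosh u <= exp alpha <= 2 cosh alpha] *)
    rewrite L0. pose proof (fundamental_hyperbolic (2 * alpha) ltac:(lra)) as F.
    set (c := fun t => cosh (2 * alpha * (t - / 2))) in F.
    set (dc := fun t => 2 * alpha * sinh (2 * alpha * (t - / 2))) in F.
    assert (C1 : c 1 = cosh alpha) by (unfold c; f_equal; field).
    pose proof (cosh_pos alpha) as Hc.
    exists (fun t => c t / c 1, fun t => dc t / c 1). cbn [fst snd]. split; [|split; [|split]].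
    + apply (fundamental_even_eigenpair _ _ _ _ _ F); [|lra].
      rewrite C1, Ea. unfold dc. replace (2 * alpha * (1 - / 2)) with alpha by field. ring.
    + destruct (fu_parity _ _ _ _ _ F) as [-> _]. field. lra.
    + simpl. field. lra.
    + intros t Ht. rewrite C1, Rabs_pos_eq.
      2: { apply Rdiv_le_0_compat; [left; apply cosh_pos | auto]. }
      apply Rmult_le_reg_r with (cosh alpha); auto.
      unfold Rdiv. rewrite Rmult_assoc, Rinv_l by lra.
      assert (Hoff : - / 2 <= t - / 2 <= / 2) by lra. unfold c.
      set (u := 2 * alpha * (t - / 2)).
      assert (Hu : - alpha <= u <= alpha) by (unfold u; nra).
      assert (exp u <= exp alpha).
      { destruct (Req_dec u alpha) as [->|]; [lra|]. left. apply exp_increasing. lra. }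
      assert (exp (- u) <= exp alpha).
      { destruct (Req_dec (- u) alpha) as [->|]; [lra|]. left. apply exp_increasing. lra. }
      unfold cosh. pose proof (exp_pos (- alpha)). lra.
  - rewrite Lodd. set (k := INR (2 * m + 1) * PI).
    assert (Hk : 0 < k).
    { apply Rmult_lt_0_compat; [apply lt_0_INR; lia | apply PI_RGT_0]. }
    assert (Ek : k / 2 = INR m * PI + PI / 2).
    { unfold k. rewrite plus_INR, mult_INR. simpl. field. }
    pose proof (fundamental_trig k Hk) as F.
    set (s := fun t => sin (k * (t - / 2)) / k) in F.
    set (ds := fun t => cos (k * (t - / 2))) in F.
    assert (S0 : s 0 = - (-1) ^ m / k).
    { unfold s. rewrite half_0, sin_neg, Ek, sin_add_INR_PI, sin_PI2. field. lra. }
    assert (Hm : (-1) ^ m <> 0) by (apply pow_nonzero; lra).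
    assert (Hs : s 0 <> 0).
    { rewrite S0. unfold Rdiv. apply Rmult_integral_contrapositive_currified; [lra|].
      apply Rinv_neq_0_compat. lra. }
    exists (fun t => s t / s 0, fun t => ds t / s 0). cbn [fst snd]. split; [|split; [|split]].
    + apply (fundamental_odd_eigenpair _ _ _ _ _ F); auto.
      unfold ds. rewrite half_1, Ek, cos_add_INR_PI, cos_PI2. ring.
    + field. auto.
    + destruct (fu_parity _ _ _ _ _ F) as (_ & _ & P & _).
      replace (s 1) with (- s 0) by (cbv beta in P; fold (s 0) (s 1) in P; lra).
      rewrite pow_add, pow_mult. replace ((-1) ^ 2) with 1 by ring. rewrite pow1. simpl. field. auto.
    + intros t _.
      assert (Hq : s t / s 0 = - ((-1) ^ m * sin (k * (t - / 2)))).
      { rewrite S0. unfold s.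
        assert (Hi : / (-1) ^ m = (-1) ^ m).
        { apply Rmult_eq_reg_l with ((-1) ^ m); auto. rewrite pow_m1_sq, Rinv_r; auto. }
        transitivity (- (sin (k * (t - / 2)) / (-1) ^ m)); [field; split; lra|].
        unfold Rdiv. rewrite Hi. ring. }
      rewrite Hq, Rabs_Ropp, Rabs_mult, pow_1_abs.
      pose proof (SIN_bound (k * (t - / 2))). rewrite Rmult_1_l. apply Rabs_le. lra.
  - rewrite Leven. destruct (Hloc (S m) ltac:(lia)) as [_ E].
    pose proof (root_ge m) as Hr. set (r := x (S m)) in *.
    assert (H1 : 1 <= r).
    { apply Rle_trans with (2 := Hr). apply (le_INR 1). lia. }
    pose proof (fundamental_trig (2 * r) ltac:(lra)) as F.
    set (c := fun t => cos (2 * r * (t - / 2))) in F.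
    set (dc := fun t => - (2 * r) * sin (2 * r * (t - / 2))) in F.
    assert (C1 : c 1 = cos r) by (unfold c; f_equal; field).
    unfold even_char in E.
    (* [cos^2 r (1 + 1/r^2) = 1] *)
    assert (Hc : / 4 <= cos r * cos r).
    { pose proof (sin2_cos2 r) as Q. unfold Rsqr in Q.
      assert (cos r * cos r = r * r * (sin r * sin r)) by (replace (cos r) with (- (r * sin r)) by lra; ring).
      nra. }
    assert (Hc0 : cos r <> 0) by (intros Z; rewrite Z in Hc; lra).
    exists (fun t => c t / c 1, fun t => dc t / c 1). cbn [fst snd]. split; [|split; [|split]].
    + apply (fundamental_even_eigenpair _ _ _ _ _ F); [|rewrite C1; auto].
      rewrite C1. unfold dc. replace (2 * r * (1 - / 2)) with r by field. lra.
    + destruct (fu_parity _ _ _ _ _ F) as [P _]. rewrite P. field. rewrite C1. auto.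
    + rewrite pow_mult. replace ((-1) ^ 2) with 1 by ring. rewrite pow1. field.
      rewrite C1. auto.
    + intros t _. unfold Rdiv. rewrite Rabs_mult, Rabs_inv, C1.
      assert (Hh : / 2 <= Rabs (cos r)).
      { apply Rsqr_incr_0_var; [|apply Rabs_pos]. rewrite <- Rsqr_abs. unfold Rsqr. lra. }
      pose proof (COS_bound (2 * r * (t - / 2))) as B.
      assert (Rabs (c t) <= 1) by (unfold c; apply Rabs_le; lra).
      apply Rmult_le_reg_r with (Rabs (cos r)); [lra|].
      rewrite Rmult_assoc, Rinv_l by lra. lra.
Qed.

Lemma lam_square_bound n : INR n ^ 2 <= lam n \/ n = O.
Proof.
  pose proof PI2_3_2 as Hpi.
  destruct (nat_trichotomy n) as [[->|[m ->]]|[m ->]]; auto; left.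
  - rewrite Lodd. apply pow_incr. pose proof (pos_INR (2 * m + 1)). nra.
  - rewrite Leven. apply pow_incr. split; [apply pos_INR|].
    pose proof (root_ge m). rewrite mult_INR. simpl (INR 2). lra.
Qed.

Lemma lam_large n : 1 <= Rabs (lam n).
Proof.
  destruct (lam_square_bound n) as [H|Hn]; [|subst n].
  - destruct n as [|n].
    + rewrite L0, Rabs_Ropp, Rabs_pos_eq by apply pow2_ge_0. nra.
    + assert (1 <= INR (S n)) by (apply (le_INR 1); lia).
      rewrite Rabs_pos_eq; nra.
  - rewrite L0, Rabs_Ropp, Rabs_pos_eq by apply pow2_ge_0. nra.
Qed.

Lemma lam_summable : ex_series (fun n => / Rabs (lam n)).
Proof.
  apply (@ex_series_le R_AbsRing R_CompleteNormedModule _ (fun n => 4 * / INR (S n) ^ 2)).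
  2: { apply (ex_series_scal_l 4 (fun n => / INR (S n) ^ 2)), inv_square_summable. }
  intros n. pose proof (lam_large n) as HL. change (Rabs (/ Rabs (lam n)) <= 4 * / INR (S n) ^ 2).
  rewrite Rabs_pos_eq by (left; apply Rinv_0_lt_compat; lra).
  assert (HS : 0 < INR (S n) ^ 2) by (apply pow_lt, lt_0_INR; lia).
  replace (4 * / INR (S n) ^ 2) with (/ (INR (S n) ^ 2 / 4)) by (field; apply not_0_INR; lia).
  apply Rinv_le_contravar; [lra|].
  destruct n as [|n].
  - simpl. lra.
  - destruct (lam_square_bound (S n)) as [H|H]; [|lia].
    apply Rle_trans with (lam (S n)); [|apply Rle_abs].
    rewrite (S_INR (S n)). assert (1 <= INR (S n)) by (apply (le_INR 1); lia). nra.
Qed.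

Lemma root_pow_summable p : ex_series (fun k => / x (S k) ^ (2 * S p)).
Proof.
  apply (@ex_series_le R_AbsRing R_CompleteNormedModule _ (fun n => / INR (S n) ^ 2)).
  2: apply inv_square_summable.
  intros n. change (Rabs (/ x (S n) ^ (2 * S p)) <= / INR (S n) ^ 2).
  pose proof (root_ge n) as Hr.
  assert (H1 : 1 <= INR (S n)) by (apply (le_INR 1); lia).
  rewrite Rabs_pos_eq by (left; apply Rinv_0_lt_compat, pow_lt; lra).
  apply Rinv_le_contravar; [apply pow_lt; lra|].
  apply Rle_trans with (x (S n) ^ 2); [apply pow_incr; lra|].
  apply Rle_pow; [lra | lia].
Qed.

Lemma odd_multiple_summable p : ex_series (fun m => / (INR (2 * m + 1) * PI) ^ (2 * S p)).
Proof.
  pose proof PI2_3_2 as Hpi.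
  apply (@ex_series_le R_AbsRing R_CompleteNormedModule _ (fun n => / INR (S n) ^ 2)).
  2: apply inv_square_summable.
  intros n. change (Rabs (/ (INR (2 * n + 1) * PI) ^ (2 * S p)) <= / INR (S n) ^ 2).
  assert (H1 : 1 <= INR (S n)) by (apply (le_INR 1); lia).
  assert (H2 : INR (S n) <= INR (2 * n + 1)) by (apply le_INR; lia).
  assert (H3 : INR (S n) <= INR (2 * n + 1) * PI) by nra.
  rewrite Rabs_pos_eq by (left; apply Rinv_0_lt_compat, pow_lt; lra).
  apply Rinv_le_contravar; [apply pow_lt; lra|].
  apply Rle_trans with ((INR (2 * n + 1) * PI) ^ 2); [apply pow_incr; lra|].
  apply Rle_pow; [lra | lia].
Qed.

(** The zeros [+- i alpha] of [cos t + t sin t] contribute the second term. *)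
Definition even_sum (p : nat) : R := root_power_sum x (2 * p) + (-1) ^ p / alpha ^ (2 * p).

Definition odd_sum (p : nat) : R := Series (fun m => / (INR (2 * m + 1) * PI) ^ (2 * p)).

Lemma lam_even_sum p :
  is_series (fun n => / lam (2 * n)%nat ^ S p) (even_sum (S p) / 4 ^ S p).
Proof.
  assert (H4 : 4 ^ S p <> 0) by (apply pow_nonzero; lra).
  apply is_series_decr_1. cbv beta.
  match goal with |- is_series _ ?v =>
    replace v with (/ 4 ^ S p * root_power_sum x (2 * S p)) end.
  - apply is_series_ext with (fun k => / 4 ^ S p * / x (S k) ^ (2 * S p)).
    + intros k. rewrite Leven, <- Rinv_mult. f_equal.
      rewrite <- pow_mult, Rpow_mult_distr, (pow_mult 2). do 2 f_equal. ring.
    + apply (is_series_scal_l (/ 4 ^ S p) (fun k => / x (S k) ^ (2 * S p))).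
      apply Series_correct, root_pow_summable.
  - change (/ 4 ^ S p * root_power_sum x (2 * S p)
            = even_sum (S p) / 4 ^ S p - / lam (2 * 0)%nat ^ S p).
    rewrite Nat.mul_0_r, L0. unfold even_sum.
    replace (- (2 * alpha) ^ 2) with (-1 * (4 * alpha ^ 2)) by ring.
    rewrite !Rpow_mult_distr, <- pow_mult.
    assert (Hm : (-1) ^ S p <> 0) by (apply pow_nonzero; lra).
    replace (/ ((-1) ^ S p * (4 ^ S p * alpha ^ (2 * S p))))
      with ((-1) ^ S p / (4 ^ S p * alpha ^ (2 * S p))).
    + field. split; [apply pow_nonzero; lra | auto].
    + apply Rmult_eq_reg_l with ((-1) ^ S p); auto.
      replace ((-1) ^ S p * ((-1) ^ S p / (4 ^ S p * alpha ^ (2 * S p))))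
        with ((-1) ^ S p * (-1) ^ S p / (4 ^ S p * alpha ^ (2 * S p)))
        by (unfold Rdiv; ring).
      rewrite pow_m1_sq. field. repeat split; auto; apply pow_nonzero; lra.
Qed.

Lemma odd_sum_nonneg p : 0 <= odd_sum (S p).
Proof.
  apply (psum_le_Series (fun m => / (INR (2 * m + 1) * PI) ^ (2 * S p)) 0).
  - intros m. left. apply Rinv_0_lt_compat, pow_lt, Rmult_lt_0_compat; [|apply PI_RGT_0].
    apply lt_0_INR. lia.
  - apply odd_multiple_summable.
Qed.

Lemma lam_odd_sum p :
  is_series (fun n => / lam (2 * n + 1)%nat ^ S p) (odd_sum (S p)).
Proof.
  apply is_series_ext with (fun m => / (INR (2 * m + 1) * PI) ^ (2 * S p)).
  - intros m. rewrite Lodd, <- pow_mult. reflexivity.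
  - apply Series_correct, odd_multiple_summable.
Qed.

Lemma lam_sum p :
  is_series (fun n => / lam n ^ S p) (even_sum (S p) / 4 ^ S p + odd_sum (S p)).
Proof.
  apply (is_series_interleave (fun n => / lam n ^ S p));
    [apply lam_even_sum | apply lam_odd_sum].
Qed.

(** The bound is known with [alpha] replaced by any smaller [beta > 1]; it passes
    to the limit. *)
Lemma even_sum_2_lower_bound : / 2 <= even_sum 2.
Proof.
  pose proof (root_pow_summable 1) as Hex. change (2 * 2)%nat with 4%nat in Hex.
  unfold even_sum, root_power_sum. change (2 * 2)%nat with 4%nat.
  set (S4 := Series (fun k => / x (S k) ^ 4)).
  replace ((-1) ^ 2 / alpha ^ 4) with (/ alpha ^ 4) by (field; lra).
  apply Rnot_lt_le. intros Hlt.
  assert (Hc : continuity_pt (fun b => / b ^ 4) alpha).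
  { apply derivable_continuous_pt, ex_derive_Reals_0. auto_derive.
    repeat apply Rmult_integral_contrapositive_currified; lra. }
  destruct (Hc (/ 2 - (S4 + / alpha ^ 4)) ltac:(lra)) as [d [Hd HD]].
  set (e := Rmin (d / 2) ((alpha - 1) / 2)).
  assert (He : 0 < e) by (apply Rmin_pos; lra).
  pose proof (Rmin_l (d / 2) ((alpha - 1) / 2)) as He1.
  pose proof (Rmin_r (d / 2) ((alpha - 1) / 2)) as He2. fold e in He1, He2.
  assert (HDe : Rabs (/ (alpha - e) ^ 4 - / alpha ^ 4) < / 2 - (S4 + / alpha ^ 4)).
  { apply (HD (alpha - e)). split; [split; [exact I | lra]|].
    simpl. unfold R_dist. replace (alpha - e - alpha) with (- e) by ring.
    rewrite Rabs_Ropp, Rabs_pos_eq; lra. }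
  apply Rabs_def2 in HDe.
  pose proof (hyperbolic_char_increasing (alpha - e) alpha ltac:(lra) ltac:(lra)) as Hh.
  assert (Hexp : (alpha - e - 1) * exp (alpha - e) < (alpha - e + 1) * exp (- (alpha - e))).
  { rewrite Ea in Hh. unfold sinh, cosh in Hh. lra. }
  pose proof (even_power_sum_lower_bound x (alpha - e) Hloc Hex ltac:(lra) Hexp) as K.
  fold S4 in K. lra.
Qed.

Lemma odd_sum_2_lower_bound : / 96 <= odd_sum 2.
Proof.
  pose proof (odd_multiple_summable 1) as Hex. change (2 * 2)%nat with 4%nat in Hex.
  assert (E : forall m, / (INR (S m) * PI - PI / 2) ^ 4 = 16 * / (INR (2 * m + 1) * PI) ^ 4).
  { intros m. rewrite S_INR, plus_INR, mult_INR. simpl (INR 2). simpl (INR 1).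
    pose proof (pos_INR m). pose proof PI_RGT_0. field.
    split; [lra|]. split; nra. }
  assert (Hex' : ex_series (fun m => / (INR (S m) * PI - PI / 2) ^ 4)).
  { apply ex_series_ext with (fun m => 16 * / (INR (2 * m + 1) * PI) ^ 4).
    - intros; symmetry; apply E.
    - apply (ex_series_scal_l 16 (fun m => / (INR (2 * m + 1) * PI) ^ 4)). exact Hex. }
  pose proof (odd_power_sum_lower_bound Hex') as K.
  rewrite (Series_ext _ _ E), Series_scal_l in K.
  unfold odd_sum. change (2 * 2)%nat with 4%nat. lra.
Qed.

Definition spectral_fun (n : nat) : R -> R := fst (proj1_sig (eigenfunction n)).
Definition spectral_fun_derivative (n : nat) : R -> R := snd (proj1_sig (eigenfunction n)).

Lemma spectral_eigenbasis :
  (forall n m, n <> m -> lam n <> lam m) ->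
  eigenbasis lam spectral_fun spectral_fun_derivative.
Proof.
  intros Hd. constructor; unfold spectral_fun, spectral_fun_derivative;
    try (intros n; intros; destruct (eigenfunction n) as [f Hf]; simpl;
         tauto || (apply Hf; auto)).
  - apply lam_large.
  - exact Hd.
  - apply lam_summable.
  - rewrite (is_series_unique _ _ (lam_sum 1)).
    pose proof even_sum_2_lower_bound. pose proof odd_sum_2_lower_bound. lra.
Qed.

End Spectrum.

(** * Recursion for the power sums of one parity *)

(** Test functions of parity [e] about the midpoint: each is an antiderivative of
    order two of the opposite of its predecessor, and the first one is, up to the
    factor [- kap], the parity part of the kernel with source at the left end. *)
Record parity_family (e kap : R) (q dq : nat -> R -> R) : Prop := {
  pf_sign : e * e = 1;
  pf_derive : forall j t, is_derive (q j) t (dq j t);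
  pf_derive_0 : forall t, is_derive (dq O) t 0;
  pf_derive_S : forall j t, is_derive (dq (S j)) t (- q j t);
  pf_left : forall j, q j 0 = e * q j 1;
  pf_left_derive : forall j, dq j 0 = - e * dq j 1;
  pf_bound : forall j t, 0 <= t <= 1 -> Rabs (q j t) <= 1;
  pf_kernel : forall z, 0 <= z <= 1 -> kernel 0 z + e * kernel 1 z = - kap * q O z;
  pf_end : kap * q O 1 = / 2 }.

Section Recursion.

Variables (lam : nat -> R) (psi dpsi : nat -> R -> R).
Hypothesis EB : eigenbasis lam psi dpsi.
Variables (e kap : R) (q dq : nat -> R -> R).
Hypothesis PF : parity_family e kap q dq.
Variable Z : nat -> R.
Hypothesis HZ : forall p, is_series (fun n => (1 + e * (-1) ^ n) / lam n ^ S p) (Z p).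

(** The boundary term of Green's formula between [q j] and an eigenfunction. *)
Definition green_weight (j : nat) : R := 2 * e * dq j 1 - (1 + e) ^ 2 * q j 1.

Definition green_sum (l : R) (j : nat) : R :=
  sum_f_R0 (fun i => green_weight i * / l ^ S (j - i)) j.

Lemma green_sum_S (l : R) (j : nat) : l <> 0 ->
  green_sum l (S j) = (green_sum l j + green_weight (S j)) / l.
Proof.
  intros Hl. unfold green_sum. rewrite tech5, Nat.sub_diag.
  unfold Rdiv. rewrite Rmult_plus_distr_r. f_equal.
  - rewrite Rmult_comm, scal_sum. apply sum_eq. intros i Hi.
    replace (S j - i)%nat with (S (j - i)) by lia. simpl.
    field. split; auto. apply pow_nonzero; auto.
  - rewrite pow_1. reflexivity.
Qed.

(** Green's formula trades [q (S j)] for [q j] at the price of one factor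
    [1 / lam n] and one boundary term; repeated down to [q 0] it gives a finite
    sum. *)
Lemma parity_pairing (n j : nat) : (-1) ^ n = e ->
  is_RInt (fun z => psi n z * q j z) 0 1 (green_sum (lam n) j).
Proof.
  intros He. pose proof (eb_nonzero _ _ _ EB n) as Hl.
  destruct (eb_pair _ _ _ EB n) as [F1 F2 F3 F4].
  pose proof (eb_left _ _ _ EB n) as V0. pose proof (eb_right _ _ _ EB n) as V1.
  rewrite He in V1. pose proof (pf_sign _ _ _ _ PF) as Hee.
  assert (D1 : dpsi n 1 = 1 + e) by lra.
  assert (D0 : dpsi n 0 = - (1 + e)) by lra.
  assert (Cq : forall i t, continuous (q i) t).
  { intros i. apply (derivative_continuous (q i) (dq i)), (pf_derive _ _ _ _ PF). }
  assert (Cp : forall t, continuous (psi n) t) by apply (derivative_continuous _ (dpsi n) F1).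
  assert (HB : forall i (ddq : R -> R), (forall t, is_derive (dq i) t (ddq t)) ->
    (forall t, continuous ddq t) ->
    is_RInt (fun z => psi n z * q i z + ddq z * psi n z / lam n) 0 1 (green_weight i / lam n)).
  { intros i ddq H Hc.
    apply is_RInt_antiderivative with
      (fun t => - (q i t * dpsi n t - dq i t * psi n t) / lam n).
    - intros t.
      assert (X1 : ex_derive (q i) t) by (eexists; apply (pf_derive _ _ _ _ PF)).
      assert (X2 : ex_derive (dq i) t) by (eexists; apply H).
      assert (X3 : ex_derive (psi n) t) by (eexists; apply F1).
      assert (X4 : ex_derive (dpsi n) t) by (eexists; apply F2).
      auto_derive; [repeat split; assumption|].
      rewrite (is_derive_unique (fun u : R => q i u) _ _ (pf_derive _ _ _ _ PF i t)),
        (is_derive_unique (fun u : R => dq i u) _ _ (H t)),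
        (is_derive_unique (fun u : R => psi n u) _ _ (F1 t)),
        (is_derive_unique (fun u : R => dpsi n u) _ _ (F2 t)). field. auto.
    - intros t. apply (@continuous_plus _ R_AbsRing R_NormedModule); [cont_mult; auto|].
      cont_mult; [cont_mult; auto | apply continuous_const].
    - unfold green_weight. rewrite (pf_left _ _ _ _ PF), (pf_left_derive _ _ _ _ PF),
        V0, V1, D0, D1. field. auto. }
  induction j as [|j IH].
  - apply is_RInt_ext with (fun z => psi n z * q O z + 0 * psi n z / lam n).
    + intros z _. real_eq. field. auto.
    + replace (green_sum (lam n) 0) with (green_weight 0 / lam n).
      * apply (HB O (fun _ => 0)); [apply (pf_derive_0 _ _ _ _ PF) | intros; apply continuous_const].
      * unfold green_sum. simpl. field. auto.
  - rewrite green_sum_S by auto.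
    apply is_RInt_ext with (fun z => plus (psi n z * q (S j) z + - q j z * psi n z / lam n)
       (scal (/ lam n) (psi n z * q j z))).
    + intros z _. change (psi n z * q (S j) z + - q j z * psi n z / lam n
         + / lam n * (psi n z * q j z) = psi n z * q (S j) z). field. auto.
    + replace ((green_sum (lam n) j + green_weight (S j)) / lam n)
        with (plus (green_weight (S j) / lam n) (scal (/ lam n) (green_sum (lam n) j))).
      * apply (@is_RInt_plus R_NormedModule).
        -- apply (HB (S j) (fun t => - q j t)); [apply (pf_derive_S _ _ _ _ PF)|].
           intros t. apply (@continuous_opp _ R_AbsRing R_NormedModule), Cq.
        -- apply (@is_RInt_scal R_NormedModule), IH.
      * change (green_weight (S j) / lam n + / lam n * green_sum (lam n) j
          = (green_sum (lam n) j + green_weight (S j)) / lam n). field. auto.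
Qed.

Lemma parity_weight (n : nat) : (-1) ^ n = e \/ 1 + e * (-1) ^ n = 0.
Proof.
  pose proof (pow_m1_sq n). pose proof (pf_sign _ _ _ _ PF) as Hee.
  assert (((-1) ^ n - e) * (1 + e * (-1) ^ n) = 0).
  { replace (((-1) ^ n - e) * (1 + e * (-1) ^ n))
      with ((-1) ^ n - e + e * ((-1) ^ n * (-1) ^ n) - (e * e) * (-1) ^ n) by ring.
    rewrite H, Hee. ring. }
  apply Rmult_integral in H0. destruct H0; [left | right]; lra.
Qed.

Definition parity_coef (n : nat) : R := 2 * (1 + e * (-1) ^ n) / lam n.

(** Both end points are used as sources because an eigenfunction takes the values
    [1] and [(-1)^n] there, so one parity drops out. *)
Lemma parity_kernel_expansion z : 0 <= z <= 1 ->
  kernel 0 z + e * kernel 1 z = Series (fun n => parity_coef n * psi n z).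
Proof.
  intros Hz.
  assert (Hex : forall x, 0 <= x <= 1 -> ex_series (fun n => mercer_coef lam psi x n * psi n z)).
  { intros x Hx.
    apply (@ex_series_le R_AbsRing R_CompleteNormedModule _ (fun n => 4 * / Rabs (lam n) * 2)).
    - intros n. change (Rabs (mercer_coef lam psi x n * psi n z) <= 4 * / Rabs (lam n) * 2).
      rewrite Rabs_mult. apply Rmult_le_compat; auto using Rabs_pos.
      + apply (mercer_coef_bound _ _ _ EB); auto.
      + apply (eb_bound _ _ _ EB); auto.
    - apply (ex_series_scal_r 2), (mercer_bound_summable _ _ _ EB). }
  rewrite !(mercer _ _ _ EB) by lra. unfold mercer_sum.
  rewrite <- Series_scal_l, <- Series_plus.
  - apply Series_ext. intros n. unfold mercer_coef, parity_coef.
    rewrite (eb_left _ _ _ EB), (eb_right _ _ _ EB). field. apply (eb_nonzero _ _ _ EB).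
  - apply Hex. lra.
  - apply (ex_series_scal_l e (fun n => mercer_coef lam psi 1 n * psi n z)), Hex. lra.
Qed.

Lemma parity_sum_first : Z O = - e / 4.
Proof.
  pose proof (parity_kernel_expansion 1 ltac:(lra)) as E.
  rewrite (Series_ext _ (fun n => 2 * e * ((1 + e * (-1) ^ n) / lam n ^ 1))) in E.
  - rewrite Series_scal_l, (is_series_unique _ _ (HZ O)) in E.
    rewrite kernel_le, kernel_ge in E by lra.
    pose proof (pf_sign _ _ _ _ PF). nra.
  - intros n. unfold parity_coef. rewrite (eb_right _ _ _ EB).
    pose proof (pf_sign _ _ _ _ PF) as Hee.
    transitivity (2 * ((-1) ^ n + e * ((-1) ^ n * (-1) ^ n)) / lam n);
      [field; apply (eb_nonzero _ _ _ EB)|].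
    transitivity (2 * (e + (e * e) * (-1) ^ n) / lam n);
      [rewrite pow_m1_sq, Hee | ]; field; apply (eb_nonzero _ _ _ EB).
Qed.

Lemma parity_green_series (k m : nat) :
  is_series (fun n => sum_f_R0 (fun i =>
      green_weight i * ((1 + e * (-1) ^ n) / lam n ^ S (S (k - i)))) m)
    (sum_f_R0 (fun i => green_weight i * Z (S (k - i))) m).
Proof.
  induction m as [|m IH].
  - apply (is_series_scal_l (green_weight 0) (fun n => (1 + e * (-1) ^ n) / lam n ^ S (S (k - 0)))).
    apply HZ.
  - rewrite tech5.
    apply is_series_ext with (fun n => plus (sum_f_R0 (fun i =>
      green_weight i * ((1 + e * (-1) ^ n) / lam n ^ S (S (k - i)))) m)
      (green_weight (S m) * ((1 + e * (-1) ^ n) / lam n ^ S (S (k - S m))))).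
    + intros n. rewrite tech5. reflexivity.
    + apply (is_series_plus (V := R_NormedModule)); auto.
      apply (is_series_scal_l (green_weight (S m))
        (fun n => (1 + e * (-1) ^ n) / lam n ^ S (S (k - S m)))).
      apply HZ.
Qed.

Lemma test_function_product (m : nat) :
  is_RInt (fun z => q O z * q m z) 0 1 (- 2 * (q O 1 * dq (S m) 1 - dq O 1 * q (S m) 1)).
Proof.
  pose proof (pf_sign _ _ _ _ PF) as Hee.
  apply is_RInt_antiderivative with (fun t => - (q O t * dq (S m) t - dq O t * q (S m) t)).
  - intros t.
    assert (X1 : forall j, ex_derive (q j) t) by (intros; eexists; apply (pf_derive _ _ _ _ PF)).
    assert (X2 : ex_derive (dq O) t) by (eexists; apply (pf_derive_0 _ _ _ _ PF)).
    assert (X3 : ex_derive (dq (S m)) t) by (eexists; apply (pf_derive_S _ _ _ _ PF)).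
    auto_derive; [repeat split; auto|].
    rewrite (is_derive_unique (fun u : R => q O u) _ _ (pf_derive _ _ _ _ PF O t)),
      (is_derive_unique (fun u : R => dq O u) _ _ (pf_derive_0 _ _ _ _ PF t)),
      (is_derive_unique (fun u : R => q (S m) u) _ _ (pf_derive _ _ _ _ PF (S m) t)),
      (is_derive_unique (fun u : R => dq (S m) u) _ _ (pf_derive_S _ _ _ _ PF m t)). ring.
  - intros t. cont_mult;
      [apply (derivative_continuous (q O) (dq O)) | apply (derivative_continuous (q m) (dq m))];
      apply (pf_derive _ _ _ _ PF).
  - rewrite !(pf_left _ _ _ _ PF), !(pf_left_derive _ _ _ _ PF).
    transitivity (- (1 + e * e) * (q O 1 * dq (S m) 1 - dq O 1 * q (S m) 1));
      [rewrite Hee; ring | ring].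
Qed.

(** The parity part of the kernel is a multiple of [q 0]. Integrated against
    [q m] it is a boundary term, by Green's formula, and also a series over the
    eigenvalues, by its expansion. *)
Lemma parity_recursion_shifted (m : nat) :
  sum_f_R0 (fun i => green_weight i * Z (S (m - i))) m
  = kap * (q O 1 * dq (S m) 1 - dq O 1 * q (S m) 1).
Proof.
  assert (HI : forall n, ex_RInt (fun t => psi n t * q m t) 0 1).
  { intros n. apply (@ex_RInt_continuous R_CompleteNormedModule). intros t _.
    cont_mult; [apply (eb_continuous _ _ _ EB)|].
    apply (derivative_continuous (q m) (dq m)), (pf_derive _ _ _ _ PF). }
  assert (Hco : forall n, Rabs (parity_coef n) <= 4 * / Rabs (lam n)).
  { intros n. unfold parity_coef, Rdiv. rewrite !Rabs_mult, Rabs_inv, (Rabs_right 2) by lra.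
    pose proof (eb_large _ _ _ EB n).
    apply Rmult_le_compat_r; [left; apply Rinv_0_lt_compat; lra|].
    destruct (parity_weight n) as [He|He].
    - rewrite <- He, pow_m1_sq, Rabs_right; lra.
    - rewrite He, Rabs_R0. lra. }
  destruct (expansion_RInt _ _ _ EB parity_coef (fun n => 4 * / Rabs (lam n)) (q m) 1 Hco)
    as [_ HS]; auto.
  - apply (mercer_bound_summable _ _ _ EB).
  - apply (pf_bound _ _ _ _ PF).
  - assert (E1 : RInt (fun t => Series (fun n => parity_coef n * psi n t) * q m t) 0 1
               = - kap * (- 2 * (q O 1 * dq (S m) 1 - dq O 1 * q (S m) 1))).
    { apply is_RInt_unique.
      apply is_RInt_ext with (fun t => scal (- kap) (q O t * q m t)).
      - intros t. rewrite Rmin_left, Rmax_right by lra. intros Ht.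
        rewrite <- parity_kernel_expansion, (pf_kernel _ _ _ _ PF) by lra.
        change (- kap * (q O t * q m t) = - kap * q O t * q m t). ring.
      - apply (@is_RInt_scal R_NormedModule), test_function_product. }
    rewrite E1 in HS.
    assert (E2 : is_series (fun n => parity_coef n * RInt (fun t => psi n t * q m t) 0 1)
      (2 * sum_f_R0 (fun i => green_weight i * Z (S (m - i))) m)).
    { apply is_series_ext with (fun n => 2 * sum_f_R0 (fun i =>
        green_weight i * ((1 + e * (-1) ^ n) / lam n ^ S (S (m - i)))) m).
      - intros n. pose proof (eb_nonzero _ _ _ EB n) as Hl.
        destruct (parity_weight n) as [He|H0].
        + rewrite (is_RInt_unique _ _ _ _ (parity_pairing n m He)).
          unfold green_sum, parity_coef.
          transitivity (2 * ((1 + e * (-1) ^ n) / lam n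
             * sum_f_R0 (fun i => green_weight i * / lam n ^ S (m - i)) m)).
          * f_equal. rewrite scal_sum.
            apply sum_eq. intros i _. simpl. field. split; auto. apply pow_nonzero; auto.
          * real_eq. unfold Rdiv. ring.
        + unfold parity_coef. rewrite H0.
          transitivity (2 * sum_f_R0 (fun _ => 0) m).
          * f_equal. apply sum_eq. intros i _. unfold Rdiv. ring.
          * rewrite sum_eq_R0 by auto. real_eq. unfold Rdiv. ring.
      - apply (is_series_scal_l 2 (fun n => sum_f_R0 (fun i =>
          green_weight i * ((1 + e * (-1) ^ n) / lam n ^ S (S (m - i)))) m)).
        apply parity_green_series. }
    apply is_series_unique in HS. apply is_series_unique in E2. lra.
Qed.

(** The missing term [i = m] contains the sum of the [1 / lam n] of that parity,
    known from the expansion at the end point. *)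
Lemma parity_recursion (m : nat) :
  sum_f_R0 (fun i => green_weight i * Z (m - i)) m
  = q m 1 * (e * (1 + e) ^ 2 / 4 - kap * dq O 1).
Proof.
  pose proof (pf_sign _ _ _ _ PF) as Hee. pose proof (pf_end _ _ _ _ PF) as Hk.
  destruct m as [|m].
  - simpl sum_f_R0. rewrite parity_sum_first. unfold green_weight.
    transitivity (- (e * e) * dq O 1 * / 2 + e * (1 + e) ^ 2 / 4 * q O 1); [field|].
    rewrite Hee, <- Hk. ring.
  - rewrite tech5, Nat.sub_diag, parity_sum_first.
    rewrite (sum_eq _ (fun i => green_weight i * Z (S (m - i)))).
    + rewrite parity_recursion_shifted. unfold green_weight.
      transitivity (kap * q O 1 * dq (S m) 1 - kap * dq O 1 * q (S m) 1
        - (e * e) * dq (S m) 1 * / 2 + e * (1 + e) ^ 2 / 4 * q (S m) 1); [field|].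
      rewrite Hee, Hk. field.
    + intros i Hi. replace (S m - i)%nat with (S (m - i)) by lia. reflexivity.
Qed.

End Recursion.

(** * Polynomial test functions and Bernoulli numbers *)

(** Signed divided powers: the Taylor terms of [cos] and [sin] about the midpoint,
    so that two derivatives send each one to minus its predecessor. *)
Definition test_even (j : nat) (t : R) : R :=
  (-1) ^ j * ((t - / 2) ^ (2 * j) / INR (fact (2 * j))).
Definition test_odd (j : nat) (t : R) : R :=
  (-1) ^ j * ((t - / 2) ^ (2 * j + 1) / INR (fact (2 * j + 1))).
Definition test_even_derivative (j : nat) (t : R) : R :=
  match j with O => 0 | S i => - test_odd i t end.

Lemma is_derive_divided_power (n : nat) (t : R) :
  is_derive (fun t => (t - / 2) ^ S n / INR (fact (S n))) t ((t - / 2) ^ n / INR (fact n)).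
Proof.
  replace ((t - / 2) ^ n / INR (fact n))
    with (INR (S n) * (t - / 2) ^ n / INR (fact (S n))).
  - generalize (INR_fact_neq_0 (S n)). generalize (INR (fact (S n))). intros c Hc.
    auto_derive; auto. unfold Rminus.
    change (1 * (INR (S n) * (t + - / 2) ^ n) * / c = INR (S n) * (t + - / 2) ^ n / c).
    field. auto.
  - rewrite fact_simpl, mult_INR. field. split; [apply INR_fact_neq_0 | apply not_0_INR; lia].
Qed.

Lemma test_odd_derive (j : nat) (t : R) : is_derive (test_odd j) t (test_even j t).
Proof.
  unfold test_odd, test_even. replace (2 * j + 1)%nat with (S (2 * j)) by lia.
  apply (is_derive_scal (fun t => (t - / 2) ^ S (2 * j) / INR (fact (S (2 * j))))).
  apply is_derive_divided_power.
Qed.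

Lemma test_even_derive (j : nat) (t : R) :
  is_derive (test_even j) t (test_even_derivative j t).
Proof.
  destruct j as [|j]; unfold test_even_derivative, test_even.
  - simpl. auto_derive; auto.
  - replace (- test_odd j t)
      with ((-1) ^ S j * ((t - / 2) ^ (2 * j + 1) / INR (fact (2 * j + 1))))
      by (unfold test_odd; simpl; ring).
    replace (2 * S j)%nat with (S (2 * j + 1)) by lia.
    apply (is_derive_scal (fun t => (t - / 2) ^ S (2 * j + 1) / INR (fact (S (2 * j + 1))))).
    apply is_derive_divided_power.
Qed.

Lemma divided_power_bound (n : nat) (t : R) : 0 <= t <= 1 ->
  Rabs ((t - / 2) ^ n / INR (fact n)) <= 1.
Proof.
  intros Ht. assert (Hf : 1 <= INR (fact n)) by (apply (le_INR 1), lt_O_fact).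
  unfold Rdiv. rewrite Rabs_mult, Rabs_inv, (Rabs_right (INR _)) by lra.
  rewrite <- RPow_abs. apply Rmult_le_reg_r with (INR (fact n)); [lra|].
  rewrite Rmult_assoc, Rinv_l by lra.
  assert (Rabs (t - / 2) ^ n <= 1 ^ n).
  { apply pow_incr. split; [apply Rabs_pos | apply Rabs_le; lra]. }
  rewrite pow1 in H. lra.
Qed.

Lemma pow_opp_even (a : R) (j : nat) : (- a) ^ (2 * j) = a ^ (2 * j).
Proof. rewrite !pow_mult. f_equal. ring. Qed.

Lemma pow_opp_odd (a : R) (j : nat) : (- a) ^ (2 * j + 1) = - a ^ (2 * j + 1).
Proof. rewrite !pow_add, pow_opp_even. simpl. ring. Qed.

Lemma test_even_left (j : nat) : test_even j 0 = test_even j 1.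
Proof.
  unfold test_even. replace (0 - / 2) with (- (1 - / 2)) by lra.
  rewrite pow_opp_even. reflexivity.
Qed.

Lemma test_odd_left (j : nat) : test_odd j 0 = - test_odd j 1.
Proof.
  unfold test_odd. replace (0 - / 2) with (- (1 - / 2)) by lra.
  rewrite pow_opp_odd. unfold Rdiv. ring.
Qed.

Lemma test_even_family : parity_family 1 (/ 2) test_even test_even_derivative.
Proof.
  constructor.
  - ring.
  - apply test_even_derive.
  - intros t. apply (@is_derive_const R_AbsRing R_NormedModule).
  - intros j t. apply (is_derive_opp (test_odd j)), test_odd_derive.
  - intros j. rewrite test_even_left. ring.
  - intros [|j]; simpl; [ring | rewrite test_odd_left; ring].
  - intros j t Ht. unfold test_even. rewrite Rabs_mult, pow_1_abs, Rmult_1_l.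
    apply divided_power_bound; auto.
  - intros z Hz. rewrite kernel_le, kernel_ge by lra. unfold test_even. simpl. field.
  - unfold test_even. simpl. field.
Qed.

Lemma test_odd_family : parity_family (-1) 1 test_odd test_even.
Proof.
  constructor.
  - ring.
  - apply test_odd_derive.
  - apply (test_even_derive 0).
  - intros j t. apply (test_even_derive (S j)).
  - intros j. rewrite test_odd_left. ring.
  - intros j. rewrite test_even_left. ring.
  - intros j t Ht. unfold test_odd. rewrite Rabs_mult, pow_1_abs, Rmult_1_l.
    apply divided_power_bound; auto.
  - intros z Hz. rewrite kernel_le, kernel_ge by lra. unfold test_odd. simpl. field.
  - unfold test_odd. simpl. field.
Qed.

Lemma parity_weighted_sum (lam : nat -> R) (e E O : R) (p : nat) :
  is_series (fun n => / lam (2 * n)%nat ^ p) E ->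
  is_series (fun n => / lam (2 * n + 1)%nat ^ p) O ->
  is_series (fun n => (1 + e * (-1) ^ n) / lam n ^ p) ((1 + e) * E + (1 - e) * O).
Proof.
  intros HE HO. apply (is_series_interleave (fun n => (1 + e * (-1) ^ n) / lam n ^ p)).
  - apply is_series_ext with (fun n => (1 + e) * / lam (2 * n)%nat ^ p).
    + intros n. rewrite (pow_mult (-1)). replace ((-1) ^ 2) with 1 by ring. rewrite pow1.
      unfold Rdiv. real_eq. ring.
    + apply (is_series_scal_l (1 + e) (fun n => / lam (2 * n)%nat ^ p)). exact HE.
  - apply is_series_ext with (fun n => (1 - e) * / lam (2 * n + 1)%nat ^ p).
    + intros n. rewrite (pow_add (-1)), (pow_mult (-1)).
      replace ((-1) ^ 2) with 1 by ring. rewrite pow1. unfold Rdiv. simpl. ring.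
    + apply (is_series_scal_l (1 - e) (fun n => / lam (2 * n + 1)%nat ^ p)). exact HO.
Qed.

Lemma half_pow_even (i : nat) : (1 - / 2) ^ (2 * i) = / 4 ^ i.
Proof.
  rewrite pow_mult, <- pow_inv. f_equal. field.
Qed.

(** [D i] and [Q i], the end values of [test_even_derivative i] and [test_even i], have
    the ratio [4 i], so the weight [2 D i - 4 Q i] is proportional to [2 i - 1]. *)
Lemma even_recursion (lam : nat -> R) (psi dpsi : nat -> R -> R) (E O : nat -> R) :
  eigenbasis lam psi dpsi ->
  (forall p, is_series (fun n => / lam (2 * n)%nat ^ S p) (E p)) ->
  (forall p, is_series (fun n => / lam (2 * n + 1)%nat ^ S p) (O p)) ->
  forall m, sum_f_R0 (fun i => (-1) ^ i * (2 * INR i - 1) / INR (fact (2 * i))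
                               * (4 ^ S (m - i) * E (m - i)%nat)) m
            = (-1) ^ m / (2 * INR (fact (2 * m))).
Proof.
  intros EB HE HO m.
  pose proof (parity_recursion lam psi dpsi EB 1 (/ 2) test_even test_even_derivative
    test_even_family (fun p => (1 + 1) * E p + (1 - 1) * O p)
    (fun p => parity_weighted_sum lam 1 (E p) (O p) (S p) (HE p) (HO p)) m) as R.
  simpl (test_even_derivative 0 1) in R.
  assert (H4 : forall i, 4 ^ i <> 0) by (intros; apply pow_nonzero; lra).
  assert (Q : test_even m 1 = (-1) ^ m / (4 ^ m * INR (fact (2 * m)))).
  { unfold test_even. rewrite half_pow_even. field. split; auto. apply INR_fact_neq_0. }
  apply Rmult_eq_reg_l with (2 / 4 ^ m).
  2: { apply Rmult_integral_contrapositive_currified; [lra|]. apply Rinv_neq_0_compat; auto. }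
  transitivity (test_even m 1 * (1 * (1 + 1) ^ 2 / 4 - / 2 * 0)).
  2: { rewrite Q. field. split; auto. apply INR_fact_neq_0. }
  rewrite <- R, scal_sum. apply sum_eq. intros i Hi.
  assert (D : test_even_derivative i 1
              = 4 * INR i * ((-1) ^ i / (4 ^ i * INR (fact (2 * i))))).
  { destruct i as [|i]; [simpl; ring|].
    unfold test_even_derivative, test_odd.
    replace (2 * S i)%nat with (S (2 * i + 1)) by lia.
    rewrite fact_simpl, mult_INR, pow_add, half_pow_even, pow_1.
    replace (INR (S (2 * i + 1))) with (2 * INR (S i))
      by (rewrite !S_INR, plus_INR, mult_INR; simpl; ring).
    simpl. field. repeat split; auto; [apply INR_fact_neq_0 | apply (not_0_INR (S i)); lia]. }
  unfold green_weight. rewrite D. unfold test_even. rewrite half_pow_even.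
  replace (4 ^ m) with (4 ^ i * 4 ^ (m - i)) by (rewrite <- pow_add; f_equal; lia).
  simpl (4 ^ S _). field. repeat split; auto. apply INR_fact_neq_0.
Qed.

Lemma odd_recursion (lam : nat -> R) (psi dpsi : nat -> R -> R) (E O : nat -> R) :
  eigenbasis lam psi dpsi ->
  (forall p, is_series (fun n => / lam (2 * n)%nat ^ S p) (E p)) ->
  (forall p, is_series (fun n => / lam (2 * n + 1)%nat ^ S p) (O p)) ->
  forall m, sum_f_R0 (fun i => test_even i 1 * O (m - i)%nat) m = test_odd m 1 / 4.
Proof.
  intros EB HE HO m.
  pose proof (parity_recursion lam psi dpsi EB (-1) 1 test_odd test_even
    test_odd_family (fun p => (1 + -1) * E p + (1 - -1) * O p)
    (fun p => parity_weighted_sum lam (-1) (E p) (O p) (S p) (HE p) (HO p)) m) as R.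
  assert (Q0 : test_even 0 1 = 1) by (unfold test_even; simpl; field).
  rewrite Q0 in R.
  apply Rmult_eq_reg_l with (-4); [|lra].
  transitivity (test_odd m 1 * (-1 * (1 + -1) ^ 2 / 4 - 1 * 1)); [|field].
  rewrite <- R, scal_sum. apply sum_eq. intros i Hi. unfold green_weight. ring.
Qed.

Lemma is_series_even_terms (c : nat -> R) (l : R) :
  is_series c l -> (forall n, c (2 * n + 1)%nat = 0) -> is_series (fun n => c (2 * n)%nat) l.
Proof.
  intros H H0.
  assert (E : forall n, sum_n c (2 * n) = sum_n (fun k => c (2 * k)%nat) n).
  { induction n as [|n IH]; [rewrite !sum_O; reflexivity|].
    replace (2 * S n)%nat with (S (S (2 * n))) by lia.
    rewrite !sum_Sn, IH. replace (S (2 * n)) with (2 * n + 1)%nat by lia.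
    rewrite H0. replace (2 * S n)%nat with (S (2 * n + 1)) by lia.
    unfold plus; simpl. ring. }
  unfold is_series. apply filterlim_ext with (fun n => sum_n c (2 * n)); auto.
  apply filterlim_comp with (2 := H). apply eventually_subseq. intros n. lia.
Qed.

Lemma is_series_odd_terms (c : nat -> R) (l : R) :
  is_series c l -> (forall n, c (2 * n)%nat = 0) -> is_series (fun n => c (2 * n + 1)%nat) l.
Proof.
  intros H H0.
  apply is_series_ext with (fun n => c (S (2 * n))).
  - intros n. f_equal. lia.
  - apply (is_series_even_terms (fun n => c (S n))).
    + apply is_series_incr_1. pose proof (H0 O) as Hc. change (2 * 0)%nat with O in Hc.
      rewrite Hc. change (is_series c (l + 0)). rewrite Rplus_0_r. exact H.
    + intros n. replace (S (2 * n + 1)) with (2 * S n)%nat by lia. auto.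
Qed.

Lemma pseries_even_part (a : nat -> R) (t l1 l2 : R) :
  is_series (fun n => a n * t ^ n) l1 -> is_series (fun n => a n * (- t) ^ n) l2 ->
  is_series (fun n => a (2 * n)%nat * (t ^ 2) ^ n) ((l1 + l2) / 2).
Proof.
  intros H1 H2.
  assert (H : is_series (fun n => / 2 * (a n * t ^ n + a n * (- t) ^ n)) ((l1 + l2) / 2)).
  { replace ((l1 + l2) / 2) with (/ 2 * (l1 + l2)) by field.
    apply (is_series_scal_l (/ 2) (fun n => a n * t ^ n + a n * (- t) ^ n)).
    apply (is_series_plus (V := R_NormedModule) _ _ _ _ H1 H2). }
  apply is_series_even_terms in H.
  - apply is_series_ext with (2 := H). intros n. rewrite pow_opp_even, <- pow_mult. real_eq. field.
  - intros n. rewrite pow_opp_odd. field.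
Qed.

Lemma pseries_odd_part (a : nat -> R) (t l1 l2 : R) : t <> 0 ->
  is_series (fun n => a n * t ^ n) l1 -> is_series (fun n => a n * (- t) ^ n) l2 ->
  is_series (fun n => a (2 * n + 1)%nat * (t ^ 2) ^ n) ((l1 - l2) / (2 * t)).
Proof.
  intros Ht H1 H2.
  assert (H : is_series (fun n => / (2 * t) * (a n * t ^ n - a n * (- t) ^ n))
                ((l1 - l2) / (2 * t))).
  { replace ((l1 - l2) / (2 * t)) with (/ (2 * t) * (l1 - l2)) by (field; auto).
    apply (is_series_scal_l (/ (2 * t)) (fun n => a n * t ^ n - a n * (- t) ^ n)).
    apply (is_series_minus (V := R_NormedModule) _ _ _ _ H1 H2). }
  apply is_series_odd_terms in H.
  - apply is_series_ext with (2 := H). intros n.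
    rewrite pow_opp_odd, pow_add, <- pow_mult. real_eq. field. auto.
  - intros n. rewrite pow_opp_even. field. auto.
Qed.

Lemma is_pseries_R (a : nat -> R) (y l : R) :
  is_pseries a y l <-> is_series (fun n => a n * y ^ n) l.
Proof.
  assert (E : forall n, pow_n (K := R_Ring) y n * a n = a n * y ^ n).
  { intros n. rewrite pow_n_pow. ring. }
  split; intros H; apply is_series_ext with (2 := H); intros n;
    [apply E | symmetry; apply E].
Qed.

(** Coefficients of [cosh (t / 2)] and [sinh (t / 2) / (4 t)] in powers of [t^2]. *)
Definition cosh_coef (i : nat) : R := / 4 ^ i / INR (fact (2 * i)).
Definition sinh_coef (i : nat) : R := / 4 ^ i / INR (fact (2 * i + 1)) / 8.

Lemma exp_series (t : R) : is_series (fun n => / INR (fact n) * t ^ n) (exp t).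
Proof. apply is_pseries_R, is_exp_Reals. Qed.

Lemma cosh_pseries (t : R) : is_pseries cosh_coef (t ^ 2) (cosh (t / 2)).
Proof.
  apply is_pseries_R.
  apply is_series_ext with (fun n => / INR (fact (2 * n)) * ((t / 2) ^ 2) ^ n).
  - intros n. unfold cosh_coef. replace ((t / 2) ^ 2) with (/ 4 * t ^ 2) by field.
    rewrite Rpow_mult_distr, pow_inv. unfold Rdiv. real_eq. ring.
  - unfold cosh. apply (pseries_even_part (fun n => / INR (fact n))); apply exp_series.
Qed.

Lemma sinh_pseries (t : R) : t <> 0 ->
  is_pseries sinh_coef (t ^ 2) (sinh (t / 2) / (4 * t)).
Proof.
  intros Ht. apply is_pseries_R.
  apply is_series_ext with (fun n => / 8 * (/ INR (fact (2 * n + 1)) * ((t / 2) ^ 2) ^ n)).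
  - intros n. unfold sinh_coef. replace ((t / 2) ^ 2) with (/ 4 * t ^ 2) by field.
    rewrite Rpow_mult_distr, pow_inv. unfold Rdiv. real_eq. ring.
  - replace (sinh (t / 2) / (4 * t)) with (/ 8 * ((exp (t / 2) - exp (- (t / 2))) / (2 * (t / 2))))
      by (unfold sinh; field; auto).
    apply (is_series_scal_l (/ 8) (fun n => / INR (fact (2 * n + 1)) * ((t / 2) ^ 2) ^ n)).
    apply (pseries_odd_part (fun n => / INR (fact n))); try apply exp_series. lra.
Qed.

Lemma is_pseries_radius (a : nat -> R) (y z l : R) :
  is_pseries a z l -> Rabs y < Rabs z -> Rbar_lt (Rabs y) (CV_radius a).
Proof.
  intros H Hyz. apply Rbar_lt_le_trans with (Rabs z); [exact Hyz|].
  apply Rbar_not_lt_le. intros Hlt. apply (CV_disk_outside a z Hlt).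
  apply is_pseries_R in H. apply ex_series_lim_0. exists l. exact H.
Qed.

Lemma pseries_zero_right_head (d : nat -> R) (del : R) : 0 < del ->
  (forall y, 0 < y < del -> is_pseries d y 0) -> d O = 0.
Proof.
  intros Hdel H.
  assert (HR : Rbar_lt (Rabs 0) (CV_radius d)).
  { apply (is_pseries_radius d 0 (del / 2) 0); [apply H; lra|].
    rewrite Rabs_R0, Rabs_pos_eq; lra. }
  pose proof (proj1 (continuity_pt_filterlim _ _) (PSeries_continuity d 0 HR)) as Hc.
  rewrite <- (PSeries_0 d). apply cond_eq. intros eps Heps.
  destruct (proj1 (filterlim_locally _ _) Hc (mkposreal eps Heps)) as [r Hr].
  pose proof (cond_pos r) as Hr0.
  set (y := Rmin (del / 2) (r / 2)).
  assert (Hy : 0 < y) by (apply Rmin_pos; lra).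
  pose proof (Rmin_l (del / 2) (r / 2)) as Hy1.
  pose proof (Rmin_r (del / 2) (r / 2)) as Hy2. fold y in Hy1, Hy2.
  assert (Hb : ball (0 : R) r y).
  { change (Rabs (y - 0) < r). rewrite Rminus_0_r, Rabs_pos_eq; lra. }
  specialize (Hr y Hb). rewrite (is_pseries_unique _ _ _ (H y ltac:(lra))) in Hr.
  rewrite Rabs_minus_sym. exact Hr.
Qed.

(** Identities between power series in [y = t^2] are available for [y > 0] only, so
    the coefficients must be determined from one side. *)
Lemma pseries_zero_right (n : nat) : forall (d : nat -> R) (del : R), 0 < del ->
  (forall y, 0 < y < del -> is_pseries d y 0) -> d n = 0.
Proof.
  induction n as [|n IH]; intros d del Hdel H.
  - apply (pseries_zero_right_head d del); auto.
  - apply (IH (PS_decr_1 d) del Hdel). intros y Hy.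
    pose proof (is_pseries_decr_1 d y (/ y) 0) as K.
    rewrite (pseries_zero_right_head d del Hdel H) in K.
    replace 0 with (scal (/ y) (plus 0 (opp 0))) by (unfold scal, plus, opp; simpl; unfold mult; simpl; ring).
    apply K; auto. change (/ y * y = 1). field. lra.
Qed.

(** Averaging over [t] and [- t] leaves the terms of even index and turns
    [t / (e^t - 1)] into [(t/2) coth (t/2)]. *)
Lemma bernoulli_even_series (B : nat -> R) (r t : R) :
  (forall x, 0 < Rabs x < r ->
      is_series (fun n => B n / INR (fact n) * x ^ n) (x / (exp x - 1))) ->
  0 < t < r ->
  is_series (fun n => B (2 * n)%nat / INR (fact (2 * n)) * (t ^ 2) ^ n)
    (t / 2 * (cosh (t / 2) / sinh (t / 2))).
Proof.
  intros HB Ht.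
  assert (Hs : 0 < sinh (t / 2)) by (apply sinh_pos; lra).
  assert (He : exp t - 1 = 2 * exp (t / 2) * sinh (t / 2)).
  { replace t with (t / 2 + t / 2) at 1 by field. unfold sinh. rewrite exp_plus, exp_Ropp.
    field. apply Rgt_not_eq, exp_pos. }
  assert (He' : exp (- t) - 1 = - 2 * exp (- (t / 2)) * sinh (t / 2)).
  { replace (- t) with (- (t / 2) + - (t / 2)) at 1 by field. unfold sinh.
    rewrite exp_plus, exp_Ropp. field. apply Rgt_not_eq, exp_pos. }
  replace (t / 2 * (cosh (t / 2) / sinh (t / 2)))
    with ((t / (exp t - 1) + - t / (exp (- t) - 1)) / 2).
  - apply (pseries_even_part (fun n => B n / INR (fact n))); apply HB.
    + rewrite Rabs_pos_eq; lra.
    + rewrite Rabs_Ropp, Rabs_pos_eq; lra.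
  - rewrite He, He'. unfold cosh. rewrite exp_Ropp.
    pose proof (exp_pos (t / 2)). field. lra.
Qed.

Definition bernoulli_coef (B : nat -> R) (p : nat) : R :=
  (4 ^ S p - 1) / (2 * INR (fact (2 * S p))) * B (2 * S p)%nat.

(** [t coth t - (t/2) coth (t/2) = (t/2) tanh (t/2)]. *)
Lemma bernoulli_tanh_pseries (B : nat -> R) (r t : R) :
  (forall x, 0 < Rabs x < r ->
      is_series (fun n => B n / INR (fact n) * x ^ n) (x / (exp x - 1))) ->
  0 < t < r / 2 ->
  is_pseries (bernoulli_coef B) (t ^ 2) (sinh (t / 2) / cosh (t / 2) / (4 * t)).
Proof.
  intros HB Ht. apply is_pseries_R.
  pose proof (bernoulli_even_series B r t HB ltac:(lra)) as H1.
  pose proof (bernoulli_even_series B r (2 * t) HB ltac:(lra)) as H2.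
  pose proof (is_series_minus (V := R_NormedModule) _ _ _ _ H2 H1) as H3.
  pose proof (is_series_scal_l (K := R_AbsRing) (V := R_NormedModule) (/ (2 * t ^ 2)) _ _ H3) as H4.
  set (v := t / 2) in *. assert (Hv : 0 < v) by (unfold v; lra).
  assert (Et : t = v + v) by (unfold v; field).
  assert (Hs : 0 < sinh v) by (apply sinh_pos; lra).
  assert (Hc : 0 < cosh v) by apply cosh_pos.
  assert (E1 : sinh t = 2 * sinh v * cosh v).
  { rewrite Et. unfold sinh, cosh. rewrite Ropp_plus_distr, !exp_plus. field. }
  assert (E2 : cosh t = 2 * sinh v * sinh v + 1).
  { rewrite Et, <- (cosh_sinh_sq v). unfold sinh, cosh.
    rewrite Ropp_plus_distr, !exp_plus. field. }
  set (b := fun n => B (2 * n)%nat / INR (fact (2 * n))) in *.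
  assert (H5 : is_series (fun n => / (2 * t ^ 2) * (b (S n) * ((2 * t) ^ 2) ^ S n - b (S n) * (t ^ 2) ^ S n))
                 (sinh v / cosh v / (4 * t))).
  { apply (is_series_incr_1 (fun n => / (2 * t ^ 2) * (b n * ((2 * t) ^ 2) ^ n - b n * (t ^ 2) ^ n))).
    match type of H4 with is_series _ ?l => match goal with |- is_series _ ?l' =>
      replace l' with l end end; [exact H4|].
    match goal with |- _ = plus ?u _ => change (/ (2 * t ^ 2) * (2 * t / 2 * (cosh (2 * t / 2) / sinh (2 * t / 2))
         - v * (cosh v / sinh v))
      = u + / (2 * t ^ 2) * (b O * 1 - b O * 1)) end.
    replace (2 * t / 2) with t by field. rewrite E1, E2, Et.
    replace (2 * sinh v * sinh v + 1) with (cosh v * cosh v + sinh v * sinh v)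
      by (rewrite <- (cosh_sinh_sq v); ring).
    field. repeat split; lra. }
  apply is_series_ext with (2 := H5). intros n.
  replace ((2 * t) ^ 2) with (4 * t ^ 2) by ring.
  rewrite Rpow_mult_distr. unfold bernoulli_coef, b.
  rewrite <- !tech_pow_Rmult. real_eq. field. split; [apply INR_fact_neq_0 | lra].
Qed.

Lemma cosh_coef_0 : cosh_coef 0 = 1.
Proof. unfold cosh_coef. simpl. field. Qed.

(** The product of the series of [tanh (t/2) / (4 t)] and [cosh (t/2)] is that of
    [sinh (t/2) / (4 t)]. *)
Lemma bernoulli_recursion (B : nat -> R) (m : nat) : bernoulli_numbers B ->
  sum_f_R0 (fun k => bernoulli_coef B k * cosh_coef (m - k)) m = sinh_coef m.
Proof.
  intros [r [Hr HB]].
  apply Rminus_diag_uniq.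
  apply (pseries_zero_right m
    (PS_minus (PS_mult (bernoulli_coef B) cosh_coef) sinh_coef) ((r / 4) ^ 2)).
  - apply pow_lt. lra.
  - intros y Hy. set (t := sqrt y).
    assert (Ht : 0 < t) by (apply sqrt_lt_R0; lra).
    assert (Ey : y = t ^ 2) by (unfold t; rewrite pow2_sqrt; lra).
    assert (Htr : t < r / 4).
    { apply Rnot_le_lt. intros H.
      assert ((r / 4) ^ 2 <= t ^ 2) by (apply pow_incr; lra). lra. }
    pose proof (bernoulli_tanh_pseries B r t HB ltac:(lra)) as HT.
    pose proof (bernoulli_tanh_pseries B r (r / 3) HB ltac:(lra)) as HT'.
    pose proof (cosh_pseries t) as HC. pose proof (cosh_pseries r) as HC'.
    pose proof (sinh_pseries t ltac:(lra)) as HS.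
    rewrite Ey.
    assert (L : forall s, t < s -> Rabs (t ^ 2) < Rabs (s ^ 2)).
    { intros s Hs. rewrite !Rabs_pos_eq by apply pow2_ge_0. nra. }
    pose proof (is_pseries_mult _ _ _ _ _ HT HC
      (is_pseries_radius _ _ _ _ HT' (L (r / 3) ltac:(lra)))
      (is_pseries_radius _ _ _ _ HC' (L r ltac:(lra)))) as HM.
    pose proof (is_pseries_minus _ _ _ _ _ HM HS) as HD.
    match type of HD with is_pseries _ _ ?l => replace l with 0 in HD; [exact HD|] end.
    change (0 = sinh (t / 2) / cosh (t / 2) / (4 * t) * cosh (t / 2) - sinh (t / 2) / (4 * t)).
    pose proof (cosh_pos (t / 2)). field. split; lra.
Qed.

(** The leading coefficient 1 makes the convolution triangular. *)
Lemma convolution_unique (c u v : nat -> R) : c O = 1 ->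
  (forall m, sum_f_R0 (fun k => u k * c (m - k)%nat) m = sum_f_R0 (fun k => v k * c (m - k)%nat) m) ->
  forall m, u m = v m.
Proof.
  intros Hc H m. induction m as [m IH] using (well_founded_induction lt_wf).
  specialize (H m). destruct m as [|m].
  - simpl in H. rewrite Hc in H. lra.
  - rewrite !tech5, Nat.sub_diag, Hc in H.
    rewrite (sum_eq _ (fun k => v k * c (S m - k)%nat)) in H; [lra|].
    intros i Hi. rewrite IH by lia. reflexivity.
Qed.

(** After the sign change [(-1)^p], which turns [cos] and [sin] into [cosh] and [sinh],
    the odd power sums solve the same triangular system as the Bernoulli
    numbers. Being non-negative, they give the absolute values. *)
Lemma odd_sum_bernoulli (B O : nat -> R) :
  bernoulli_numbers B ->
  (forall m, sum_f_R0 (fun i => test_even i 1 * O (m - i)%nat) m = test_odd m 1 / 4) ->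
  (forall p, 0 <= O p) ->
  forall p, O p = (4 ^ S p - 1) / (2 * INR (fact (2 * S p))) * Rabs (B (2 * S p)%nat).
Proof.
  intros HB HO Hpos p.
  assert (E : forall k, bernoulli_coef B k = (-1) ^ k * O k).
  { apply (convolution_unique cosh_coef); [apply cosh_coef_0|].
    intros m. rewrite bernoulli_recursion by auto.
    assert (Q : sinh_coef m = (-1) ^ m * (test_odd m 1 / 4)).
    { unfold sinh_coef, test_odd. rewrite pow_add, half_pow_even.
      transitivity ((-1) ^ m * (-1) ^ m * (/ 4 ^ m / INR (fact (2 * m + 1)) / 8));
        [rewrite pow_m1_sq; ring|].
      field. repeat split; (apply INR_fact_neq_0 || (apply pow_nonzero; lra)). }
    rewrite Q, <- HO, scal_sum.
    rewrite <- (sum_f_R0_skip (fun k => (-1) ^ k * O k * cosh_coef (m - k))).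
    apply sum_eq. intros i Hi. replace (m - (m - i))%nat with i by lia.
    unfold test_even, cosh_coef. rewrite half_pow_even.
    replace ((-1) ^ m) with ((-1) ^ i * (-1) ^ (m - i)) by (rewrite <- pow_add; f_equal; lia).
    transitivity ((-1) ^ i * (-1) ^ i * ((-1) ^ (m - i) * O (m - i)%nat * (/ 4 ^ i / INR (fact (2 * i)))));
      [unfold Rdiv; ring | rewrite pow_m1_sq; ring]. }
  specialize (E p). unfold bernoulli_coef in E.
  assert (Hc : 0 <= (4 ^ S p - 1) / (2 * INR (fact (2 * S p)))).
  { apply Rdiv_le_0_compat.
    - pose proof (pow_R1_Rle 4 (S p) ltac:(lra)). lra.
    - pose proof (INR_fact_lt_0 (2 * S p)). lra. }
  rewrite <- (Rabs_pos_eq _ Hc), <- Rabs_mult, E, Rabs_mult, pow_1_abs, Rmult_1_l.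
  rewrite Rabs_pos_eq; auto.
Qed.

(** * Trace formula and recursion *)

Theorem theorem2 (lambda x B : nat -> R) (alpha : R)
  (Hlambda : increasing_enum 0 lambda bvp_eigenvalue)
  (Hx : increasing_enum 1 x positive_cot_root)
  (Halpha : 0 < alpha /\ alpha = coth alpha)
  (HB : bernoulli_numbers B) :
  (forall p : nat, (1 <= p)%nat ->
     ex_series (fun n => / lambda n ^ p) /\
     ex_RInt (fun t => iterK p t t) 0 1 /\
     Series (fun n => / lambda n ^ p) = RInt (fun t => iterK p t t) 0 1 /\
     RInt (fun t => iterK p t t) 0 1 =
       / 4 ^ p * (root_power_sum x (2 * p) + (-1) ^ p / alpha ^ (2 * p))
       + (4 ^ p - 1) / (2 * INR (fact (2 * p))) * Rabs (B (2 * p)%nat) /\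
     ex_series (fun k => / x (S k) ^ (2 * p)) /\
     ex_series (fun k => (4 / lambda (2 * S k)%nat) ^ p) /\
     root_power_sum x (2 * p) = Series (fun k => (4 / lambda (2 * S k)%nat) ^ p)) /\
  (forall n : nat,
     sum_n_m (fun l =>
       (-1) ^ (n + 1 - l) * (2 * INR (n + 1 - l) - 1)
         / INR (fact (2 * (n + 1 - l)))
         * (root_power_sum x (2 * l) + (-1) ^ l / alpha ^ (2 * l))) 1 (n + 1)
     = (-1) ^ n / (2 * INR (fact (2 * n)))).
Proof.
  destruct (eigenvalues_explicit lambda x alpha Hlambda Hx Halpha) as (L0 & Lodd & Leven).
  destruct (coth_fixed_point alpha Halpha) as [Ha Ea].
  pose proof (root_location x Hx) as Hloc.
  assert (Hd : forall n m, n <> m -> lambda n <> lambda m).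
  { intros n m Hnm. pose proof (increasing_enum_lt _ _ _ Hlambda) as M.
    destruct (Nat.lt_total n m) as [H|[H|H]]; [|lia|].
    - pose proof (M n m ltac:(lia) H). lra.
    - pose proof (M m n ltac:(lia) H). lra. }
  pose proof (spectral_eigenbasis lambda x alpha L0 Lodd Leven Ha Ea Hloc Hd) as EB.
  pose proof (lam_even_sum lambda x alpha L0 Leven Ha Hloc) as HE.
  pose proof (lam_odd_sum lambda Lodd) as HO.
  assert (HBO : forall p, odd_sum (S p)
    = (4 ^ S p - 1) / (2 * INR (fact (2 * S p))) * Rabs (B (2 * S p)%nat)).
  { intros p. apply (odd_sum_bernoulli B (fun p => odd_sum (S p))); auto.
    - apply (odd_recursion lambda _ _
        (fun p => even_sum x alpha (S p) / 4 ^ S p) (fun p => odd_sum (S p)) EB HE HO).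
    - intros k. apply odd_sum_nonneg. }
  split.
  - intros [|p] Hp; [lia|].
    pose proof (is_series_interleave (fun n => / lambda n ^ S p) _ _ (HE p) (HO p)) as HS.
    pose proof (iterK_trace _ _ _ EB p) as HT.
    assert (Hx0 : forall k, x (S k) <> 0).
    { intros k. pose proof (root_ge x Hloc k).
      assert (0 < INR (S k)) by (apply lt_0_INR; lia). lra. }
    assert (Ex : forall k, (4 / lambda (2 * S k)%nat) ^ S p = / x (S k) ^ (2 * S p)).
    { intros k. rewrite Leven, pow_mult, <- pow_inv. f_equal. field. auto. }
    pose proof (root_pow_summable x Hloc p) as HX.
    refine (conj _ (conj _ (conj _ (conj _ (conj _ (conj _ _)))))).
    + eexists; exact HS.
    + eexists; exact HT.
    + symmetry. apply is_RInt_unique. exact HT.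
    + rewrite (is_RInt_unique _ _ _ _ HT), (is_series_unique _ _ HS), HBO.
      real_eq. unfold even_sum, Rdiv. ring.
    + exact HX.
    + apply ex_series_ext with (2 := HX). intros k. symmetry. apply Ex.
    + unfold root_power_sum. apply Series_ext. intros k. symmetry. apply Ex.
  - intros n. rewrite <- (even_recursion lambda _ _
        (fun p => even_sum x alpha (S p) / 4 ^ S p) (fun p => odd_sum (S p)) EB HE HO n).
    rewrite Nat.add_1_r, <- sum_n_m_S.
    change (sum_n_m ?f 0 n) with (sum_n f n). rewrite sum_n_Reals.
    rewrite <- sum_f_R0_skip. apply sum_eq. intros i Hi.
    replace (S n - S (n - i))%nat with i by lia.
    replace (4 ^ S (n - i) * (even_sum x alpha (S (n - i)) / 4 ^ S (n - i)))
      with (even_sum x alpha (S (n - i))) by (field; apply pow_nonzero; lra).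
    reflexivity.
Qed.
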